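(* Let $F_0$ be a distribution on $\mathbb{R}_+$ with density $f_0$ and mean $1$, with associated age distribution $F$, hazard rate $\eta$, and observed hazard rate distributions $G$ (non-synchronized) and $G_0$ (synchronized). For each $N$, consider a local memory system with $N$ items, memory size $C_N$ (an integer, $1\le C_N<N$), and independent stationary renewal request processes $\Phi_1,\dots,\Phi_N$ with intensities $\lambda_1^{(N)}\ge\dots\ge\lambda_N^{(N)}>0$, where $\Phi_i$ has inter-arrival distribution $F_0(\lambda_i^{(N)}t)$. Assume: (i) $L_N(\lambda):=\frac1N\sum_{i=1}^N\mathbf{1}_{\{\lambda_i^{(N)}\le\lambda\}}$ converges weakly to a probability distribution $L$ with no atom at $0$; (ii) for each $N\ge1$ and $1\le i\ne j\le N$, $P^0_\Phi(X_i^{(N)}=X_j^{(N)})=0$, where $X_i^{(N)}$ are the observed hazard rates at time $0$ and $\Phi=\sum_{i=1}^N\Phi_i$. Suppose $\{L_N\}_{N\ge1}$ is uniformly integrable. Let $G_\infty(x)=\int_0^\infty G(x/\lambda)L(d\lambda)$ and let $Q_\infty$ be its quantile function. Let $c\in(0,1]$ be such that $1-c$ is a continuity point of $Q_\infty$ and that $\theta^*:=Q_\infty(1-c)\notin D_L\cdot D_{G_0}$. If $C_N/N\to c$ as $N\to\infty$, then the miss rate $m^{(N)}_{\mathcal{C}^*}$ of the optimal causal policy $\mathcal{C}^*$ satisfies $$\lim_{N\to\infty}\frac{m^{(N)}_{\mathcal{C}^*}}{N}=\int_0^\infty\lambda\,G_0\!\left(\frac{\theta^*}{\lambda}\right)L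(d\lambda).$$
   Context: Framework: $(\Omega,\mathcal{F},P)$ carries a measurable flow $\{\vartheta_t\}$ preserving $P$, and stationarity means compatibility with the flow. The Palm probability of a stationary point process $\Phi$ of intensity $\lambda=\mathrm{E}[\Phi((0,1])]$ is $P^0_\Phi(A)=\frac1\lambda\mathrm{E}[\int_{(0,1]}\mathbf{1}_A(\vartheta_s\omega)\Phi(ds)]$. A stationary renewal process is a stationary simple point process whose inter-arrival times are i.i.d. under its Palm probability. Base distributions: $F(t)=\int_0^t(1-F_0(s))ds$, $\eta(t)=f_0(t)/(1-F_0(t))$, $G(x)=\int_{\eta^{-1}([0,x])}F(dt)$, $G_0(x)=\int_{\eta^{-1}([0,x])}F_0(dt)$. Observed hazard rates: $\eta_i(t)=\lambda_i^{(N)}\eta(\lambda_i^{(N)}t)$ is the hazard rate of the $i$-th process, $\tau_i^-(t)$ is the last point of $\Phi_i$ strictly before $t$, the stochastic intensity of $\Phi_i$ with respect to its natural history is $\lambda_i(t)=\eta_i(t-\tau_i^-(t))$, and $X_i^{(N)}=\lambda_i(0)$. Optimal policy and miss rate: the storage policy $\mathcal{C}^*$ stores at every time $t$ the $C_N$ items with the largest values of $\lambda_i(t)$ (ties broken by an arbitrary deterministic rule). With $\lambda^N=\sum_{i=1}^N\lambda_i^{(N)}$ and hit process $\Psi_{\mathcal{C}^*}(B)=\sum_{i=1}^N\int_B\mathbf{1}_{\{i\in\mathcal{C}^*(t)\}}\Phi_i(dt)$, the hit rate is $h_{\mathcal{C}^*}=\mathrm{E}[\Psi_{\mathcal{C}^*}((0,1])]$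 and the miss rate is $m^{(N)}_{\mathcal{C}^*}=\lambda^N-h_{\mathcal{C}^*}=\sum_{i=1}^N\lambda_i^{(N)}P^0_{\Phi_i}(i\notin\mathcal{C}^*(0))$. $\{L_N\}$ is uniformly integrable if for every $\epsilon>0$ there is $K\ge0$ with $\sup_{N\ge1}\frac1N\sum_{i:\,\lambda_i^{(N)}\ge K}\lambda_i^{(N)}\le\epsilon$. $Q_\infty(p)=\inf\{x\ge0:G_\infty(x)\ge p\}$, $p\in[0,1]$. $D_L$ and $D_{G_0}$ are the sets of discontinuity points of $L$ and $G_0$, and $D_L\cdot D_{G_0}=\{\lambda x:\lambda\in D_L,\ x\in D_{G_0}\}$. *)

(* Defs.v *)
From mathcomp Require Import all_boot all_order all_algebra.
From mathcomp Require Import all_classical all_reals all_analysis.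
From mathcomp Require Import measurable_realfun.

Set Implicit Arguments.
Unset Strict Implicit.
Unset Printing Implicit Defensive.

Import Order.TTheory GRing.Theory Num.Theory.
Import numFieldNormedType.Exports.

Local Open Scope classical_set_scope.
Local Open Scope ring_scope.
Local Open Scope ereal_scope.

Definition dist_fun {R : realType} (mu : set R -> \bar R) (x : R) : R :=
  fine (mu `]-oo, x]%classic).

Definition discontinuities {R : realType} (f : R -> R) : set R :=
  [set x | ~ {for x, continuous f}].

(* Weak convergence of distribution functions: pointwise convergence at the
   continuity points of the limit. *)
Definition cvg_weakly {R : realType} (F_ : nat -> R -> R) (F : R -> R) : Prop :=
  forall x : R, {for x, continuous F} -> F_ N x @[N --> \oo] --> F x.

(* Mutual independence of a family of classes of events; [P] is only a set
   function, so that it applies to Palm probabilities as defined below. *)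
Definition mutually_independent {R : realType} {T : Type} {I : eqType}
    (P : set T -> \bar R) (G : I -> set (set T)) : Prop :=
  forall (s : seq I) (A : I -> set T), uniq s ->
    (forall i, i \in s -> G i (A i)) ->
    P (\bigcap_(i in [set` s]) A i) = \big[*%E/1]_(i <- s) P (A i).

Definition has_density {R : realType} (F0 : probability R R) (f0 : R -> R)
    : Prop :=
  [/\ measurable_fun [set: R] f0, forall t, (0 <= f0 t)%R &
      forall A : set R, measurable A ->
        F0 A = \int[lebesgue_measure]_(t in A) (f0 t)%:E].

(* The measure F(dt) with distribution function
   F(t) = \int_0^t (1 - F_0(s)) ds. *)
Definition age_dist {R : realType} (F0 : probability R R) (A : set R) : \bar R :=
  \int[lebesgue_measure]_(s in A `&` `[0%R, +oo[%classic)
    (1 - dist_fun F0 s)%:E.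

(* Where F_0(t) = 1 the hazard rate takes the junk value 0; that set is null
   for both F_0 and the age distribution. *)
Definition hazard {R : realType} (F0 : probability R R) (f0 : R -> R) (t : R)
    : R := (f0 t / (1 - dist_fun F0 t))%R.

(* eta is a function on R_+, hence the constraint 0 <= t. *)
Definition hazard_preimage {R : realType} (eta : R -> R) (x : R) : set R :=
  [set t | (0 <= t)%R /\ (0 <= eta t <= x)%R].

Definition observed_hazard_dist {R : realType} (mu : set R -> \bar R)
    (eta : R -> R) (x : R) : R := fine (mu (hazard_preimage eta x)).

Definition limit_hazard_dist {R : realType} (G : R -> R) (L : probability R R)
    (x : R) : R :=
  fine (\int[L]_(l in `]0%R, +oo[%classic) (G (x / l)%R)%:E).

(* Real-valued: the infimum of an empty set is 0, which can only occur at
   p = 1 for a distribution function H. *)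
Definition quantile {R : realType} (H : R -> R) (p : R) : R :=
  inf [set x : R | (0 <= x)%R /\ (p <= H x)%R].

Definition measure_preserving_flow {R : realType} {d : measure_display}
    {T : measurableType d} (P : probability T R) (theta : R -> T -> T) : Prop :=
  [/\ measurable_fun [set: R * T] (fun p : R * T => theta p.1 p.2),
      forall w, theta 0%R w = w,
      forall s t w, theta (s + t)%R w = theta s (theta t w) &
      forall t (A : set T), measurable A -> P (theta t @^-1` A) = P A].

Definition point_process {R : realType} {d : measure_display}
    {T : measurableType d} (Phi : R.-ker T ~> R) : Prop :=
  forall w (a b : R) (B : set R), measurable B -> B `<=` `[a, b]%classic ->
    exists n : nat, Phi w B = n%:R%:E.

Definition simple_pp {R : realType} {d : measure_display}
    {T : measurableType d} (P : probability T R) (Phi : R.-ker T ~> R) : Prop :=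
  {ae P, forall w, forall t : R, Phi w [set t] <= 1}.

Definition stationary_pp {R : realType} {d : measure_display}
    {T : measurableType d} (theta : R -> T -> T) (Phi : R.-ker T ~> R) : Prop :=
  forall w (t : R) (B : set R), measurable B ->
    Phi (theta t w) B = Phi w [set (s + t)%R | s in B].

Definition intensity {R : realType} {d : measure_display}
    {T : measurableType d} (P : probability T R) (Phi : T -> set R -> \bar R)
    : \bar R := \int[P]_w Phi w `]0%R, 1%R]%classic.

(* A probability measure when the intensity is positive and finite; kept as a
   plain set function. *)
Definition palm {R : realType} {d : measure_display} {T : measurableType d}
    (P : probability T R) (theta : R -> T -> T) (Phi : T -> set R -> \bar R)
    (A : set T) : \bar R :=
  ((fine (intensity P Phi))^-1)%:E *
  \int[P]_w \int[Phi w]_(s in `]0%R, 1%R]%classic) (\1_A (theta s w))%:E.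

(* The points of a counting measure [mu], numbered so that
   T_0 <= 0 < T_1 and T_n <= T_(n+1). *)
Definition nth_point {R : realType} (mu : set R -> \bar R) (n : int) : R :=
  match n with
  | Posz 0 => sup [set t : R | (t <= 0)%R /\ 1 <= mu `[t, 0%R]%classic]
  | Posz m.+1 =>
      inf [set t : R | (0 < t)%R /\ m.+1%:R%:E <= mu `]0%R, t]%classic]
  | Negz m =>
      sup [set t : R | (t <= 0)%R /\ m.+2%:R%:E <= mu `[t, 0%R]%classic]
  end.

Definition interarrival {R : realType} {d : measure_display}
    {T : measurableType d} (Phi : R.-ker T ~> R) (n : int) (w : T) : R :=
  (nth_point (Phi w) (n + 1) - nth_point (Phi w) n)%R.

Definition stationary_renewal {R : realType} {d : measure_display}
    {T : measurableType d} (P : probability T R) (theta : R -> T -> T)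
    (Phi : R.-ker T ~> R) : Prop :=
  [/\ point_process Phi, stationary_pp theta Phi, simple_pp P Phi,
      mutually_independent (palm P theta (fun w => Phi w))
        (fun n : int =>
           preimage_set_system [set: T] (interarrival Phi n)
             (@measurable _ (measurableTypeR R))) &
      forall (m n : int) (B : set R), measurable B ->
        palm P theta (fun w => Phi w) (interarrival Phi m @^-1` B) =
        palm P theta (fun w => Phi w) (interarrival Phi n @^-1` B)].

(* The inter-arrival times have distribution function t |-> F_0(l t). *)
Definition has_interarrival_dist {R : realType} {d : measure_display}
    {T : measurableType d} (P : probability T R) (theta : R -> T -> T)
    (Phi : R.-ker T ~> R) (F0 : probability R R) (l : R) : Prop :=
  forall (n : int) (t : R),
    palm P theta (fun w => Phi w) (interarrival Phi n @^-1` `]-oo, t]%classic) =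
    (dist_fun F0 (l * t))%:E.

Definition pp_sigma_algebra {R : realType} {d : measure_display}
    {T : measurableType d} (Phi : R.-ker T ~> R) : set (set T) :=
  <<s [set A : set T | exists (B : set R) (U : set (\bar R)),
        [/\ measurable B, measurable U & A = (fun w => Phi w B) @^-1` U]] >>.

Definition independent_pps {R : realType} {d : measure_display}
    {T : measurableType d} (P : probability T R) (N : nat)
    (Phi : 'I_N -> R.-ker T ~> R) : Prop :=
  mutually_independent P (fun i => pp_sigma_algebra (Phi i)).

Definition superposition {R : realType} {d : measure_display}
    {T : measurableType d} (N : nat) (Phi : 'I_N -> R.-ker T ~> R)
    (w : T) (B : set R) : \bar R := \sum_(i < N) Phi i w B.

(* The set below is bounded above; it is empty only if there is no point
   before t, in which case the value is the junk 0. *)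
Definition last_point {R : realType} (mu : set R -> \bar R) (t : R) : R :=
  sup [set s : R | (s < t)%R /\ 0 < mu [set s]].

(* lambda_i(t) = eta_i(t - tau_i^-(t)) with eta_i(t) = l eta(l t). *)
Definition observed_rate {R : realType} {d : measure_display}
    {T : measurableType d} (eta : R -> R) (l : R) (Phi : R.-ker T ~> R)
    (t : R) (w : T) : R :=
  (l * eta (l * (t - last_point (Phi w) t)))%R.

(* [sel] maps the vector of current rates to [C] items of largest rate; ties
   are resolved by whatever (deterministic) choice [sel] makes. No measurability
   of that choice is required. *)
Definition largest_selection {R : realType} (N C : nat)
    (sel : ('I_N -> R) -> {set 'I_N}) : Prop :=
  forall x : 'I_N -> R, #|sel x| = C /\
    forall i j, i \in sel x -> j \notin sel x -> (x j <= x i)%R.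

Definition optimal_policy {R : realType} {d : measure_display}
    {T : measurableType d} (N : nat) (eta : R -> R) (lam : 'I_N -> R)
    (Phi : 'I_N -> R.-ker T ~> R) (sel : ('I_N -> R) -> {set 'I_N})
    (t : R) (w : T) : {set 'I_N} :=
  sel (fun i => observed_rate eta (lam i) (Phi i) t w).

Definition hit_process {R : realType} {d : measure_display}
    {T : measurableType d} (N : nat) (Phi : 'I_N -> R.-ker T ~> R)
    (policy : R -> T -> {set 'I_N}) (w : T) (B : set R) : \bar R :=
  \sum_(i < N) \int[Phi i w]_(t in B) (\1_[set s | i \in policy s w] t)%:E.

Definition miss_rate {R : realType} {d : measure_display}
    {T : measurableType d} (P : probability T R) (N : nat) (lam : 'I_N -> R)
    (Phi : 'I_N -> R.-ker T ~> R) (policy : R -> T -> {set 'I_N}) : \bar R :=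
  (\sum_(i < N) lam i)%R%:E - intensity P (hit_process Phi policy).

Definition empirical_dist {R : realType} (N : nat) (lam : 'I_N -> R) (x : R)
    : R := (N%:R^-1 * \sum_(i < N | lam i <= x) 1)%R.

Definition rates_uniformly_integrable {R : realType}
    (lam : forall N : nat, 'I_N -> R) : Prop :=
  forall e : R, (0 < e)%R -> exists K : R, (0 <= K)%R /\
    forall N : nat, (0 < N)%N ->
      (N%:R^-1 * \sum_(i < N | K <= lam N i) lam N i <= e)%R.

(* Main.v *)
(* Fix a threshold x and call an item hot when its observed rate exceeds x. At a
   fixed time the age of item j has law F(lam_j .) by stationarity, so j is hot
   with probability p_j = F{lam_j eta > x}; under the Campbell measure of Phi_j the
   age has law F_0(lam_j .), so the requests for j that find it hot have intensity
   lam_j F_0{lam_j eta > x}. By independence and Chebyshev's inequality the number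
   of hot items seen from a request is within o(N) of sum_j p_j. Hence, outside a
   negligible fraction of the requests, the optimal policy stores all hot items if
   C_N exceeds this sum by a multiple of N, and only hot items if it falls short by
   a multiple of N: the miss rate is at most, respectively at least, about
   sum_j lam_j F_0{lam_j eta <= x}.
   The averages N^-1 sum_j w(lam_j) nu{lam_j eta <= x}, for (w, nu) = (1, F) and
   (id, F_0), are compared with the integrals of w(l) nu{l eta <= x'} against L,
   with x' different from x, by Tonelli and dominated convergence. The first pair
   shows that x slightly above (below) theta* makes sum_j p_j smaller (larger) than
   C_N, because 1 - c is a continuity point of the quantile function; the second
   gives the limit, which is continuous at theta* as theta* is not in D_L . D_G0. *)

Require Import Defs.
From HB Require Import structures.
From mathcomp Require Import all_boot all_order all_algebra.
From mathcomp Require Import all_classical all_reals all_analysis.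
From mathcomp Require Import measurable_realfun lra ring.
Set Implicit Arguments.
Unset Strict Implicit.
Unset Printing Implicit Defensive.
Import Order.TTheory GRing.Theory Num.Theory.
Import numFieldNormedType.Exports.
Local Open Scope classical_set_scope.
Local Open Scope ring_scope.
Local Open Scope ereal_scope.

(** No measurability of [sel] is assumed, and none is established for the inter-arrival times.
    Integrals of arbitrary nonnegative functions are therefore only compared by monotonicity, and
    each such quantity is squeezed between masses of measurable sets under the Campbell measure on
    pairs (w, s), a sample with one of its points in ]0, 1]. The absence of atoms of [F0] closes the
    squeeze for the gaps. Ages enter through void events [Phi w ]s - a, s[ = 0]. These involve
    counts only, hence are measurable also for the history of a single process, where independence
    is available. The stationary age law is an inversion formula: the event that ]t - a, t[ is empty
    is counted by the first point after t. Unfolding over integer windows turns the average over t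
    in ]0, 1] into an integral of Campbell masses over the whole line. The threshold is shifted
    because x / eta may be an atom of [L], where averages need not converge. The weight l is
    unbounded: truncated means are reduced to distribution functions by integration by parts, and
    the level eta = 0, where no truncation remains, is [F0]-null. *)

Section monotone_integral.
Context d (T : measurableType d) (R : realType).
Variable mu : {measure set T -> \bar R}.

(** The integral of a nonnegative function is a supremum over simple functions below it, so
    monotonicity survives without measurability; this is how [sel] and Palm events are handled. *)
Lemma le_integral_nonmeas (D : set T) (f g : T -> \bar R) :
  (forall x, D x -> 0 <= f x) -> (forall x, D x -> f x <= g x) ->
  \int[mu]_(x in D) f x <= \int[mu]_(x in D) g x.
Proof.
move=> f0 fg.
have g0 x : D x -> 0 <= g x by move=> Dx; exact: le_trans (f0 _ Dx) (fg _ Dx).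
rewrite !ge0_integralE//; apply: ereal_sup_le => _ /= [h hf <-].
exists h => // x; apply: le_trans (hf x) _; exact: lee_restrict.
Qed.

End monotone_integral.

Section image_measure.
Context d d' (T1 : measurableType d) (T2 : measurableType d') (R : realType).
Variables (m : {measure set T1 -> \bar R}) (f : T1 -> T2).
Hypothesis mf : measurable_fun [set: T1] f.

Definition image_measure : {measure set T2 -> \bar R} :=
  measure_function_pushforward__canonical__measure_function_Measure m mf.

Lemma image_measureE A : image_measure A = m (f @^-1` A).
Proof. by []. Qed.

End image_measure.

Section affine.
Context {R : realType}.
Local Notation leb := (@lebesgue_measure R).

Lemma measurable_affine (k b : R) :
  measurable_fun [set: measurableTypeR R] (fun x : measurableTypeR R => (k * x + b)%R :
    measurableTypeR R).
Proof. by apply: measurable_funD => //; exact: mulrl_measurable. Qed.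

(** The image of Lebesgue measure under the affine map, multiplied by k, agrees with Lebesgue
    measure on half-open intervals, which determine it. *)
Lemma lebesgue_measure_scale_shift (k b : R) (A : set R) : (0 < k)%R -> measurable A ->
  leb ((fun x : R => (k * x + b)%R) @^-1` A) = (k^-1)%:E * leb A.
Proof.
move=> k0 mA.
have k0' : (0 <= k)%R by exact: ltW.
pose f : measurableTypeR R -> measurableTypeR R := fun x => (k * x + b)%R.
have mf : measurable_fun setT f := measurable_affine k b.
pose m : {measure set (measurableTypeR R) -> \bar R} :=
  mscale (NngNum k0') (image_measure leb mf).
have mE X : measurable X -> leb X = m X.
  apply: lebesgue_measure_unique => _ [[x y]] _ <- /=.
  rewrite /m /mscale /= /pushforward.
  rewrite [X in _ = _ * leb X](_ : _ = `](k^-1 * (x - b))%R, (k^-1 * (y - b))%R]%classic); last first.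
    apply/seteqP; split => z /=; rewrite /f !in_itv/= ltr_pdivrMl// ler_pdivlMl//;
      by rewrite ltrBlDr lerBrDr.
  rewrite !lebesgue_measure_itv/= !lte_fin ltr_pM2l ?invr_gt0// ltrD2r.
  case: ifPn => _; last by rewrite mule0.
  by rewrite -!EFinB -EFinM; congr EFin; field; rewrite gt_eqF.
rewrite (mE _ mA) /m /mscale/= /pushforward muleA -EFinM mulVf ?mul1e// gt_eqF//.
Qed.

End affine.

Lemma eq_measure_rays {R : realType} (m1 m2 : {measure set R -> \bar R}) :
  m1 setT < +oo -> m1 setT = m2 setT ->
  (forall a : R, m1 `]a, +oo[%classic = m2 `]a, +oo[%classic) ->
  forall A, measurable A -> m1 A = m2 A.
Proof.
move=> m1oo m12T m12 A mA.
(* The whole line is adjoined to the rays so that a constant sequence inside the pi-system exhausts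
   the space. *)
pose G : set (set R) := [set A | A = setT \/ exists x, A = `]x, +oo[%classic].
apply: (measure_unique G (fun=> setT)) => //.
- rewrite [LHS](RGenOInfty.measurableE R); apply/seteqP; split; last first.
    apply: smallest_sub; first exact: smallest_sigma_algebra.
    move=> _ [->|[x ->]]; last by apply: sub_sigma_algebra; exists x.
    have := sigma_algebraCD (@sigma_algebra0 R setT (@RGenOInfty.G R)).
    by rewrite setD0.
  apply: sub_sigma_algebra2 => _ [x ->]; right; by exists x.
- move=> X Y [->|[x ->]] [->|[y ->]]; rewrite ?setTI ?setIT; try by [left|right; eexists].
  right; exists (Order.max x y); apply/seteqP; split => z /=; rewrite !in_itv/= !andbT gt_max.
    by move=> [-> ->].
  by move=> /andP[].
- by move=> i; left.
- by apply/seteqP; split => // x _; exists 0%N.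
- by move=> _ [->|[x ->]].
Qed.

(** * Point configurations *)

(** The pathwise content of [point_process], isolated so that deterministic facts apply to [Phi w]
    for each fixed w. *)
Definition counting_conf {R : realType} (mu : set R -> \bar R) :=
  forall (a b : R) (B : set R), measurable B -> B `<=` `[a, b]%classic ->
    exists n : nat, mu B = n%:R%:E.

Section configurations.
Context {R : realType} (mu : {measure set R -> \bar R}).
Hypothesis cmu : counting_conf mu.

Lemma conf_lty (a b : R) (B : set R) : measurable B -> B `<=` `[a, b]%classic -> mu B < +oo.
Proof. by move=> mB /(cmu mB)[n ->]; rewrite ltry. Qed.

Lemma conf_ge1 (a b : R) (B : set R) : measurable B -> B `<=` `[a, b]%classic ->
  0 < mu B -> 1 <= mu B.
Proof. by move=> mB /(cmu mB)[n ->]; rewrite !lte_fin !lee_fin ler1n ltr0n. Qed.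

(* Being integer valued, mu vanishes on the intersection of a decreasing
   sequence of bounded sets only if it vanishes on one of them. *)
Lemma conf_decreasing_eq0 (a b : R) (B : (set R)^nat) :
  (forall n, measurable (B n)) -> (forall n, B n `<=` `[a, b]%classic) ->
  nonincreasing_seq B -> mu (\bigcap_n B n) = 0 -> exists n, mu (B n) = 0.
Proof.
move=> mB Bab niB B0; apply: contrapT => /forallNP Bn0.
have : mu \o B @ \oo --> mu (\bigcap_n B n).
  apply: nonincreasing_cvg_mu => //; first exact: conf_lty (Bab 0%N).
  exact: bigcap_measurable.
rewrite B0 => /cvg_lim => /(_ (@ereal_hausdorff R)) lim0.
have : 1 <= limn (mu \o B).
  apply: lime_ge; last first.
    apply: nearW => n; apply: (conf_ge1 _ (Bab n)) => //.
    by rewrite lt0e measure_ge0 andbT; exact/eqP/Bn0.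
  apply/cvg_ex; exists (mu (\bigcap_n B n)); apply: nonincreasing_cvg_mu => //.
    exact: conf_lty (Bab 0%N).
  exact: bigcap_measurable.
by rewrite lim0 lee_fin ler10.
Qed.

(* The infimum of the t with mu (B `&` ]-oo, t]) > 0 is an atom. *)
Lemma atom_exists (a b : R) (B : set R) : measurable B -> B `<=` `[a, b]%classic ->
  0 < mu B -> exists2 s, B s & 0 < mu [set s].
Proof.
move=> mB Bab B0.
pose S := [set t : R | 0 < mu (B `&` `]-oo, t])].
have mBt t : measurable (B `&` `]-oo, t]) by exact: measurableI.
have mBto t : measurable (B `&` `]-oo, t[) by exact: measurableI.
have sBt t : B `&` `]-oo, t] `<=` `[a, b]%classic by apply: subset_trans Bab => ? [].
have Sb : S b.
  rewrite /S/= (_ : B `&` _ = B)//; apply/setIidPl => x /Bab/=.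
  by rewrite !in_itv/= => /andP[].
have lbS : lbound S a.
  move=> t St; rewrite leNgt; apply/negP => ta; move: St.
  rewrite /S/= (_ : B `&` _ = set0) ?measure0 ?ltxx// -subset0 => x [/Bab/=].
  by rewrite !in_itv/= => /andP[ax _] xt; move: (le_lt_trans xt ta); rewrite ltNge ax.
have hiS : has_inf S by split; [exists b | exists a].
set s := inf S.
(* The infimum belongs to [S]: otherwise the cuts at s + 1/(n+1) decrease to a null set, and
   integrality makes one of them null already. *)
have Ss : S s.
  rewrite /S/= lt0e measure_ge0 andbT; apply/eqP => Bs0.
  pose C n := B `&` `]-oo, (s + n.+1%:R^-1)%R].
  have capC : \bigcap_n C n = B `&` `]-oo, s].
    apply/seteqP; split => x /=.
      move=> Cx; split; first by have [] := Cx 0%N I.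
      rewrite in_itv/=; apply/ler_addgt0Pr => e e0.
      have [n /ltW ne] : exists n, (n.+1%:R^-1 < e)%R.
        by have [n] := ltr_add_invr e0; rewrite add0r => ?; exists n.
      have [_ /=] := Cx n I; rewrite in_itv/= => /le_trans; apply.
      by rewrite lerD2l.
    move=> [Bx xs] n _; split => //=; move: xs; rewrite !in_itv/= => /le_trans; apply.
    by rewrite lerDl invr_ge0.
  have [||||n] := @conf_decreasing_eq0 a b C.
  - by move=> n; exact: mBt.
  - by move=> n; exact: sBt.
  - move=> m n mn; apply/subsetPset; apply: setIS => x /=.
    rewrite !in_itv/= => /le_trans; apply; rewrite lerD2l lef_pV2 ?posrE// ler_nat//.
  - by rewrite capC.
  have [t St tn] := @inf_adherent R S n.+1%:R^-1 (ltac:(by rewrite invr_gt0)) hiS.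
  move=> Cn0; move: St; rewrite /S/= lt0e => /andP[/eqP + _]; apply.
  apply: subset_measure0 Cn0 => //; first exact: mBt.
  by apply: setIS => x /=; rewrite !in_itv/= => /le_trans; apply; exact: ltW.
(* Continuity from below: every cut strictly left of s is null. With [Ss] this leaves all the mass
   at s itself. *)
have Bo0 : mu (B `&` `]-oo, s[) = 0.
  pose C n := B `&` `]-oo, (s - n.+1%:R^-1)%R].
  have cupC : \bigcup_n C n = B `&` `]-oo, s[.
    apply/seteqP; split => x /=.
      move=> [n _ [Bx]]; rewrite /= !in_itv/= => xs; split => //.
      by apply: le_lt_trans xs _; rewrite ltrBlDr ltrDl invr_gt0.
    rewrite in_itv/= => -[Bx xs]; have [n xn] := ltr_add_invr xs.
    by exists n => //; split => //=; rewrite in_itv/= lerBrDr ltW.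
  have C0 n : mu (C n) = 0.
    apply/eqP; rewrite eq_le measure_ge0 andbT leNgt; apply/negP => Cn.
    have : (s <= s - n.+1%:R^-1)%R by apply: ge_inf => //; case: hiS.
    by rewrite leNgt ltrBlDr ltrDl invr_gt0 ltr0Sn.
  have : mu \o C @ \oo --> mu (\bigcup_n C n).
    apply: nondecreasing_cvg_mu => //.
    - by move=> n; exact: mBt.
    - by rewrite cupC; exact: mBto.
    move=> m n mn; apply/subsetPset; apply: setIS => x /=.
    rewrite !in_itv/= => /le_trans; apply; rewrite lerD2l lerN2 lef_pV2 ?posrE// ler_nat//.
  rewrite cupC (_ : mu \o C = cst 0); last by apply/funext => n /=; exact: C0.
  by move/(cvg_unique (@ereal_hausdorff R) (cvg_cst _)).
have Bs : 0 < mu (B `&` [set s]).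
  move: Ss; rewrite /S/= (_ : B `&` `]-oo, s] = (B `&` `]-oo, s[) `|` (B `&` [set s])); last first.
    rewrite -setIUr; congr (_ `&` _); apply/seteqP; split => x /=; rewrite !in_itv/= le_eqVlt.
      by move=> /orP[/eqP->|]; [right|left].
    by move=> [->|->]; rewrite ?orbT// eqxx.
  move=> /lt_le_trans; apply; rewrite -[leRHS]add0e -Bo0.
  by apply: measureU2 => //; exact: measurableI.
have [Bs'|nBs] := pselect (B s); last first.
  by move: Bs; rewrite (_ : B `&` _ = set0) ?measure0 ?ltxx// -subset0 => x [Bx xs]; rewrite -xs in nBs.
by exists s => //; move: Bs; rewrite setIidr// => _ ->.
Qed.

Lemma no_atom_measure0 (a b : R) (B : set R) : measurable B -> B `<=` `[a, b]%classic ->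
  (forall s, B s -> mu [set s] = 0) -> mu B = 0.
Proof.
move=> mB Bab B0; apply/eqP; rewrite eq_le measure_ge0 andbT leNgt; apply/negP.
by move=> /(atom_exists mB Bab)[s /B0 ->]; rewrite ltxx.
Qed.

End configurations.

Lemma measurable_lt_set dS (S : measurableType dS) (R : realType) (f g : S -> R) :
  measurable_fun setT f -> measurable_fun setT g ->
  measurable [set z | (f z < g z)%R].
Proof.
move=> mf mg; have := measurable_fun_ltr mf mg measurableT (Y := [set true]).
by rewrite setTI; apply.
Qed.

Section void_sets.
Context dS (S : measurableType dS) (R : realType).
Variable kappa : S -> {measure set R -> \bar R}.
Hypothesis mkappa : forall B, measurable B -> measurable_fun setT (kappa ^~ B).
Hypothesis ckappa : forall z, counting_conf (kappa z).

(** By [atom_exists] a charged open interval contains an atom, which can be enclosed in a closed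
    interval with rational ends inside the open one; only countably many counts of fixed sets
    remain. *)
Lemma measurable_points (X Y : S -> R) :
  measurable_fun setT X -> measurable_fun setT Y ->
  measurable [set z | 0 < kappa z `]X z, Y z[%classic].
Proof.
move=> mX mY.
rewrite [X in measurable X](_ : _ = \bigcup_(p : rat) \bigcup_(r : rat)
   ([set z | (X z < ratr p)%R] `&` [set z | (ratr r < Y z)%R] `&`
    [set z | 0 < kappa z `[(ratr p : R), ratr r]%classic])).
  apply: bigcupT_measurable_rat => p; apply: bigcupT_measurable_rat => r.
  apply: measurableI; first apply: measurableI.
  - exact: measurable_lt_set.
  - exact: measurable_lt_set.
  - rewrite -[X in measurable X]setTI; apply: emeasurable_fun_o_infty => //.
    exact: mkappa.
apply/seteqP; split => z /=.
  move=> /(atom_exists (ckappa z) (a := X z) (b := Y z)) []//.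
    exact: subset_itv_oo_cc.
  move=> s /=; rewrite in_itv/= => /andP[Xs sY] s0.
  have [p] := rat_in_itvoo Xs; rewrite in_itv/= => /andP[Xp ps].
  have [r] := rat_in_itvoo sY; rewrite in_itv/= => /andP[sr rY].
  exists p => //; exists r => //; split => //=.
  apply: (lt_le_trans s0); apply: le_measure; rewrite ?inE//.
  by move=> x /= ->; rewrite in_itv/= !ltW.
move=> [p _ [r _ [[/= Xp rY] +]]].
move=> /lt_le_trans; apply; apply: le_measure; rewrite ?inE//.
move=> x /=; rewrite !in_itv/= => /andP[px xr].
by rewrite (lt_le_trans Xp px) (le_lt_trans xr rY).
Qed.

Lemma measurable_void (X Y : S -> R) :
  measurable_fun setT X -> measurable_fun setT Y ->
  measurable [set z | kappa z `]X z, Y z[%classic = 0].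
Proof.
move=> mX mY; rewrite [X in measurable X](_ : _ =
   ~` [set z | 0 < kappa z `]X z, Y z[%classic]).
  by apply: measurableC; exact: measurable_points.
apply/seteqP; split => z /=; first by move=> ->; rewrite ltxx.
by move/negP; rewrite -leNgt => h; apply/eqP; rewrite eq_le h measure_ge0.
Qed.

End void_sets.

Section last_point.
Context {R : realType}.

(* The second case is the junk value 0 of [last_point] when no point precedes t. *)
Lemma last_point_gt (mu : {measure set R -> \bar R}) (t a : R) : counting_conf mu ->
  (a < last_point mu t)%R <->
  0 < mu `]a, t[%classic \/
  ((forall n : nat, mu `](t - n.+1%:R)%R, t[%classic = 0) /\ (a < 0)%R).
Proof.
move=> cmu; set A := [set s : R | (s < t)%R /\ 0 < mu [set s]].
have ubA : has_ubound A by exists t => s [/ltW].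
have [A0|/set0P/negP] := pselect (A !=set0).
  split => [aA|[m0|]].
  - left; have [s [st s0] sa] := sup_gt A0 aA.
    apply: (lt_le_trans s0); apply: le_measure; rewrite ?inE//.
    by move=> x /= ->; rewrite in_itv/= sa st.
  - have [s] := atom_exists cmu (measurable_itv `]a, t[) (@subset_itv_oo_cc _ _ a t) m0.
    rewrite /= in_itv/= => /andP[as_ st] s0; apply: (lt_le_trans as_).
    by apply: ub_le_sup => //; split.
  - move=> [V _]; exfalso; have [s [st s0]] := A0.
    have [n ns] : exists n : nat, (t - n.+1%:R < s)%R.
      exists (Num.truncn (t - s)); rewrite ltrBlDr addrC -ltrBlDr.
      exact: truncnS_gt.
    suff : 0 < mu `](t - n.+1%:R)%R, t[%classic by rewrite V ltxx.
    apply: (lt_le_trans s0); apply: le_measure; rewrite ?inE//.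
    by move=> x /= ->; rewrite in_itv/= ns st.
rewrite negbK => /eqP A0.
have V b : mu `]b, t[%classic = 0.
  apply: (no_atom_measure0 cmu (a := b) (b := t)) => //.
    by apply: subset_itv_oo_cc.
  move=> s /=; rewrite in_itv/= => /andP[_ st]; apply/eqP; rewrite eq_le measure_ge0 andbT.
  by rewrite leNgt; apply/negP => s0; have : A s by []; rewrite A0.
rewrite /last_point -/A A0 sup0 V ltxx; split => [a0|[//|[]//]].
by right; split.
Qed.

End last_point.

Section last_point_measurable.
Context dS (S : measurableType dS) (R : realType).
Variable kappa : S -> {measure set R -> \bar R}.
Hypothesis mkappa : forall B, measurable B -> measurable_fun setT (kappa ^~ B).
Hypothesis ckappa : forall z, counting_conf (kappa z).

Lemma measurable_last_point (Y : S -> R) : measurable_fun setT Y ->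
  measurable_fun setT (fun z => last_point (kappa z) (Y z)).
Proof.
move=> mY; apply: (measurability (@RGenOInfty.G R)); first exact: RGenOInfty.measurableE.
move=> _ [_ [a ->] <-]; rewrite setTI.
(* For a < 0 the configurations without any point before [Y z] belong to the event too, because
   [last_point] then has the default value 0. *)
rewrite [X in measurable X](_ : _ = [set z | 0 < kappa z `]a, Y z[%classic] `|`
  (if (a < 0)%R then \bigcap_(n : nat)
      [set z | kappa z `](Y z - n.+1%:R)%R, Y z[%classic = 0] else set0)).
  apply: measurableU; first exact: (measurable_points mkappa).
  case: ifP => // _; apply: bigcapT_measurable => n.
  by apply: (measurable_void mkappa) => //; exact: measurable_funB.
apply/seteqP; split => z /=; rewrite in_itv/= andbT.
  move=> /(last_point_gt _ _ (ckappa z))[|[V a0]]; first by left.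
  by right; rewrite a0 => n _; exact: V.
move=> h; apply/(last_point_gt _ _ (ckappa z)).
case: h => [|]; first by left.
by case: ifP => // a0 V; right; split => // n; exact: V.
Qed.

End last_point_measurable.

(** * Campbell measures on the unit window *)

Section campbell.
Context d (T : measurableType d) (R : realType) (P : probability T R).
Variable Phi : R.-ker T ~> R.
Hypothesis cPhi : forall w, counting_conf (Phi w).

Local Notation D := (`]0%R, 1%R]%classic : set R).

Lemma measurable_campbell_section (A : set (T * R)) : measurable A ->
  measurable_fun setT (fun w => Phi w (xsection A w `&` D)).
Proof.
move=> mA.
have mD : measurable D by [].
suff /(_ A mA)[] : measurable `<=` [set A | measurable A /\
    measurable_fun setT (fun w => mrestr (Phi w) mD (xsection A w))] by [].
(* The bound asked for here may depend on w, and each configuration is finite on the bounded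
   window. *)
apply: measurable_prod_subset_xsection_kernel => w.
have [n nE] := cPhi w mD (@subset_itv_oc_cc _ _ _ _).
exists n.+1%:R => X mX; apply: (@le_lt_trans _ _ n%:R%:E); last first.
  by rewrite lte_fin ltr_nat.
by rewrite -nE /mrestr; apply: le_measure; rewrite ?inE//; exact: measurableI.
Qed.

(** The Campbell measure of the points in ]0, 1], not normalised. The mark is the unshifted pair (w,
    s) rather than [theta s w], so events seen from the point s are expressed by counts of [Phi w]
    near s. *)
Definition campbell (A : set (T * R)) : \bar R :=
  \int[P]_w Phi w (xsection A w `&` D).

Let campbell0 : campbell set0 = 0.
Proof. by apply: integral0_eq => w _; rewrite xsection0 set0I measure0. Qed.

Let campbell_ge0 A : 0 <= campbell A.
Proof. by apply: integral_ge0 => w _; exact: measure_ge0. Qed.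

Let campbell_sigma_additive : semi_sigma_additive campbell.
Proof.
move=> F mF tF mUF; apply: cvg_toP.
  by apply: is_cvg_ereal_nneg_natsum => n _; exact: campbell_ge0.
rewrite -integral_nneseries//; last first.
- by move=> n; exact: measurable_campbell_section.
apply: eq_integral => w _; rewrite xsection_bigcup setI_bigcupl measure_bigcup//.
- by apply: eq_eseriesl => i; rewrite in_setT.
- by move=> i _; apply: measurableI => //; exact: measurable_xsection.
- by apply: trivIset_setIr; exact: trivIset_xsection.
Qed.

Definition campbell_measure : {measure set (T * R) -> \bar R} :=
  HB.pack campbell (isMeasure.Build _ _ _ campbell campbell0 campbell_ge0
    campbell_sigma_additive).

Lemma campbell_setT : campbell_measure setT = intensity P (fun w => Phi w).
Proof. by apply: eq_integral => w _; rewrite xsectionE preimage_setT setTI. Qed.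

End campbell.

(** * Palm and stationary laws of the age *)

Section age_law.
Context dS (S : measurableType dS) (R : realType).
Variable kappa : S -> {measure set R -> \bar R}.
Hypothesis mkappa : forall B, measurable B -> measurable_fun setT (kappa ^~ B).
Hypothesis ckappa : forall z, counting_conf (kappa z).
Variable Y : S -> R.
Hypothesis mY : measurable_fun setT Y.

Let V (a : R) := [set z | kappa z `](Y z - a)%R, Y z[%classic = 0].

Let mV a : measurable (V a).
Proof. by apply: measurable_void => //; exact: measurable_funB. Qed.

Lemma measurable_age : measurable_fun setT (fun z => Y z - last_point (kappa z) (Y z))%R.
Proof. by apply: measurable_funB => //; exact: measurable_last_point. Qed.

(* The law of the age is read off the void probabilities. *)
Lemma age_lawE (m : {measure set S -> \bar R}) (rho : {measure set R -> \bar R}) :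
  m setT < +oo -> m setT = rho setT -> rho `]-oo, 0%R]%classic = 0 ->
  (forall a : R, (0 < a)%R -> m [set z | kappa z `](Y z - a)%R, Y z[%classic = 0] =
                   rho `]a, +oo[%classic) ->
  forall E, measurable E ->
    m [set z | E (Y z - last_point (kappa z) (Y z))%R] = rho E.
Proof.
move=> moo mrho rho0 mVrho E mE.
pose age z := (Y z - last_point (kappa z) (Y z))%R.
have mage : measurable_fun setT age := measurable_age.
(* On [V0] there is no point before [Y z] and the age is meaningless. It is null because it lies in
   every void event of integer length, whose masses are tails of [rho]. *)
pose V0 := \bigcap_n V n.+1%:R.
have mV0 : measurable V0 by apply: bigcapT_measurable => n; exact: mV.
have rhooo A : measurable A -> rho A < +oo.
  by move=> mA; apply: le_lt_trans moo; rewrite mrho; apply: le_measure; rewrite ?inE.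
have agele a z : (a < age z)%R -> (V a z).
  move=> az; apply/eqP; rewrite eq_le measure_ge0 andbT leNgt; apply/negP => h.
  have : (Y z - a < last_point (kappa z) (Y z))%R.
    by apply/(last_point_gt _ _ (ckappa z)); left.
  by move: az; rewrite /age; clear => h1 h2; lra.
have agege a b z : (a < b)%R -> V b z -> ~ V0 z -> (a < age z)%R.
  move=> ab Vb nV0; rewrite /age; suff : (last_point (kappa z) (Y z) <= Y z - b)%R by clear -ab => h; lra.
  rewrite leNgt; apply/negP => /(last_point_gt _ _ (ckappa z))[|[h _]].
    by rewrite Vb ltxx.
  by apply: nV0 => n _; exact: h.
have rho_cvg (a : R) : rho `](a + n.+1%:R^-1)%R, +oo[%classic @[n --> \oo] --> rho `]a, +oo[%classic.
  rewrite (_ : `]a, +oo[%classic = \bigcup_n `](a + n.+1%:R^-1)%R, +oo[%classic).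
    apply: nondecreasing_cvg_mu => //; first exact: bigcup_measurable.
    move=> i j ij; apply/subsetPset => x /=; rewrite !in_itv/= !andbT.
    by apply: le_lt_trans; rewrite lerD2l lef_pV2 ?posrE// ler_nat.
  apply/seteqP; split => x /=; rewrite in_itv/= andbT.
    by move=> /ltr_add_invr[n ?]; exists n => //=; rewrite in_itv/= andbT.
  move=> [n _]; rewrite /= in_itv/= andbT; apply: lt_trans.
  by rewrite ltrDl invr_gt0.
have V00 : m V0 = 0.
  apply/eqP; rewrite eq_le measure_ge0 andbT.
  have : rho `]n.+1%:R, +oo[%classic @[n --> \oo] --> rho (\bigcap_n `]n.+1%:R, +oo[%classic).
    apply: (@nonincreasing_cvg_mu _ R R rho (fun n => `]n.+1%:R, +oo[%classic)) => //.
    - exact: rhooo.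
    - exact: bigcapT_measurable.
    move=> i j ij; apply/subsetPset => x /=; rewrite !in_itv/= !andbT.
    by apply: le_lt_trans; rewrite ler_nat.
  rewrite (_ : \bigcap_n _ = set0) ?measure0; last first.
    rewrite -subset0 => x /(_ (Num.truncn x) I) /=; rewrite in_itv/= andbT.
    by rewrite ltNge ltW// truncnS_gt.
  move=> h; apply: (cvge_ge _ h).
  apply: nearW => n; rewrite -mVrho//; apply: le_measure; rewrite ?inE//; first exact: mV.
  by move=> z; apply.
(* Voidness over the length a does not give an age strictly above a, so the lower bound passes
   through the lengths a + 1/(n+1). At a = 0, where no void probability is given, the upper bound is
   the total mass. *)
have gtE (a : R) : (0 <= a)%R -> m [set z | (a < age z)%R] = rho `]a, +oo[%classic.
  move=> a0; have magea : measurable [set z | (a < age z)%R] by exact: measurable_lt_set.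
  apply/eqP; rewrite eq_le; apply/andP; split; last first.
    apply: (cvge_le _ (rho_cvg a)).
    apply: nearW => n; rewrite -mVrho; last by rewrite ltr_wpDl// invr_gt0.
    apply: (@le_trans _ _ (m ([set z | (a < age z)%R] `|` V0))).
      apply: le_measure; rewrite ?inE//; [exact: mV|exact: measurableU|].
      move=> z Vz; have [V0z|nV0z] := pselect (V0 z); [by right|left].
      by apply: agege Vz nV0z; rewrite ltrDl invr_gt0.
    by rewrite measureU0.
  move: a0; rewrite [(0 <= a)%R]le_eqVlt => /predU1P[<-|a0].
    rewrite (_ : rho _ = rho setT).
      by rewrite -mrho; apply: le_measure; rewrite ?inE//; exact: measurable_lt_set.
    rewrite (_ : setT = `]-oo, 0%R]%classic `|` `]0%R, +oo[%classic); last first.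
      apply/seteqP; split => // x _ /=; rewrite !in_itv/= andbT.
      by case: (leP x 0%R) => ?; [left|right].
    by rewrite setUC measureU0.
  rewrite -mVrho//; apply: le_measure; rewrite ?inE//; first exact: mV.
  by move=> z; exact: agele.
transitivity (image_measure m mage E); first by [].
apply: eq_measure_rays => //.
move=> a; rewrite image_measureE.
rewrite (_ : _ @^-1` _ = [set z | (a < age z)%R]); last first.
  by apply/seteqP; split => z /=; rewrite in_itv/= andbT.
have [a0|a0] := leP 0%R a; first exact: gtE.
have rhoT : rho `]0%R, +oo[%classic = rho setT.
  rewrite (_ : setT = `]-oo, 0%R]%classic `|` `]0%R, +oo[%classic); last first.
    apply/seteqP; split => // x _ /=; rewrite !in_itv/= andbT.
    by case: (leP x 0%R) => ?; [left|right].
  by rewrite setUC measureU0.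
have /eqP rhoa : rho `]a, +oo[%classic == rho setT.
  rewrite eq_le; apply/andP; split; first by apply: le_measure; rewrite ?inE.
  rewrite -rhoT; apply: le_measure; rewrite ?inE// => x /=; rewrite !in_itv/= !andbT.
  exact: lt_trans.
rewrite rhoa; apply/eqP; rewrite eq_le; apply/andP; split.
  by rewrite -mrho; apply: le_measure; rewrite ?inE//; exact: measurable_lt_set.
rewrite -rhoT -gtE//; apply: le_measure; rewrite ?inE//; try exact: measurable_lt_set.
by move=> z /=; exact: lt_trans.
Qed.

End age_law.

(** Integrality again: s carries no atom iff some neighbourhood of radius 1/(n+1) is void, and
    voidness of a moving interval is measurable. *)
Lemma measurable_atomless {R : realType} (mu : {measure set R -> \bar R}) :
  counting_conf mu -> measurable [set s | mu [set s] = 0].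
Proof.
move=> cmu.
rewrite [X in measurable X](_ : _ = \bigcup_n
    [set s | mu `](s - n.+1%:R^-1)%R, (s + n.+1%:R^-1)%R[%classic = 0]).
  apply: bigcupT_measurable => n; apply: (@measurable_void _ R R (fun=> mu)) => //.
  - by apply: measurable_funB => //; do ?[exact: measurable_id|exact: measurable_cst].
  - by apply: measurable_funD => //; do ?[exact: measurable_id|exact: measurable_cst].
apply/seteqP; split => s /=; last first.
  move=> [n _ /=]; apply: subset_measure0 => //.
  by move=> x -> /=; rewrite in_itv/= ltrBlDr !ltrDl invr_gt0 ltr0n.
move=> s0; pose B n := `](s - n.+1%:R^-1)%R, (s + n.+1%:R^-1)%R[%classic.
have BE : \bigcap_n B n = [set s].
  apply/seteqP; split => x /=; last first.
    by move=> -> n _; rewrite /B /= in_itv/= ltrBlDr !ltrDl invr_gt0 ltr0n.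
  move=> Bx; apply/eqP; rewrite eq_le; apply/andP; split; apply/ler_addgt0Pr => e e0;
  have [n] := ltr_add_invr e0; rewrite add0r => ne {s0};
  have := Bx n I; rewrite /B /= in_itv/= => /andP[h1 h2];
    move: (n.+1%:R^-1)%R ne h1 h2 => u ne h1 h2; clear -ne h1 h2; lra.
have [||||n Bn0] := @conf_decreasing_eq0 _ mu cmu (s - 1)%R (s + 1)%R B.
- by move=> n; exact: measurable_itv.
- move=> n x; rewrite /B/= !in_itv/=.
  have : (n.+1%:R^-1 <= 1 :> R)%R by rewrite invf_le1// ler1n.
  move: (n.+1%:R^-1)%R => u h /andP[h1 h2]; apply/andP; clear -h h1 h2.
  by split; lra.
- move=> i j ij; apply/subsetPset => x; rewrite /B/= !in_itv/=.
  have : (j.+1%:R^-1 <= i.+1%:R^-1 :> R)%R by rewrite lef_pV2 ?posrE// ler_nat.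
  move: (i.+1%:R^-1)%R (j.+1%:R^-1)%R => u v h /andP[h1 h2]; apply/andP.
  by clear -h h1 h2; split; lra.
- by rewrite BE.
by exists n.
Qed.

(* A simple configuration with a point at the origin: the age at 0 is minus the
   point of index -1, unless there is no point to the left. *)
Section origin.
Context {R : realType} (mu : {measure set R -> \bar R}).
Hypothesis cmu : counting_conf mu.
Hypothesis smu : forall t, mu [set t] <= 1.
Hypothesis mu0 : 0 < mu [set 0%R].

Let mu01 : mu [set 0%R] = 1.
Proof.
apply/eqP; rewrite eq_le smu/= (@conf_ge1 _ mu cmu 0%R 0%R) //.
by move=> x /= ->; rewrite in_itv/= lexx.
Qed.

Lemma nth_point0 : nth_point mu 0 = 0%R.
Proof.
rewrite /=; set A := [set t | _].
have A0 : A 0%R.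
  split => //; rewrite -mu01; apply: le_measure; rewrite ?inE//.
  by move=> x /= ->; rewrite in_itv/= lexx.
have ubA : ubound A 0%R by move=> x [].
apply/eqP; rewrite eq_le ge_sup//; last by exists 0%R.
by apply: ub_le_sup => //; exists 0%R.
Qed.

Let A := [set t : R | (t <= 0)%R /\ 2%:R%:E <= mu `[t, 0%R]%classic].

Let ubA : has_ubound A. Proof. by exists 0%R => x []. Qed.

Let points_left (t : R) : 0 < mu `]t, 0%R[%classic -> exists2 s, A s & (t < s)%R.
Proof.
move=> /(atom_exists cmu (measurable_itv _) (@subset_itv_oo_cc _ _ _ _))[s].
rewrite /= in_itv/= => /andP[ts s0] mus; exists s => //; split; first exact: ltW.
have mus1 : 1 <= mu [set s].
  apply: (@conf_ge1 _ mu cmu s s) => //.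
  by move=> x /= ->; rewrite in_itv/= lexx.
rewrite (_ : 2%:R%:E = 1 + 1); last by rewrite -EFinD.
apply: (@le_trans _ _ (mu [set s] + mu [set 0%R])); first by rewrite mu01 leeD2r.
rewrite -measureU//.
  apply: le_measure; rewrite ?inE//; first exact: measurableU.
  by move=> x [] /= ->; rewrite in_itv/= !lexx// ltW.
by rewrite -subset0 => x [] /= -> s00; move: s0; rewrite s00 ltxx.
Qed.

Let interE : (nth_point mu 0 - nth_point mu (Negz 0))%R = (- sup A)%R.
Proof. by rewrite nth_point0 sub0r. Qed.

Lemma point_inter (v : R) : 0 < mu `](- v)%R, 0%R[%classic ->
  (nth_point mu 0 - nth_point mu (Negz 0) <= v)%R.
Proof.
move=> /points_left[s As vs]; rewrite interE lerNl.
by apply: (le_trans (ltW vs)); exact: ub_le_sup.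
Qed.

(** The slack v' < v replaces the supremum by some t > -v in [A]. As 0 has mass one, the second
    point of [t, 0] lies in ]-v, 0[. The other alternative is an empty [A], whose supremum is a
    default value. *)
Lemma inter_point (v' v : R) : (v' < v)%R ->
  (nth_point mu 0 - nth_point mu (Negz 0) <= v')%R ->
  0 < mu `](- v)%R, 0%R[%classic \/
  (forall n : nat, mu `](- n.+1%:R)%R, 0%R[%classic = 0).
Proof.
move=> vv'; rewrite interE lerNl => vA.
have [A0|nA] := pselect (A !=set0); last first.
  right => n; apply/eqP; rewrite eq_le measure_ge0 andbT leNgt; apply/negP => h.
  by have [s As _] := points_left h; apply: nA; exists s.
have [|t [t0 mut] vt] := @sup_gt R A (- v)%R A0.
  by apply: lt_le_trans vA; rewrite ltrN2.
left; rewrite lt0e measure_ge0 andbT; apply/eqP => h.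
have : mu `[t, 0%R]%classic <= 1.
  rewrite -mu01 -[leRHS]add0e -h.
  apply: (@le_trans _ _ (mu (`](- v)%R, 0%R[%classic `|` [set 0%R]))).
    apply: le_measure; rewrite ?inE//; first exact: measurableU.
    move=> x /=; rewrite !in_itv/= [(x <= 0)%R]le_eqVlt => /andP[tx] /predU1P[->|]; first by right.
    by move=> ->; left; rewrite (lt_le_trans vt tx).
  exact: measureU2.
by move=> /(le_trans mut); rewrite lee_fin leNgt ltr1n.
Qed.

(** Without an earlier point the supremum defaults to 0 and the gap reads 0. Such configurations
    thus fall into an event that [F0] will show to be null. *)
Lemma no_point_inter : (forall n : nat, mu `](- n.+1%:R)%R, 0%R[%classic = 0) ->
  (nth_point mu 0 - nth_point mu (Negz 0) <= 0)%R.
Proof.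
move=> V; rewrite interE (_ : A = set0) ?sup0 ?oppr0//.
rewrite -subset0 => t [t0 mut].
have nt : (- (Num.truncn (- t)).+1%:R < t)%R by rewrite ltrNl truncnS_gt.
have : mu `[t, 0%R]%classic <= 1.
  rewrite -mu01 -[leRHS]add0e -(V (Num.truncn (- t))).
  apply: (@le_trans _ _ (mu (`](- (Num.truncn (- t)).+1%:R)%R, 0%R[%classic `|` [set 0%R]))).
    apply: le_measure; rewrite ?inE//; first exact: measurableU.
    move=> x /=; rewrite !in_itv/= [(x <= 0)%R]le_eqVlt => /andP[tx] /predU1P[->|]; first by right.
    by move=> ->; left; rewrite (lt_le_trans nt tx).
  exact: measureU2.
by move=> /(le_trans mut); rewrite lee_fin leNgt ltr1n.
Qed.

End origin.

(** * Comparing Palm sums of arbitrary events with Campbell masses *)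

Section null_comparison.
Context d (T : measurableType d) (R : realType).
Variables (mu : {measure set T -> \bar R}) (N : set T).
Hypotheses (mN : measurable N) (N0 : mu N = 0).
Variables (f g : T -> \bar R).
Hypotheses (f0 : forall x, 0 <= f x) (g0 : forall x, 0 <= g x).
Hypothesis mf : measurable_fun setT f.

Let integralN (h : T -> \bar R) : measurable_fun setT h -> (forall x, 0 <= h x) ->
  \int[mu]_x h x = \int[mu]_(x in ~` N) h x.
Proof. by move=> mh h0; rewrite (ge0_negligible_integral mN measurableT)// setTD. Qed.

Lemma null_le_integral : (forall x, ~ N x -> f x <= g x) ->
  \int[mu]_x f x <= \int[mu]_x g x.
Proof.
move=> fg; rewrite integralN// integral_mkcond; apply: le_integral_nonmeas.
  by move=> x _; rewrite patchE; case: ifP.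
move=> x _; rewrite patchE; case: ifPn => [/set_mem|_]; [exact: fg|exact: g0].
Qed.

(** [g] may be non-measurable, so [N] cannot be cut out of its integral. Instead [f] is raised to
    +oo on [N]: domination then holds everywhere and the integral of [f] is unchanged. *)
Lemma null_ge_integral : (forall x, ~ N x -> g x <= f x) ->
  \int[mu]_x g x <= \int[mu]_x f x.
Proof.
move=> gf; pose h x := f x + ((cst +oo) \_ N) x.
have mh : measurable_fun setT h.
  by apply: emeasurable_funD => //; apply/(measurable_restrictT _ mN).1; exact: measurable_cst.
have p0 x : 0 <= ((cst +oo) \_ N) x :> \bar R by rewrite patchE; case: ifP; rewrite ?le0y.
have h0 x : 0 <= h x by rewrite adde_ge0.
apply: (@le_trans _ _ (\int[mu]_x h x)).
  apply: le_integral_nonmeas => // x _; rewrite /h patchE; case: ifPn => xN.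
    by rewrite addey ?leey// gt_eqF// (lt_le_trans _ (f0 x)).
  by rewrite adde0; apply: gf => Nx; rewrite mem_set in xN.
rewrite integralN// [leRHS]integralN//; apply: le_integral_nonmeas => // x Nx.
by rewrite /h patchE memNset// adde0.
Qed.

End null_comparison.

Lemma addr_image_oo {R : realType} (a b s : R) :
  [set (t + s)%R | t in `]a, b[%classic] = `](a + s)%R, (b + s)%R[%classic.
Proof.
apply/seteqP; split => x /=.
  by move=> [t /[!in_itv]/= /andP[h1 h2] <-]; rewrite !ltrD2r h1.
rewrite in_itv/= => /andP[h1 h2]; exists (x - s)%R; last by rewrite subrK.
by rewrite in_itv/= ltrBrDr ltrBlDr h1.
Qed.

Section palm_comparison.
Context (R : realType) d (T : measurableType d) (P : probability T R) (theta : R -> T -> T).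
Variable Phi : R.-ker T ~> R.
Hypothesis cPhi : forall w, counting_conf (Phi w).
Hypothesis simPhi : simple_pp P Phi.

Local Notation D := (`]0%R, 1%R]%classic : set R).

(** The Palm probability before division by the intensity. [A] is arbitrary, so only inequalities
    with Campbell masses are available. *)
Definition palm_sum (A : set T) : \bar R :=
  \int[P]_w \int[Phi w]_(s in D) (\1_A (theta s w))%:E.

(** The point-free part of the window is measurable and null for [Phi w]. Inclusions between events
    thus need checking only at actual points of simple configurations. *)
Let Z w := D `&` [set s | Phi w [set s] = 0].

Let mZ w : measurable (Z w).
Proof. by apply: measurableI => //; exact: measurable_atomless. Qed.

Let Z0 w : Phi w (Z w) = 0.
Proof.
apply: (no_atom_measure0 (cPhi w) (a := 0%R) (b := 1%R)) => //.
  by move=> x [/= xD _]; exact: subset_itv_oc_cc xD.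
by move=> s [].
Qed.

Let notZ w s : D s -> ~ Z w s -> 0 < Phi w [set s].
Proof.
move=> Ds nZ; rewrite lt0e measure_ge0 andbT; apply/eqP => h; exact: nZ.
Qed.

Lemma campbell_le_palm_sum (B : set (T * R)) (A : set T) : measurable B ->
  (forall w s, (forall t, Phi w [set t] <= 1) -> D s -> 0 < Phi w [set s] ->
     B (w, s) -> A (theta s w)) ->
  campbell_measure P cPhi B <= palm_sum A.
Proof.
move=> mB BA; have [N [mN N0 subN]] := simPhi.
apply: (null_le_integral mN N0) => [w|w||w Nw].
- exact: measure_ge0.
- by apply: integral_ge0 => s _; rewrite lee_fin.
- exact: measurable_campbell_section.
have sw : forall t, Phi w [set t] <= 1 by apply: contrapT => h; apply: Nw; exact: subN.
have mxB : measurable (xsection B w) by exact: measurable_xsection.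
apply: (@le_trans _ _ (Phi w ((xsection B w `\` Z w) `&` D))).
  apply: (@le_trans _ _ (Phi w (((xsection B w `\` Z w) `&` D) `|` Z w))).
    apply: le_measure; rewrite ?inE//.
    - exact: measurableI.
    - by apply: measurableU => //; apply: measurableI => //; exact: measurableD.
    by move=> s [Bs Ds]; have [Zs|nZs] := pselect (Z w s); [right|left].
  by rewrite measureU0//; apply: measurableI => //; exact: measurableD.
rewrite -integral_indic//; last exact: measurableD.
apply: le_integral_nonmeas => [s _|s Ds]; rewrite lee_fin//.
rewrite !indicE; case: (boolP (s \in _)) => [|_]; last by rewrite ler0n.
rewrite inE => -[/set_mem Bs nZs]; rewrite mem_set//.
by apply: BA => //; exact: notZ.
Qed.

Lemma palm_sum_le_campbell (B : set (T * R)) (A : set T) : measurable B ->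
  (forall w s, (forall t, Phi w [set t] <= 1) -> D s -> 0 < Phi w [set s] ->
     A (theta s w) -> B (w, s)) ->
  palm_sum A <= campbell_measure P cPhi B.
Proof.
move=> mB AB; have [N [mN N0 subN]] := simPhi.
apply: (null_ge_integral mN N0) => [w|w||w Nw].
- exact: measure_ge0.
- by apply: integral_ge0 => s _; rewrite lee_fin.
- exact: measurable_campbell_section.
have sw : forall t, Phi w [set t] <= 1 by apply: contrapT => h; apply: Nw; exact: subN.
have mxB : measurable (xsection B w) by exact: measurable_xsection.
apply: (@le_trans _ _ (Phi w ((xsection B w `|` Z w) `&` D))); last first.
  apply: (@le_trans _ _ (Phi w ((xsection B w `&` D) `|` Z w))).
    apply: le_measure; rewrite ?inE//.
    - by apply: measurableI => //; exact: measurableU.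
    - by apply: measurableU => //; exact: measurableI.
    by move=> s [[Bs|Zs] Ds]; [left|right].
  by rewrite measureU0//; exact: measurableI.
rewrite -integral_indic//; last exact: measurableU.
apply: le_integral_nonmeas => [s _|s Ds]; rewrite lee_fin//.
rewrite !indicE; case: (boolP (theta s w \in A)) => [|_]; last by rewrite ler0n.
rewrite inE => As; rewrite mem_set//.
have [Zs|nZs] := pselect (Z w s); [by right|left].
by apply/mem_set; apply: AB => //; exact: notZ.
Qed.

End palm_comparison.

Section density.
Context {R : realType} (F0 : probability R R).
Hypothesis F0_set1 : forall x, F0 [set x] = 0.

Lemma dist_funE x : (dist_fun F0 x)%:E = F0 `]-oo, x]%classic.
Proof. by rewrite fineK// fin_num_measure. Qed.

Lemma dist_fun_ge0 x : (0 <= dist_fun F0 x)%R.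
Proof. by rewrite fine_ge0. Qed.

Lemma dist_fun_le1 x : (dist_fun F0 x <= 1)%R.
Proof. by rewrite -lee_fin dist_funE probability_le1. Qed.

Lemma dist_fun_left x :
  F0 `]-oo, (x - n.+1%:R^-1)%R]%classic @[n --> \oo] --> F0 `]-oo, x]%classic.
Proof.
have -> : F0 `]-oo, x]%classic = F0 (\bigcup_n `]-oo, (x - n.+1%:R^-1)%R]%classic).
  rewrite (_ : \bigcup_n _ = `]-oo, x[%classic).
    rewrite (_ : `]-oo, x]%classic = `]-oo, x[%classic `|` [set x]).
      by rewrite measureU0 //; exact: F0_set1.
    apply/seteqP; split => y /=; rewrite !in_itv/= le_eqVlt.
      by move=> /predU1P[->|]; [right|left].
    by move=> [->|->]; rewrite ?eqxx ?orbT.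
  apply/seteqP; split => y /=.
    move=> [n _]; rewrite /= !in_itv/= => /le_lt_trans; apply.
    by rewrite ltrBlDr ltrDl invr_gt0.
  rewrite in_itv/= => /ltr_add_invr[n yn]; exists n => //=.
  by rewrite in_itv/= lerBrDr ltW.
apply: nondecreasing_cvg_mu => //; first exact: bigcup_measurable.
move=> i j ij; apply/subsetPset => y /=; rewrite !in_itv/= => /le_trans; apply.
by rewrite lerD2l lerN2 lef_pV2 ?posrE// ler_nat.
Qed.

End density.

Section palm_age.
Context (R : realType) d (T : measurableType d) (P : probability T R) (theta : R -> T -> T).
Variable Phi : R.-ker T ~> R.
Hypothesis cPhi : forall w, counting_conf (Phi w).
Hypothesis simPhi : simple_pp P Phi.
Hypothesis statPhi : stationary_pp theta Phi.
Variables (F0 : probability R R) (lam : R).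
Hypothesis F0_supp : F0 `]-oo, 0%R[%classic = 0.
Hypothesis F0_set1 : forall x, F0 [set x] = 0.
Hypothesis lam0 : (0 < lam)%R.
Hypothesis intPhi : intensity P (fun w => Phi w) = lam%:E.
Hypothesis interPhi : has_interarrival_dist P theta Phi F0 lam.

Local Notation J := (campbell_measure P cPhi).

Lemma mker_comp dS (S : measurableType dS) (W : S -> T) : measurable_fun setT W ->
  forall B, measurable B -> measurable_fun setT (fun z => Phi (W z) B).
Proof. move=> mW B mB. exact: (measurableT_comp (measurable_kernel Phi B mB) mW). Qed.

Let kappa (z : T * R) := Phi z.1.

Let mkappa B : measurable B -> measurable_fun setT (kappa ^~ B).
Proof. by apply: mker_comp; exact: measurable_fst. Qed.

Let ckappa (z : T * R) : counting_conf (kappa z). Proof. exact: cPhi. Qed.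

Let mpoints (v : R) : measurable [set z : T * R | 0 < Phi z.1 `](z.2 - v)%R, z.2[%classic].
Proof. by apply: (measurable_points mkappa ckappa) => //; exact: measurable_funB. Qed.

Let mvoid (v : R) : measurable [set z : T * R | Phi z.1 `](z.2 - v)%R, z.2[%classic = 0].
Proof. by apply: (measurable_void mkappa ckappa) => //; exact: measurable_funB. Qed.

Lemma shift_oo w s a b : Phi (theta s w) `]a, b[%classic = Phi w `](a + s)%R, (b + s)%R[%classic.
Proof. by rewrite statPhi// addr_image_oo. Qed.

Lemma shift_set1 w s a : Phi (theta s w) [set a] = Phi w [set (a + s)%R].
Proof. by rewrite statPhi// image_set1. Qed.

(** [Negz 0] is the index -1: the gap ending at the point which the Palm shift puts at the origin,
    that is, the age seen by that point. *)
Lemma palm_sum_interarrival v :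
  palm_sum P theta Phi (interarrival Phi (Negz 0) @^-1` `]-oo, v]%classic) =
  lam%:E * F0 `]-oo, (lam * v)%R]%classic.
Proof.
have := interPhi (Negz 0) v; rewrite /palm intPhi/= dist_funE => <-.
by rewrite muleA -EFinM divff ?mul1e// gt_eqF.
Qed.

(** A point at distance less than v before s forces a gap at most v, and is forced by a gap at most
    v' < v. Letting v' increase to v closes the squeeze because [F0] has no atoms. *)
Lemma campbell_void v : (0 < v)%R ->
  J [set z | Phi z.1 `](z.2 - v)%R, z.2[%classic = 0] = lam%:E * F0 `](lam * v)%R, +oo[%classic.
Proof.
move=> v0.
have F00 : F0 `]-oo, (lam * 0)%R]%classic = 0.
  rewrite mulr0 (_ : `]-oo, 0%R]%classic = `]-oo, 0%R[%classic `|` [set 0%R]);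
    first by rewrite measureU0 //; exact: F0_set1.
  apply/seteqP; split => y /=; rewrite !in_itv/= le_eqVlt.
    by move=> /predU1P[->|]; [right|left].
  by move=> [->|->]; rewrite ?eqxx ?orbT.
have conf w s : (forall t, Phi w [set t] <= 1) -> 0 < Phi w [set s] ->
    (forall t, Phi (theta s w) [set t] <= 1) /\ 0 < Phi (theta s w) [set 0%R].
  by move=> sw h; split => [t|]; rewrite shift_set1// add0r.
have ooE a w s : Phi (theta s w) `](- a)%R, 0%R[%classic = Phi w `](s - a)%R, s[%classic.
  by rewrite shift_oo add0r addrC.
have le_ v' : J [set z | 0 < Phi z.1 `](z.2 - v')%R, z.2[%classic] <=
    lam%:E * F0 `]-oo, (lam * v')%R]%classic.
  rewrite -palm_sum_interarrival; apply: campbell_le_palm_sum => // w s sw Ds ms /= h.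
  have [sw' ms'] := conf w s sw ms.
  by rewrite in_itv/=; apply: (point_inter (cPhi (theta s w)) sw' ms'); rewrite ooE.
(* Without an earlier point the gap reads at most 0, so this event is bounded by the [F0]-mass of
   ]-oo, 0], which vanishes. *)
pose none := \bigcap_n [set z | Phi z.1 `](z.2 - n.+1%:R)%R, z.2[%classic = 0].
have mnone : measurable none by apply: bigcapT_measurable => n; exact: mvoid.
have none0 : J none = 0.
  apply/eqP; rewrite eq_le measure_ge0 andbT.
  apply: (@le_trans _ _ (lam%:E * F0 `]-oo, (lam * 0)%R]%classic)); last by rewrite F00 mule0.
  rewrite -palm_sum_interarrival; apply: campbell_le_palm_sum => // w s sw Ds ms /= h.
  have [sw' ms'] := conf w s sw ms.
  rewrite in_itv/=; apply: (no_point_inter (cPhi (theta s w)) sw' ms') => n; rewrite ooE.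
  exact: (h n).
have ge_ v' : (v' < v)%R -> lam%:E * F0 `]-oo, (lam * v')%R]%classic <=
    J [set z | 0 < Phi z.1 `](z.2 - v)%R, z.2[%classic].
  move=> v'v; rewrite -palm_sum_interarrival.
  apply: (@le_trans _ _ (J ([set z | 0 < Phi z.1 `](z.2 - v)%R, z.2[%classic] `|` none))); last first.
    by rewrite measureU0.
  apply: palm_sum_le_campbell => //; first exact: measurableU.
  move=> w s sw Ds ms; rewrite /= in_itv/= => h.
  have [sw' ms'] := conf w s sw ms.
  have [] := inter_point (cPhi (theta s w)) sw' ms' v'v h; rewrite ?ooE; first by left.
  by move=> h'; right => n _ /=; rewrite -ooE.
have JE : J [set z | 0 < Phi z.1 `](z.2 - v)%R, z.2[%classic] = lam%:E * F0 `]-oo, (lam * v)%R]%classic.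
  apply/eqP; rewrite eq_le le_/=.
  have h : lam%:E * F0 `]-oo, (lam * v - n.+1%:R^-1)%R]%classic @[n --> \oo] -->
     lam%:E * F0 `]-oo, (lam * v)%R]%classic.
    by apply: cvgeZl => //; exact: dist_fun_left.
  apply: (cvge_le _ h); apply: nearW => n.
  rewrite (_ : (lam * v - n.+1%:R^-1)%R = (lam * (v - lam^-1 * n.+1%:R^-1))%R).
    by apply: ge_; rewrite ltrBlDr ltrDl mulr_gt0 ?invr_gt0.
  by rewrite mulrBr mulrA divff ?mul1r// gt_eqF.
rewrite (_ : [set z | _] = ~` [set z | 0 < Phi z.1 `](z.2 - v)%R, z.2[%classic]); last first.
  apply/seteqP; split => z /=; first by move=> ->; rewrite ltxx.
  by move/negP; rewrite -leNgt => h; apply/eqP; rewrite eq_le h measure_ge0.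
have JT : J setT = lam%:E by rewrite -intPhi; exact: campbell_setT.
have JToo : J setT < +oo by rewrite JT ltry.
set Pts := [set z | 0 < _].
have mPts : measurable Pts by exact: mpoints.
have -> : J (~` Pts) = J setT - J Pts by rewrite -setTD measureD// setTI.
rewrite JT JE -[X in X - _ = _]mule1 -dist_funE.
rewrite -[`](lam * v)%R, +oo[%classic]setCK setCitvr probability_setC// -dist_funE.
by rewrite muleBr ?fin_num_adde_defl //.
Qed.

End palm_age.

(** * The first point after a given time *)

Section first_point.
Context {R : realType} (mu : {measure set R -> \bar R}).
Hypothesis cmu : counting_conf mu.
Hypothesis smu : forall t, mu [set t] <= 1.

Lemma measurable_next_points (t a : R) :
  measurable [set s | (t <= s)%R /\ mu `](t - a)%R, s[%classic = 0].
Proof.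
rewrite (_ : [set s | _] = `[t, +oo[%classic `&` [set s | mu `](t - a)%R, s[%classic = 0]).
  apply: measurableI => //; apply: (@measurable_void _ R R (fun=> mu)) => //.
apply/seteqP; split => s /=; by rewrite in_itv/= andbT.
Qed.

(** The infimum of the points after t is attained: if it carried no atom, integrality would make
    some ]s0, s0 + 1/(n+1)[ void, and points could not approach it from the right. *)
Lemma first_point_exists (t : R) : (exists n : nat, 0 < mu `[t, (t + n%:R)%R]%classic) ->
  exists s0, [/\ (t <= s0)%R, 0 < mu [set s0] &
    forall s, (t <= s)%R -> 0 < mu [set s] -> (s0 <= s)%R].
Proof.
move=> [n tn]; pose A := [set s : R | (t <= s)%R /\ 0 < mu [set s]].
have A0 : A !=set0.
  have [s] := atom_exists cmu (measurable_itv _) (@subset_refl _ `[t, (t + n%:R)%R]%classic) tn.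
  by rewrite /= in_itv/= => /andP[ts _] ms; exists s.
have lA : has_lbound A by exists t => s [].
pose s0 := inf A.
have ts0 : (t <= s0)%R by apply: lb_le_inf => // s [].
have s0le s : A s -> (s0 <= s)%R by move=> As; exact: ge_inf.
exists s0; split => //; last by move=> s ts ms; exact: s0le.
rewrite lt0e measure_ge0 andbT; apply/eqP => ms0.
pose B (n : nat) := `]s0, (s0 + n.+1%:R^-1)%R[%classic.
have mB m : measurable (B m) by exact: measurable_itv.
have Bab m : B m `<=` `[s0, (s0 + 1)%R]%classic.
  move=> x; rewrite /B /= !in_itv/= => /andP[h1 h2]; rewrite ltW//=.
  by apply: (le_trans (ltW h2)); rewrite lerD2l invf_le1 ?ler1n.
have niB : nonincreasing_seq B.
  move=> i j ij; apply/subsetPset => x; rewrite /B /= !in_itv/= => /andP[-> /lt_le_trans].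
  by apply; rewrite lerD2l lef_pV2 ?posrE// ler_nat.
have [|m Bm0] := conf_decreasing_eq0 cmu mB Bab niB.
  rewrite (_ : \bigcap_n _ = set0) ?measure0// -subset0 => x Bx.
  have := Bx 0%N I; rewrite /B /= in_itv/= => /andP[s0x _].
  have [m] := ltr_add_invr s0x; have := Bx m I; rewrite /B /= in_itv/= => /andP[_ h1] h2.
  by move: (lt_trans h1 h2); rewrite ltxx.
have [|s [ts ms] ss0] := @inf_adherent R A m.+1%:R^-1 _ (conj A0 lA); first by rewrite invr_gt0.
have ss : (s0 < s)%R.
  by rewrite lt_neqAle s0le// andbT; apply/eqP => h; move: ms; rewrite -h ms0 ltxx.
suff : mu [set s] = 0 by move=> h; move: ms; rewrite h ltxx.
apply: subset_measure0 Bm0 => //.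
by move=> x /= ->; rewrite /B /= in_itv/= ss.
Qed.

(* The only point s >= t with no point in ]t - a, s[ is the first one after t. *)
Lemma measure_next_points (t a : R) : (0 < a)%R ->
  mu [set s | (t <= s)%R /\ mu `](t - a)%R, s[%classic = 0] =
  (if `[< mu `](t - a)%R, t[%classic = 0 /\
     exists n : nat, 0 < mu `[t, (t + n%:R)%R]%classic >] then 1 else 0).
Proof.
move=> a0; set S := [set s | _].
have mS : measurable S by exact: measurable_next_points.
case: asboolP => [[V E]|nVE].
  have [s0 [ts0 ms0 s0le]] := first_point_exists E.
  have ms1 : mu [set s0] = 1.
    apply/eqP; rewrite eq_le smu/= (@conf_ge1 _ mu cmu s0 s0) //.
    by move=> x /= ->; rewrite in_itv/= lexx.
  have noatom (x y : R) : (y <= s0)%R -> (t - a <= x)%R -> mu `]x, y[%classic = 0.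
    move=> ys0 tax; apply: (no_atom_measure0 cmu (measurable_itv _) (@subset_itv_oo_cc _ _ x y)).
    move=> s /=; rewrite in_itv/= => /andP[xs sy]; apply/eqP.
    rewrite eq_le measure_ge0 andbT leNgt; apply/negP => ms.
    have [ts|st] := leP t s; first by have := s0le _ ts ms; rewrite leNgt (lt_le_trans sy ys0).
    have : mu [set s] = 0.
      apply: subset_measure0 V => //.
      by move=> z /= ->; rewrite in_itv/= st andbT (le_lt_trans tax xs).
    by move=> h; move: ms; rewrite h ltxx.
  apply/eqP; rewrite eq_le -ms1; apply/andP; split; last first.
    apply: le_measure; rewrite ?inE// => x /= ->; split => //; exact: noatom.
  rewrite -[leRHS]add0e -(noatom (t - a)%R s0)//.
  apply: (@le_trans _ _ (mu (`](t - a)%R, s0[%classic `|` [set s0]))); last exact: measureU2.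
  apply: le_measure; rewrite ?inE//; first exact: measurableU.
  move=> s [ts Vs]; have [ss0|s0s|->] := ltgtP s s0; last by right.
    by left; rewrite /= in_itv/= ss0 andbT; apply: lt_le_trans ts; rewrite ltrBlDr ltrDl.
  exfalso; suff : 0 < mu `](t - a)%R, s[%classic by rewrite Vs ltxx.
  apply: (lt_le_trans ms0); apply: le_measure; rewrite ?inE// => x /= ->.
  by rewrite in_itv/= s0s andbT; apply: lt_le_trans ts0; rewrite ltrBlDr ltrDl.
have [V|nV] := pselect (mu `](t - a)%R, t[%classic = 0); last first.
  rewrite (_ : S = set0) ?measure0// -subset0 => s [ts Vs]; apply: nV.
  apply: subset_measure0 Vs => //.
  by move=> x /=; rewrite !in_itv/= => /andP[-> /lt_le_trans]; exact.
have E n : mu `[t, (t + n%:R)%R]%classic = 0.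
  apply/eqP; rewrite eq_le measure_ge0 andbT leNgt; apply/negP => h.
  by apply: nVE; split => //; exists n.
have S0 : mu (\bigcup_n `[t, (t + n%:R)%R]%classic) = 0.
  apply/eqP; rewrite eq_le measure_ge0 andbT.
  apply: (@le_trans _ _ (\sum_(0 <= n <oo) mu `[t, (t + n%:R)%R]%classic)).
    apply: measure_sigma_subadditive => //; exact: bigcup_measurable.
  by rewrite eseries0.
apply: subset_measure0 S0 => //; first exact: bigcup_measurable.
move=> s [ts _]; exists (Num.truncn (s - t)).+1 => //=.
by rewrite in_itv/= ts/= -lerBlDl ltW// truncnS_gt.
Qed.

End first_point.

(** * Affine substitutions and the age measure *)

Section lebesgue_substitutions.
Context {R : realType}.
Local Notation leb := (@lebesgue_measure R).

Lemma integral_affine (k b : R) (D : set R) (f : R -> \bar R) : (0 < k)%R ->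
  measurable D -> measurable_fun setT f -> (forall x, 0 <= f x) ->
  k%:E * \int[leb]_(x in (fun x => k * x + b)%R @^-1` D) f (k * x + b)%R =
  \int[leb]_(x in D) f x.
Proof.
move=> k0 mD mf f0.
have mphi := measurable_affine k b.
have k0' : (0 <= k)%R by exact: ltW.
have := @ge0_integral_pushforward _ _ _ _ R _ mphi leb D f mD (measurable_funTS mf) (fun y _ => f0 y).
rewrite /comp => <-.
have -> : \int[leb]_(x in D) f x =
    \int[mscale (NngNum k0') (image_measure leb mphi)]_(x in D) f x.
  apply: eq_measure_integral => A mA AD.
  suff E : leb A = k%:E * leb ((fun x => k * x + b)%R @^-1` A) by exact: E || exact: esym E.
  by rewrite lebesgue_measure_scale_shift// muleA -EFinM divff ?mul1e// gt_eqF.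
rewrite ge0_integral_mscale//; exact: measurable_funTS.
Qed.

Lemma lebesgue_measure_reflect (s : R) (A : set R) : measurable A ->
  leb ((fun u : R => s - u)%R @^-1` A) = leb A.
Proof.
move=> mA; pose B := (fun u : R => 1 * u + s)%R @^-1` A.
have mB : measurable B by rewrite -[X in measurable X]setTI; exact: (measurable_affine 1 s).
transitivity (leb B); last by rewrite lebesgue_measure_scale_shift// invr1 mul1e.
rewrite -[RHS]lebesgue_measureN//; congr leb; apply/seteqP.
by split => u; rewrite /B/= mul1r addrC.
Qed.

End lebesgue_substitutions.

Section age_measure.
Context {R : realType} (F0 : probability R R).
Local Notation leb := (@lebesgue_measure R).

Lemma dist_fun_nd : {homo dist_fun F0 : x y / (x <= y)%R}.
Proof.
move=> x y xy; rewrite -lee_fin !dist_funE; apply: le_measure; rewrite ?inE//.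
by move=> z /=; rewrite !in_itv/= => /le_trans; exact.
Qed.

Lemma measurable_dist_fun : measurable_fun setT (dist_fun F0).
Proof. apply: nondecreasing_measurable => //; exact: dist_fun_nd. Qed.

Let h (s : R) : \bar R := (1 - dist_fun F0 s)%:E.

Let h0 s : 0 <= h s. Proof. by rewrite lee_fin subr_ge0 dist_fun_le1. Qed.

Let mh : measurable_fun setT h.
Proof. by apply/measurable_EFinP; apply: measurable_funB => //; exact: measurable_dist_fun. Qed.

Let age_dist0 : age_dist F0 set0 = 0.
Proof. by rewrite /age_dist set0I integral_set0. Qed.

Let age_dist_ge0 A : 0 <= age_dist F0 A.
Proof. by apply: integral_ge0 => s _; exact: h0. Qed.

Let age_dist_sigma_additive : semi_sigma_additive (age_dist F0 : set R -> \bar R).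
Proof.
move=> F mF tF mUF.
pose G n := F n `&` `[0%R, +oo[%classic.
have mG n : measurable (G n) by exact: measurableI (mF n) _.
have tG : trivIset setT G by exact: trivIset_setIr.
have mUG : measurable (\bigcup_n G n) by exact: bigcupT_measurable.
have := @semi_sigma_additive_nng_induced _ _ R leb h mh h0 G mG tG mUG.
by rewrite -setI_bigcupl.
Qed.

Definition age_measure : {measure set R -> \bar R} :=
  HB.pack (age_dist F0 : set R -> \bar R)
    (isMeasure.Build _ R R (age_dist F0 : set R -> \bar R) age_dist0 age_dist_ge0
    age_dist_sigma_additive).

Lemma age_measureE A : age_measure A = age_dist F0 A.
Proof. by []. Qed.

Lemma age_measure_neg : age_measure `]-oo, 0%R]%classic = 0.
Proof.
rewrite age_measureE /age_dist.
rewrite (_ : _ `&` _ = [set 0%R]) ?integral_set1//.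
apply/seteqP; split => x /=; rewrite !in_itv/= andbT.
  by move=> [h1 h2]; apply/eqP; rewrite eq_le h1.
by move=> ->.
Qed.

Lemma ccdfE x : F0 `]x, +oo[%classic = (1 - dist_fun F0 x)%:E.
Proof. by rewrite -[`]x, +oo[%classic]setCK setCitvr probability_setC// -dist_funE. Qed.

Lemma age_measure_ray (b : R) : (0 <= b)%R ->
  age_measure `]b, +oo[%classic = \int[leb]_(s in `[b, +oo[) F0 `]s, +oo[%classic.
Proof.
move=> b0; rewrite age_measureE /age_dist setIidl; last first.
  by move=> x /=; rewrite !in_itv/= !andbT => h1; exact/ltW/(le_lt_trans b0).
rewrite -integral_itv_obnd_cbnd; first by apply: eq_integral => s _; rewrite ccdfE.
apply: (eq_measurable_fun h) => [s _|]; last exact: measurable_funTS.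
by rewrite ccdfE.
Qed.

Hypothesis F0_supp : F0 `]-oo, 0%R[%classic = 0.
Hypothesis F0_mean : \int[F0]_t t%:E = 1.

(** The total mass is the mean of [F0], by the tail formula for expectations. That formula wants a
    variable nonnegative everywhere, hence the positive part, which equals the identity off the
    [F0]-null negative half-line. *)
Lemma age_measureT : age_measure setT = 1.
Proof.
pose X (t : R) := Num.max t 0%R.
have mX : measurable_fun setT X by apply: measurable_maxr => //; exact: measurable_cst.
pose X' : {RV F0 >-> R} := HB.pack X (isMeasurableFun.Build _ _ _ _ X mX).
have X0 t : (0 <= X' t)%R by rewrite /X' /X /= le_max lexx orbT.
have <- : 'E_F0[X'] = 1.
  rewrite expectation_def -F0_mean.
  have mN : measurable (`]-oo, 0%R[%classic : set R) by [].
  rewrite [RHS](integralE _ _ (fun t : R => t%:E)) [X in _ - X](_ : _ = 0) ?sube0.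
    by apply: eq_integral => t _; rewrite /X' /X /= funeposE -EFin_max.
  apply/eqP; rewrite eq_le integral_ge0 ?andbT; last by [].
  rewrite (ge0_negligible_integral mN measurableT)//; last first.
    exact/measurable_funeneg/measurable_EFinP.
  rewrite (_ : \int[_]_(_ in _) _ = 0)//; apply: integral0_eq => t [_ /=].
  rewrite in_itv/= => /negP; rewrite -leNgt => t0.
  by rewrite funenegE -EFinN -EFin_max; congr EFin; apply/max_idPr; rewrite oppr_le0.
rewrite (ge0_expectation_ccdf X0) age_measureE /age_dist setTI.
apply: eq_integral => s /set_mem /=; rewrite in_itv/= andbT => s0.
rewrite -ccdfE /ccdf /distribution /pushforward; congr (F0 _).
apply/seteqP; split => t; rewrite /X' /X /= !in_itv/= !andbT lt_max.
  by move=> ->.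
by move=> /orP[//|]; rewrite ltNge s0.
Qed.

End age_measure.

Lemma measurable_le_set dS (S : measurableType dS) (R : realType) (f g : S -> R) :
  measurable_fun setT f -> measurable_fun setT g ->
  measurable [set z | (f z <= g z)%R].
Proof.
move=> mf mg; have := measurable_fun_ler mf mg measurableT (Y := [set true]).
by rewrite setTI; apply.
Qed.

Lemma addr_image_itv {R : realType} (c d : bool) (a b s : R) :
  [set (t + s)%R | t in [set` Interval (BSide c a) (BSide d b)]] =
  [set` Interval (BSide c (a + s)%R) (BSide d (b + s)%R)].
Proof.
apply/seteqP; split => x /=.
  by move=> [t + <-]; case: c; case: d; rewrite !in_itv/= !(ltrD2r,lerD2r).
move=> xD; exists (x - s)%R; last by rewrite subrK.
by move: xD; case: c; case: d; rewrite !in_itv/= ?(ltrBrDr,lerBrDr) ?(ltrBlDr,lerBlDr).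
Qed.

Section finite_measure_of.
Context d (T : measurableType d) (R : realType) (m : {measure set T -> \bar R}).
Hypothesis fm : fin_num_fun m.

Let sigma_fm : sigma_finite setT m.
Proof. by apply: fin_num_fun_sigma_finite; [rewrite measure0|exact: fm]. Qed.

Let sfm : sfinite_measure m.
Proof. exact: sfinite_measure_sigma_finite. Qed.

Definition finite_measure_of : {finite_measure set T -> \bar R} :=
  let H1 := isFinite.Build _ _ _ _ fm in
  let H2 := isSFinite.Build _ _ _ _ sfm in
  let H3 := isSigmaFinite.Build _ _ _ _ sigma_fm in
  HB.pack_for (FiniteMeasure.type T R) (Measure.sort m) H1 H2 H3.

End finite_measure_of.

(** * Inversion: from gaps seen at points to stationary void probabilities *)

Section stationary_age.
Context (R : realType) d (T : measurableType d) (P : probability T R) (theta : R -> T -> T).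
Hypothesis Hflow : measure_preserving_flow P theta.
Variable Phi : R.-ker T ~> R.
Hypothesis cPhi : forall w, counting_conf (Phi w).
Hypothesis simPhi : simple_pp P Phi.
Hypothesis statPhi : stationary_pp theta Phi.
Variables (F0 : probability R R) (lam : R).
Hypothesis F0_supp : F0 `]-oo, 0%R[%classic = 0.
Hypothesis F0_set1 : forall x, F0 [set x] = 0.
Hypothesis F0_mean : \int[F0]_t t%:E = 1.
Hypothesis lam0 : (0 < lam)%R.
Hypothesis intPhi : intensity P (fun w => Phi w) = lam%:E.
Hypothesis interPhi : has_interarrival_dist P theta Phi F0 lam.

Local Notation J := (campbell_measure P cPhi).
Local Notation leb := (@lebesgue_measure R).

Lemma campbell_finite : fin_num_fun J.
Proof.
apply: lty_fin_num_fun; rewrite (_ : J setT = lam%:E) ?ltry// -intPhi.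
exact: campbell_setT.
Qed.

Definition campbell_fin := finite_measure_of campbell_finite.

Lemma measurable_flow t : measurable_fun setT (theta t).
Proof.
have [mtheta _ _ _] := Hflow.
exact: (measurableT_comp mtheta (pair1_measurable t)).
Qed.

Lemma flow_invariant t (h : T -> \bar R) : measurable_fun setT h -> (forall w, 0 <= h w) ->
  \int[P]_w h (theta t w) = \int[P]_w h w.
Proof.
move=> mh h0; have [_ _ _ Ptheta] := Hflow.
have := @ge0_integral_pushforward _ _ _ _ R _ (measurable_flow t) P setT h measurableT mh (fun y
  _ => h0 y).
rewrite preimage_setT => E.
transitivity (\int[image_measure P (measurable_flow t)]_w h w); first exact: esym E.
by apply: eq_measure_integral => A mA _; exact: Ptheta.
Qed.

Variable a : R.
Hypothesis a0 : (0 < a)%R.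

(** Pairs of a marked point s and a time u <= s with nothing in ]u - a, s[: s is the first point
    from u on, and the a time units before u are empty. *)
Let Wset : set ((T * R) * R) :=
  [set p | (p.2 <= p.1.2)%R /\ Phi p.1.1 `](p.2 - a)%R, p.1.2[%classic = 0].

Let m11 : measurable_fun setT (fun p : (T * R) * R => p.1.1).
Proof. by apply: measurableT_comp => //; exact: measurable_fst. Qed.

Let m12 : measurable_fun setT (fun p : (T * R) * R => p.1.2).
Proof. by apply: measurableT_comp => //; exact: measurable_snd. Qed.

Let m2 : measurable_fun setT (fun p : (T * R) * R => p.2).
Proof. exact: measurable_snd. Qed.

Let mvoid3 (X Y : (T * R) * R -> R) : measurable_fun setT X -> measurable_fun setT Y ->
  measurable [set p | Phi p.1.1 `]X p, Y p[%classic = 0].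
Proof.
by move=> mX mY; apply: (measurable_void (kappa := fun p : (T * R) * R => Phi p.1.1)) => //;
  exact: mker_comp.
Qed.

Let mWset : measurable Wset.
Proof.
rewrite (_ : Wset = [set p | (p.2 <= p.1.2)%R] `&`
   [set p | Phi p.1.1 `](p.2 - a)%R, p.1.2[%classic = 0])//.
apply: measurableI; first exact: measurable_le_set.
by apply: mvoid3 => //; exact: measurable_funB.
Qed.

Let f (u : R) := J (ysection Wset u).

Let mf : measurable_fun setT f.
Proof. exact: (measurable_fun_ysection campbell_fin mWset). Qed.

Let f0 u : 0 <= f u. Proof. exact: measure_ge0. Qed.

(** [Wset] in the coordinate r = s - u. Its section at r >= 0 asks for a void of length r + a before
    s, which [campbell_void] evaluates. *)
Let W'set : set ((T * R) * R) :=
  [set p | (0 <= p.2)%R /\ Phi p.1.1 `](p.1.2 - (p.2 + a))%R, p.1.2[%classic = 0].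

Let mW'set : measurable W'set.
Proof.
rewrite (_ : W'set = [set p | (0 <= p.2)%R] `&`
   [set p | Phi p.1.1 `](p.1.2 - (p.2 + a))%R, p.1.2[%classic = 0])//.
apply: measurableI; first by apply: measurable_le_set => //; exact: measurable_cst.
by apply: mvoid3 => //; apply: measurable_funB => //; exact: measurable_funD.
Qed.

Let tonelli (A : set ((T * R) * R)) : measurable A ->
  \int[leb]_u J (ysection A u) = \int[campbell_fin]_z leb (xsection A z).
Proof.
move=> mA; have := indic_fubini_tonelli campbell_fin leb mA.
have FE := indic_fubini_tonelli_FE leb mA.
have GE := indic_fubini_tonelli_GE campbell_fin mA.
rewrite FE => E; rewrite -[RHS]/(\int[campbell_fin]_z (leb \o xsection A) z) E.
by apply: eq_integral => u _; exact: esym (congr1 (@^~ u) GE).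
Qed.

(* Substituting r = s - u, the time back from the point s. *)
Let integral_f : \int[leb]_u f u = age_measure F0 `](lam * a)%R, +oo[%classic.
Proof.
rewrite tonelli// (_ : \int[_]_z _ = \int[campbell_fin]_z leb (xsection W'set z)); last first.
  apply: eq_integral => z _; rewrite -(lebesgue_measure_reflect z.2); last exact: measurable_xsection.
  congr leb.
  have E u : (z.2 - u - a = z.2 - (u + a))%R by rewrite opprD addrA.
  have E' u : (z.2 - u <= z.2)%R = (0 <= u)%R by rewrite gerDl oppr_le0.
  apply/seteqP; split => u; rewrite /xsection /preimage /= !inE /Wset /W'set /= E E' => -[].
    by [].
  by [].
rewrite -tonelli// age_measure_ray ?mulr_ge0 ?ltW//.
have mg : measurable_fun setT (fun s : R => F0 `]s, +oo[%classic).
  apply: (eq_measurable_fun (fun s => (1 - dist_fun F0 s)%:E)) => [s _|]; first by rewrite ccdfE.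
  apply/measurable_EFinP; apply: measurable_funB => //; exact: measurable_dist_fun.
pose g (s : R) := F0 `]s, +oo[%classic.
have g0 s : 0 <= g s by exact: measure_ge0.
have IA := @integral_affine R lam (lam * a) _ g lam0 (measurable_itv `[(lam * a)%R, +oo[) mg g0.
transitivity (\int[leb]_(x in `[(lam * a)%R, +oo[%classic) g x); last by [].
rewrite -IA -ge0_integralZl//; last 3 first.
- rewrite -[X in measurable X]setTI; exact: (measurable_affine lam (lam * a)).
- apply: measurable_funTS.
  apply: (eq_measurable_fun (fun r => (1 - dist_fun F0 (lam * r + lam * a))%:E)) => [r _|].
    by rewrite /g ccdfE.
  apply/measurable_EFinP; apply: measurable_funB => //.
  apply: measurableT_comp; first exact: measurable_dist_fun.
  by apply: measurable_funD => //; exact: mulrl_measurable.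
- by rewrite lee_fin ltW.
rewrite [RHS]integral_mkcond; apply: eq_integral => r _.
have rE : (r \in (fun x : R => lam * x + lam * a)%R @^-1` `[(lam * a)%R, +oo[%classic) = (0 <= r)%R.
  apply/idP/idP => [/set_mem|r0]; last apply/mem_set; rewrite /= in_itv/= andbT lerDr pmulr_rge0//.
rewrite patchE rE; case: ifPn => [r0|/negP nr].
  rewrite /g -mulrDr -(campbell_void cPhi simPhi statPhi F0_supp F0_set1 lam0 intPhi interPhi);
    last first.
    by rewrite ltr_wpDl.
  congr (J _); apply/seteqP; split => z; first by move=> /set_mem[].
  by move=> Vz; apply/mem_set; split.
rewrite (_ : ysection _ _ = set0) ?measure0// -subset0 => z.
by move=> /set_mem[/= r0 _]; apply: nr.
Qed.

Let Q (t : R) := [set w | Phi w `](t - a)%R, t[%classic = 0 /\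
   exists n : nat, 0 < Phi w `[t, (t + n%:R)%R]%classic].

Let mV t : measurable [set w | Phi w `](t - a)%R, t[%classic = 0].
Proof.
by apply: (measurable_void (measurable_kernel Phi) cPhi); exact: measurable_cst.
Qed.

Let mE t : measurable [set w | exists n : nat, 0 < Phi w `[t, (t + n%:R)%R]%classic].
Proof.
rewrite (_ : [set w | _] = \bigcup_n [set w | 0 < Phi w `[t, (t + n%:R)%R]%classic]).
  apply: bigcupT_measurable => n.
  rewrite -[X in measurable X]setTI; apply: emeasurable_fun_o_infty => //.
  exact: measurable_kernel.
by apply/seteqP; split => w /= [n]; exists n.
Qed.

Let mQ t : measurable (Q t). Proof. exact: measurableI (mV t) (mE t). Qed.

Let PQ t : P (Q t) = P (Q 0%R).
Proof.
have [_ _ _ Ptheta] := Hflow.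
have V w : Phi (theta t w) `](0 - a)%R, 0%R[%classic = Phi w `](t - a)%R, t[%classic.
  by rewrite statPhi// addr_image_itv !add0r [(- a + t)%R]addrC.
have E w n : Phi (theta t w) `[0%R, (0 + n%:R)%R]%classic = Phi w `[t, (t + n%:R)%R]%classic.
  by rewrite statPhi// addr_image_itv !add0r [(n%:R + t)%R]addrC.
rewrite -(Ptheta t (Q 0%R))//; congr (P _).
by apply/seteqP; split => w; rewrite /Q /= V => -[-> [n hn]]; split => //; exists n; move: hn; rewrite E.
Qed.

Let S t (w : T) := [set s | (t <= s)%R /\ Phi w `](t - a)%R, s[%classic = 0].

(** [f] only sees points of ]0, 1]. Shifting by k moves the first point after t - k in that window
    to the first point after t in ]k, k + 1]. *)
Let f_window (t : R) (k : nat) :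
  f (t - k%:R) = \int[P]_w Phi w (S t w `&` `]k%:R, (k%:R + 1)%R]%classic).
Proof.
pose h w := Phi w (xsection (ysection Wset (t - k%:R)%R) w `&` `]0%R, 1%R]%classic).
have mys : measurable (ysection Wset (t - k%:R)%R) by exact: measurable_ysection.
have mh : measurable_fun setT h by exact: measurable_campbell_section.
transitivity (\int[P]_w h w) => //.
rewrite -(flow_invariant k%:R mh) ?/h//; apply: eq_integral => w _.
rewrite /h statPhi; last first.
  by apply: measurableI => //; exact: measurable_xsection.
congr (Phi w _); apply/seteqP; split => x /=.
  move=> [s [hs Ds] <-]; have {hs} : Wset ((theta k%:R w, s), (t - k%:R)%R).
    exact: set_mem (set_mem hs).
  move: Ds; rewrite /Wset /= !in_itv/= => /andP[s0 s1] [tks V].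
  split; last by rewrite ltrDr s0/= addrC lerD2l.
  split; first by rewrite -lerBlDr.
  by move: V; rewrite statPhi// addr_image_itv addrAC subrK.
rewrite in_itv/= => -[[tx V] /andP[kx xk]]; exists (x - k%:R)%R; last by rewrite subrK.
split; last by rewrite /= in_itv/= subr_gt0 kx lerBlDr addrC.
apply/mem_set/mem_set; rewrite /Wset /=; split; first by rewrite lerD2r.
by rewrite statPhi// addr_image_itv addrAC !subrK.
Qed.

(** For t > 0 the windows ]k, k + 1] cover all candidates. By [measure_next_points] the total count
    is almost surely the indicator of [Q t], whose probability does not depend on t. *)
Let sum_f (t : R) : (0 < t)%R -> \sum_(0 <= k <oo) f (t - k%:R) = P (Q 0%R).
Proof.
move=> t0; rewrite -(PQ t).
under eq_eseriesr do rewrite f_window.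
have mSw w : measurable (S t w) by exact: measurable_next_points.
have mSk k : measurable_fun setT (fun w => Phi w (S t w `&` `]k%:R, (k%:R + 1)%R]%classic)).
  pose B := [set p : T * R | (t <= p.2)%R /\ Phi p.1 `](t - a)%R, p.2[%classic = 0].
  have mB : measurable B.
    rewrite (_ : B = [set p | (t <= p.2)%R] `&` [set p | Phi p.1 `](t - a)%R, p.2[%classic = 0])//.
    apply: measurableI; first by apply: measurable_le_set => //; exact: measurable_cst.
    apply: (measurable_void (kappa := fun p : T * R => Phi p.1)) => //.
    by apply: mker_comp; exact: measurable_fst.
  have mD : measurable (`]k%:R, (k%:R + 1)%R]%classic : set R) by [].
  suff /(_ B mB)[_] : measurable `<=` [set A | measurable A /\
      measurable_fun setT (fun w => mrestr (Phi w) mD (xsection A w))].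
    by under eq_fun do rewrite /mrestr xsectionE.
  apply: measurable_prod_subset_xsection_kernel => w.
  have [n nE] := cPhi w mD (@subset_itv_oc_cc _ _ _ _).
  exists n.+1%:R => X mX; apply: (@le_lt_trans _ _ n%:R%:E); last first.
    by rewrite lte_fin ltr_nat.
  by rewrite -nE /mrestr; apply: le_measure; rewrite ?inE//; exact: measurableI.
rewrite -integral_nneseries//.
rewrite -(setIT (Q t)) -integral_indic//.
have [N [mN N0 subN]] := simPhi.
apply: ge0_ae_eq_integral => //.
- by apply: ge0_emeasurable_sum => // k x _ _; exact: measure_ge0.
- by apply/measurable_EFinP; exact: measurable_indic.
- by move=> w _; apply: nneseries_ge0.
exists N; split => // w /= nE; apply: subN => /= sw; apply: nE => _.
have tr : trivIset setT (fun k : nat => S t w `&` `]k%:R, (k%:R + 1)%R]%classic).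
  apply: trivIset_setIl; apply/trivIsetP => i j _ _ ij.
  rewrite -subset0 => x [/=]; rewrite !in_itv/= => /andP[ix xi] /andP[jx xj].
  have : (i%:R < j%:R + 1 :> R)%R := lt_le_trans ix xj.
  have : (j%:R < i%:R + 1 :> R)%R := lt_le_trans jx xi.
  by rewrite !natr1 !ltr_nat !ltnS => h1 h2; move/eqP: ij; apply; apply/eqP; rewrite eqn_leq h1 h2.
rewrite -(measure_semi_bigcup (Phi w))//; last 2 first.
- by move=> k; exact: measurableI.
- by apply: bigcupT_measurable => k; exact: measurableI.
rewrite -setI_bigcupr setIidl; last first.
  move=> s [ts _]; have s0 : (0 < s)%R := lt_le_trans t0 ts.
  have ex : exists m : nat, (s <= m%:R)%R.
    by exists (Num.truncn s).+1; exact/ltW/truncnS_gt.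
  (* The window index is the least m with s <= m, lowered by one; m is not 0 because s > 0. *)
  have := ex_minnP ex; case=> -[|k] sm mmin; first by move: s0; rewrite ltNge sm.
  exists k => //=; rewrite in_itv/= natr1 sm andbT ltNge; apply/negP => /mmin.
  by rewrite ltnn.
rewrite measure_next_points// indicE; case: asboolP => h.
  by rewrite mem_set.
by rewrite memNset.
Qed.

(** The constant [P (Q 0)] is its own average over t in ]0, 1]. The translates ]-k, 1 - k] tile
    ]-oo, 1] and [f] vanishes beyond 1, so averaging [sum_f] unfolds into the integral of [f] over
    the line. *)
Let PQE : P (Q 0%R) = age_measure F0 `](lam * a)%R, +oo[%classic.
Proof.
rewrite -integral_f.
have f1 u : (1 < u)%R -> f u = 0.
  move=> u1; apply: integral0_eq => w _.
  rewrite (_ : _ `&` _ = set0) ?measure0// -subset0 => s [].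
  move=> /set_mem/set_mem[/= us _]; rewrite /= in_itv/= => /andP[_ s1].
  by move: (lt_le_trans u1 (le_trans us s1)); rewrite ltxx.
pose I_ (k : nat) := `](- k%:R)%R, (1 - k%:R)%R]%classic : set R.
have UI : \bigcup_k I_ k = `]-oo, 1%R]%classic.
  apply/seteqP; split => x /=.
    move=> [k _]; rewrite /I_ /= !in_itv/= => /andP[_ /le_trans]; apply.
    by rewrite lerBlDr lerDl.
  rewrite in_itv/= => x1; exists (Num.truncn (1 - x)) => //; rewrite /I_ /= in_itv/=.
  have h : (0 <= 1 - x)%R by rewrite subr_ge0.
  have /andP[h1 h2] := truncn_itv h.
  move: h1 h2; rewrite -natr1; move: ((Num.truncn (1 - x))%:R)%R => u h1 h2.
  by apply/andP; split; lra.
have trI : trivIset setT I_.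
  apply/trivIsetP => i j _ _ ij.
  rewrite -subset0 => x [/=]; rewrite /I_ /= !in_itv/= => /andP[ix xi] /andP[jx xj].
  have : (- i%:R < 1 - j%:R :> R)%R := lt_le_trans ix xj.
  have : (- j%:R < 1 - i%:R :> R)%R := lt_le_trans jx xi.
  move=> h1 h2; have : (i%:R < j.+1%:R :> R)%R.
    by rewrite -natr1; move: (i%:R)%R (j%:R)%R h1 h2 => u v h1 h2; lra.
  have : (j%:R < i.+1%:R :> R)%R.
    by rewrite -natr1; move: (i%:R)%R (j%:R)%R h1 h2 => u v h1 h2; lra.
  rewrite !ltr_nat !ltnS => h3 h4.
  by move/eqP: ij; apply; apply/eqP; rewrite eqn_leq h3 h4.
have -> : \int[leb]_u f u = \int[leb]_(u in `]-oo, 1%R]%classic) f u.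
  rewrite [RHS]integral_mkcond; apply: eq_integral => u _; rewrite patchE.
  case: ifPn => // /negP; rewrite inE /= in_itv/= => /negP; rewrite -ltNge; exact: f1.
have mI k : measurable (I_ k) by exact: measurable_itv.
have mfU : measurable_fun (\bigcup_k I_ k) f by exact: measurable_funTS.
rewrite -UI (ge0_integral_bigcup leb mI mfU (fun u _ => f0 u) trI).
transitivity (\sum_(0 <= k <oo) \int[leb]_(t in `]0%R, 1%R]) f (t - k%:R)); last first.
  apply: eq_eseriesr => k _.
  rewrite -(@integral_affine R 1%R (- k%:R)%R (I_ k) f)// mul1e.
  rewrite (_ : _ @^-1` _ = `]0%R, 1%R]%classic).
    by apply: eq_integral => u _; rewrite mul1r.
  by apply/seteqP; split => x; rewrite /I_ /= !in_itv/= mul1r ltrDr lerD2r.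
have mfk k : measurable_fun (`]0%R, 1%R]%classic : set R) (fun t : R => f (t - k%:R)%R).
  apply: measurable_funTS; apply: (measurableT_comp mf).
  by apply: measurable_funB => //; exact: measurable_cst.
have IN := @integral_nneseries _ _ R leb _ (measurable_itv `]0%R, 1%R]) _ mfk (fun k t _ => f0 _).
apply: etrans IN.
rewrite (eq_integral (fun=> P (Q 0%R))); last first.
  by move=> t /set_mem; rewrite /= in_itv/= => /andP[t0 _]; rewrite sum_f.
have l1 : leb `]0%R, 1%R]%classic = 1 by rewrite lebesgue_measure_itv/= lte_fin ltr01 sube0.
transitivity (P (Q 0%R) * leb `]0%R, 1%R]%classic); first by rewrite l1 mule1.
by rewrite integral_cst.
Qed.

Lemma stationary_next_void t :
  P [set w | Phi w `](t - a)%R, t[%classic = 0 /\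
     exists n : nat, 0 < Phi w `[t, (t + n%:R)%R]%classic] =
  age_measure F0 `](lam * a)%R, +oo[%classic.
Proof. by rewrite -[LHS]/(P (Q t)) PQ PQE. Qed.

End stationary_age.

(** * Laws of the age and of the observed rate *)

Section rate_laws.
Context (R : realType) d (T : measurableType d) (P : probability T R) (theta : R -> T -> T).
Hypothesis Hflow : measure_preserving_flow P theta.
Variable Phi : R.-ker T ~> R.
Hypothesis cPhi : forall w, counting_conf (Phi w).
Hypothesis simPhi : simple_pp P Phi.
Hypothesis statPhi : stationary_pp theta Phi.
Variables (F0 : probability R R) (lam : R).
Hypothesis F0_supp : F0 `]-oo, 0%R[%classic = 0.
Hypothesis F0_set1 : forall x, F0 [set x] = 0.
Hypothesis F0_mean : \int[F0]_t t%:E = 1.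
Hypothesis lam0 : (0 < lam)%R.
Hypothesis intPhi : intensity P (fun w => Phi w) = lam%:E.
Hypothesis interPhi : has_interarrival_dist P theta Phi F0 lam.

Local Notation J := (campbell_measure P cPhi).

Let mPhi B : measurable B -> measurable_fun setT (fun w => Phi w B).
Proof. by move=> mB; exact: measurable_kernel. Qed.

Let mVoid t a : measurable [set w | Phi w `](t - a)%R, t[%classic = 0].
Proof. by apply: (measurable_void mPhi cPhi); exact: measurable_cst. Qed.

Let mPt t : measurable [set w | exists n : nat, 0 < Phi w `[t, (t + n%:R)%R]%classic].
Proof.
rewrite (_ : [set w | _] = \bigcup_n [set w | 0 < Phi w `[t, (t + n%:R)%R]%classic]).
  apply: bigcupT_measurable => n.
  rewrite -[X in measurable X]setTI; apply: emeasurable_fun_o_infty => //.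
  exact: mPhi.
by apply/seteqP; split => w /= [n]; exists n.
Qed.

(** The event contains those of [stationary_next_void], whose probabilities increase to the total
    mass 1 of the age measure as the void length tends to 0. It allows [stationary_void] to drop the
    clause on a next point. *)
Lemma exists_next_point t :
  P [set w | exists n : nat, 0 < Phi w `[t, (t + n%:R)%R]%classic] = 1.
Proof.
apply/eqP; rewrite eq_le probability_le1//=.
have h : age_measure F0 `](n.+1%:R^-1)%R, +oo[%classic @[n --> \oo] --> age_measure F0 `]0%R,
  +oo[%classic.
  rewrite (_ : `]0%R, +oo[%classic = \bigcup_n `](n.+1%:R^-1)%R, +oo[%classic).
    apply: (@nondecreasing_cvg_mu _ R R (age_measure F0) (fun n => `](n.+1%:R^-1)%R, +oo[%classic)) => //.
      exact: bigcup_measurable.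
    move=> i j ij; apply/subsetPset => x /=; rewrite !in_itv/= !andbT.
    by apply: le_lt_trans; rewrite lef_pV2 ?posrE// ler_nat.
  apply/seteqP; split => x /=; rewrite in_itv/= andbT.
    by move=> /ltr_add_invr[n]; rewrite add0r => ?; exists n => //=; rewrite in_itv/= andbT.
  by move=> [n _]; rewrite /= in_itv/= andbT; apply: lt_trans; rewrite invr_gt0.
have <- : age_measure F0 `]0%R, +oo[%classic = 1.
  rewrite -(age_measureT F0_supp F0_mean).
  rewrite (_ : setT = `]0%R, +oo[%classic `|` `]-oo, 0%R]%classic); last first.
    apply/seteqP; split => // x _ /=; rewrite !in_itv/= andbT.
    by case: (leP x 0%R) => ?; [right|left].
  by rewrite measureU0//; exact: age_measure_neg.
apply: (cvge_le _ h); apply: nearW => n.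
have -> : (n.+1%:R^-1 = lam * (lam^-1 * n.+1%:R^-1))%R.
  by rewrite mulrA divff ?mul1r// gt_eqF.
rewrite -(stationary_next_void Hflow cPhi simPhi statPhi F0_supp F0_set1 lam0 intPhi interPhi _
  t); last first.
  by rewrite mulr_gt0 ?invr_gt0.
by apply: le_measure; rewrite ?inE//; [exact: measurableI (mVoid t _) (mPt t)|move=> w []].
Qed.

Lemma stationary_void t a : (0 < a)%R ->
  P [set w | Phi w `](t - a)%R, t[%classic = 0] = age_measure F0 `](lam * a)%R, +oo[%classic.
Proof.
move=> a0.
rewrite -(stationary_next_void Hflow cPhi simPhi statPhi F0_supp F0_set1 lam0 intPhi interPhi a0 t).
set V := [set w | _]; set E := [set w | exists n : nat, 0 < Phi w `[t, (t + n%:R)%R]%classic].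
rewrite -[RHS]/(P (V `&` E)).
have mV : measurable V by exact: mVoid.
have mE : measurable E by exact: mPt.
have PE : P (~` E) = 0 by rewrite probability_setC// exists_next_point subee.
apply/eqP; rewrite eq_le; apply/andP; split; last first.
  by apply: le_measure; rewrite ?inE//; do ?[exact: measurableI|move=> w []].
apply: (@le_trans _ _ (P ((V `&` E) `|` ~` E))).
  apply: le_measure; rewrite ?inE//; first by apply: measurableU;
    do ?[exact: measurableI|exact: measurableC].
  by move=> w Vw; have [Ew|nEw] := pselect (E w); [left|right].
by rewrite measureU0 //; do ?[exact: measurableI|exact: measurableC].
Qed.

Let mdil : measurable_fun setT (fun v : R => lam^-1 * v)%R.
Proof. exact: mulrl_measurable. Qed.

Let dil_ray b : (fun v : R => lam^-1 * v)%R @^-1` `]b, +oo[%classic = `](lam * b)%R, +oo[%classic.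
Proof.
by apply/seteqP; split => x /=; rewrite !in_itv/= !andbT ltr_pdivlMl.
Qed.

Let dil_neg : (fun v : R => lam^-1 * v)%R @^-1` `]-oo, 0%R]%classic = `]-oo, 0%R]%classic.
Proof.
by apply/seteqP; split => x /=; rewrite !in_itv/= pmulr_rle0 ?invr_gt0.
Qed.

Lemma stationary_age_law t E : measurable E ->
  P [set w | E (t - last_point (Phi w) t)%R] = age_measure F0 [set v | E (lam^-1 * v)%R].
Proof.
move=> mE; rewrite -[RHS](image_measureE (age_measure F0) mdil E).
apply: (age_lawE mPhi cPhi (Y := cst t)) => //.
- by apply: (@le_lt_trans _ _ 1%:E); [exact: probability_le1|exact: ltry].
- rewrite image_measureE preimage_setT age_measureT//; exact: probability_setT.
- by rewrite image_measureE dil_neg; exact: age_measure_neg.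
- by move=> a a0; rewrite image_measureE dil_ray; exact: stationary_void.
Qed.

Lemma campbell_age_law E : measurable E ->
  J [set z | E (z.2 - last_point (Phi z.1) z.2)%R] = lam%:E * F0 [set v | E (lam^-1 * v)%R].
Proof.
move=> mE; have lam0' : (0 <= lam)%R by exact: ltW.
pose rho : {measure set R -> \bar R} := mscale (NngNum lam0') (image_measure F0 mdil).
rewrite -[RHS]/(rho E).
have JT : J setT = lam%:E by rewrite -intPhi; exact: campbell_setT.
have F0neg : F0 `]-oo, 0%R]%classic = 0.
  rewrite (_ : `]-oo, 0%R]%classic = `]-oo, 0%R[%classic `|` [set 0%R]).
    by rewrite measureU0 //; exact: F0_set1.
  apply/seteqP; split => y /=; rewrite !in_itv/= le_eqVlt.
    by move=> /predU1P[->|]; [right|left].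
  by move=> [->|->]; rewrite ?eqxx ?orbT.
apply: (@age_lawE _ _ _ (fun z : T * R => Phi z.1) _ _ snd) => //.
- by move=> B mB; apply: mker_comp => //; exact: measurable_fst.
- by rewrite JT ltry.
- by rewrite JT -[RHS]/(lam%:E * F0 setT) probability_setT mule1.
- by rewrite -[LHS]/(lam%:E * F0 (_ @^-1` _)) dil_neg F0neg mule0.
- move=> a a0; rewrite -[RHS]/(lam%:E * F0 (_ @^-1` _)) dil_ray.
  exact: (campbell_void cPhi simPhi statPhi F0_supp F0_set1 lam0 intPhi interPhi).
Qed.

Variable eta : R -> R.
Hypothesis meta : measurable_fun setT eta.

Let mrate x : measurable [set u : R | (x < lam * eta (lam * u))%R].
Proof.
apply: measurable_lt_set; first exact: measurable_cst.
apply: measurable_funM; first exact: measurable_cst.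
by apply: measurableT_comp => //; exact: mulrl_measurable.
Qed.

Lemma stationary_rate_law t x :
  P [set w | (x < observed_rate eta lam Phi t w)%R] =
  age_measure F0 [set v | (x < lam * eta v)%R].
Proof.
rewrite (stationary_age_law t (mrate x)); congr (age_measure F0 _).
by apply/seteqP; split => v /=; rewrite mulrA divff ?mul1r// gt_eqF.
Qed.

Lemma campbell_rate_law x :
  J [set z | (x < observed_rate eta lam Phi z.2 z.1)%R] =
  lam%:E * F0 [set v | (x < lam * eta v)%R].
Proof.
rewrite (campbell_age_law (mrate x)); congr (_ * F0 _).
by apply/seteqP; split => v /=; rewrite mulrA divff ?mul1r// gt_eqF.
Qed.

End rate_laws.

(** * Independence and the number of hot items *)

(** The generators of [pp_sigma_algebra], named so that the history of one process becomes a
    measurable type to which measurability lemmas apply. *)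
Definition counting_events {R : realType} {d} {T : measurableType d} (Phi : R.-ker T ~> R) :
  set (set T) :=
  [set A : set T | exists (B : set R) (U : set (\bar R)),
        [/\ measurable B, measurable U & A = (fun w => Phi w B) @^-1` U]].

Lemma pp_sigma_algebraE {R : realType} {d} {T : measurableType d} (Phi : R.-ker T ~> R) :
  pp_sigma_algebra Phi = @measurable _ (g_sigma_algebraType (counting_events Phi)).
Proof. by []. Qed.

Lemma pp_sigma_algebra_measurable {R : realType} {d} {T : measurableType d} (Phi : R.-ker T ~> R) A :
  pp_sigma_algebra Phi A -> measurable A.
Proof.
apply: smallest_sub => //; first exact: sigma_algebra_measurable.
move=> _ [B [U [mB mU ->]]]; rewrite -[X in measurable X]setTI.
exact: (measurable_kernel Phi B mB).
Qed.

Lemma pp_sigma_algebraT {R : realType} {d} {T : measurableType d} (Phi : R.-ker T ~> R) :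
  pp_sigma_algebra Phi setT.
Proof. by rewrite pp_sigma_algebraE; exact: measurableT. Qed.

Lemma pp_sigma_algebraI {R : realType} {d} {T : measurableType d} (Phi : R.-ker T ~> R) A B :
  pp_sigma_algebra Phi A -> pp_sigma_algebra Phi B -> pp_sigma_algebra Phi (A `&` B).
Proof. by rewrite pp_sigma_algebraE; exact: measurableI. Qed.

Section restricted_integral.
Context d (T : measurableType d) (R : realType) (mu : {measure set T -> \bar R}).

Lemma ge0_integral_mrestr (D : set T) (mD : measurable D) (h : T -> \bar R) :
  measurable_fun setT h -> (forall w, 0 <= h w) ->
  \int[mrestr mu mD]_w h w = \int[mu]_(w in D) h w.
Proof.
move=> mh h0.
rewrite (@ge0_negligible_integral _ _ _ (mrestr mu mD) setT (~` D) h)//.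
- rewrite setTD setCK; apply: eq_measure_integral => A mA AD.
  by have := congr1 mu (setIidl AD); (exact: id || exact: esym).
- exact: measurableC.
- by transitivity (mu (~` D `&` D)) => //; rewrite setICl measure0.
Qed.

End restricted_integral.

Section independence.
Context (R : realType) d (T : measurableType d) (P : probability T R).
Variables (N : nat) (Phi : 'I_N -> R.-ker T ~> R).
Hypothesis indPhi : independent_pps P Phi.
Hypothesis cPhi : forall j w, counting_conf (Phi j w).
Variable i : 'I_N.

(** Rectangle events that leave the i-th process unconstrained. They form a pi-system generating the
    history of the other processes, as the uniqueness argument for independence requires. *)
Definition other_events : set (set T) :=
  [set D | exists B : 'I_N -> set T, [/\ forall j, pp_sigma_algebra (Phi j) (B j),
     B i = setT & D = \bigcap_(j in [set: 'I_N]) B j]].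

Local Notation T' := (g_sigma_algebraType other_events).
Local Notation Ti := (g_sigma_algebraType (counting_events (Phi i))).

Let other_eventsI : setI_closed other_events.
Proof.
move=> _ _ [B [mB Bi ->]] [C [mC Ci ->]]; exists (fun j => B j `&` C j); split.
- by move=> j; exact: pp_sigma_algebraI.
- by rewrite Bi Ci setIT.
- by rewrite bigcapI.
Qed.

Let other_eventsT : other_events setT.
Proof.
exists (fun=> setT); split => //; first by move=> j; exact: pp_sigma_algebraT.
by rewrite bigcapT.
Qed.

Lemma pp_other_events j A : j != i -> pp_sigma_algebra (Phi j) A -> other_events A.
Proof.
move=> ji mA; exists (fun k => if k == j then A else setT); split.
- by move=> k; case: eqP => [->//|_]; exact: pp_sigma_algebraT.
- by rewrite eq_sym (negbTE ji).
- apply/seteqP; split => w; first by move=> Aw k _; case: eqP.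
  by move=> /(_ j I); rewrite eqxx.
Qed.

Lemma other_events_measurable (D : set T) : @measurable _ T' D -> @measurable _ T D.
Proof.
apply: smallest_sub => //; first exact: sigma_algebra_measurable.
move=> _ [B [mB _ ->]]; apply: fin_bigcap_measurable => //.
  by move=> j _; exact: pp_sigma_algebra_measurable (mB j).
Qed.

Let mid' : measurable_fun setT (id : T -> T').
Proof. by move=> _ Y mY; rewrite setTI; exact: other_events_measurable. Qed.

Let midi : measurable_fun setT (id : T -> Ti).
Proof. by move=> _ Y mY; rewrite setTI; exact: pp_sigma_algebra_measurable mY. Qed.

Let gen_indep D A : other_events D -> pp_sigma_algebra (Phi i) A ->
  P (D `&` A) = P D * P A.
Proof.
move=> [B [mB Bi DE]] mA.
pose s := [seq j <- enum 'I_N | j != i].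
have us : uniq s by rewrite filter_uniq// enum_uniq.
have is_ : i \notin s by rewrite mem_filter eqxx.
have sE j : j != i -> j \in s by rewrite mem_filter mem_enum andbT.
(* Independence is used for [s] alone and for [i :: s] with [A] placed at index i; the common
   product over [s] is [P D]. *)
pose B' j := if j == i then A else B j.
have := indPhi (s := i :: s) (A := B').
have := indPhi (s := s) (A := B).
move=> /(_ us (fun j _ => mB j)) PB.
rewrite /= is_ us => /(_ erefl) PB'.
have {}PB' := PB' _.
have DB : \bigcap_(j in [set` s]) B j = D.
  rewrite DE; apply/seteqP; split => w h j; last by move=> _; exact: h.
  by have [->|ji] := eqVneq j i; [rewrite Bi|move=> _; apply: h; exact: sE].
have DAB : \bigcap_(j in [set` i :: s]) B' j = D `&` A.
  rewrite -DB; apply/seteqP; split => w.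
    move=> h; split; last by have := h i; rewrite /B' eqxx; apply; rewrite /= mem_head.
    move=> j js; have := h j; rewrite /B'; case: eqP => [ji|_].
      by move: is_ js; rewrite -ji /= => /negP.
    by apply; rewrite /= in_cons js orbT.
  move=> [h Aw] j; rewrite /= in_cons /B'; case: eqP => //= _; exact: h.
rewrite -DAB PB'; last first.
  by move=> j _; rewrite /B'; case: eqP => [->|].
rewrite big_cons {1}/B' eqxx muleC; congr (_ * _).
rewrite -DB PB; apply: eq_big_seq => j js; rewrite /B'.
by case: eqP => // ji; move: js; rewrite ji (negbTE is_).
Qed.

Lemma other_events_indep (D A : set T) : @measurable _ T' D -> pp_sigma_algebra (Phi i) A ->
  P (D `&` A) = P D * P A.
Proof.
move=> mD mA.
have mA' : measurable A := pp_sigma_algebra_measurable mA.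
have PA0 : (0 <= fine (P A))%R by rewrite fine_ge0.
pose m1 := image_measure (mrestr P mA') mid'.
pose m2 : {measure set T' -> \bar R} := mscale (NngNum PA0) (image_measure P mid').
have m2E X : m2 X = P A * P X by rewrite -[P A]fineK ?fin_num_measure.
suff : m1 D = m2 D by rewrite m2E muleC.
apply: (@measure_unique _ R T' other_events (fun=> setT) erefl other_eventsI _ _ m1 m2) => //.
- by apply/seteqP; split => // w _; exists 0%N.
- by move=> X GX; rewrite m2E muleC -gen_indep.
- move=> _; apply: (@le_lt_trans _ _ 1); last exact: ltry.
  by apply: probability_le1; rewrite setTI.
Qed.

Lemma other_events_integral (D : set T) (h : T -> \bar R) : @measurable _ T' D ->
  measurable_fun setT (h : Ti -> \bar R) -> (forall w, 0 <= h w) ->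
  \int[P]_(w in D) h w = P D * \int[P]_w h w.
Proof.
move=> mD mh h0.
have mD' : measurable D := other_events_measurable mD.
have PD0 : (0 <= fine (P D))%R by rewrite fine_ge0.
pose m2 : {measure set Ti -> \bar R} := mscale (NngNum PD0) (image_measure P midi).
have mhT : measurable_fun setT h.
  by move=> _ Y mY; have := mh measurableT Y mY; exact: pp_sigma_algebra_measurable.
transitivity (\int[image_measure (mrestr P mD') midi]_w h w).
  have := @ge0_integral_pushforward _ _ _ _ R _ midi (mrestr P mD') setT h measurableT mh (fun y
    _ => h0 y).
  rewrite preimage_setT => E; apply: esym; apply: etrans E _.
  exact: (ge0_integral_mrestr P mD' mhT h0).
transitivity (\int[m2]_w h w).
  apply: eq_measure_integral => A mA _.
  rewrite -[LHS]/(P (A `&` D)) -[RHS]/((fine (P D))%:E * P A) fineK ?fin_num_measure//.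
  by rewrite setIC other_events_indep.
rewrite (@ge0_integral_mscale _ _ R (image_measure P midi) setT measurableT (NngNum PD0) h)//.
have -> : ((NngNum PD0)%:num)%:E = P D by rewrite /= fineK ?fin_num_measure.
congr (_ * _).
exact: (@ge0_integral_pushforward _ _ _ _ R _ midi P setT h measurableT mh (fun y _ => h0 y)).
Qed.

Variable lam : R.
Hypothesis intPhi : intensity P (fun w => Phi i w) = lam%:E.

Local Notation J := (campbell_measure P (cPhi i)).

Let msnd : measurable_fun [set: T * R] (snd : T * R -> R).
Proof. exact: measurable_snd. Qed.

Let swap (z : T * R) : R * T' := (z.2, z.1).

Let mswap : measurable_fun setT swap.
Proof.
apply/measurable_fun_pair => //.
by apply: (measurableT_comp mid'); exact: measurable_fst.
Qed.

Let JT : J setT = lam%:E.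
Proof. by rewrite -intPhi; exact: campbell_setT. Qed.

Let fin_s : fin_num_fun (image_measure J msnd).
Proof.
by apply: lty_fin_num_fun; rewrite image_measureE preimage_setT JT ltry.
Qed.

Let fin_P : fin_num_fun (image_measure P mid').
Proof.
apply: lty_fin_num_fun; apply: (@le_lt_trans _ _ 1); last exact: ltry.
exact: (@probability_le1 _ _ _ P setT measurableT).
Qed.

(** The number of points of [Phi i] in I depends on [Phi i] alone, hence is independent of D: the
    time of a request and the other histories factorise. *)
Let campbell_rectangle (I : set R) (D : set T') : measurable I -> measurable D ->
  J [set z | I z.2 /\ D z.1] = image_measure J msnd I * image_measure P mid' D.
Proof.
move=> mI mD; rewrite !image_measureE muleC.
pose h w := Phi i w (I `&` `]0%R, 1%R]%classic).
have mI1 : measurable (I `&` `]0%R, 1%R]%classic) by exact: measurableI.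
have mh : measurable_fun setT (h : Ti -> \bar R).
  move=> _ U mU; rewrite setTI; apply: sub_sigma_algebra.
  by exists (I `&` `]0%R, 1%R]%classic), U.
have h0 w : 0 <= h w by exact: measure_ge0.
have := other_events_integral mD mh h0.
rewrite -[id @^-1` D]/D => E.
transitivity (\int[P]_(w in D) h w).
  rewrite integral_mkcond; apply: eq_integral => w _; rewrite patchE /h.
  case: ifPn => [/set_mem Dw|/negP nDw].
    congr (Phi i w _); apply/seteqP; split => s [].
      by move=> /set_mem[/= Is _] s01.
    by move=> Is s01; split => //; apply/mem_set.
  rewrite (_ : _ `&` _ = set0) ?measure0// -subset0 => s [/set_mem[/= _ Dw] _].
  by apply: nDw; apply/mem_set.
rewrite E; congr (_ * _); apply: eq_integral => w _; rewrite /h.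
by congr (Phi i w (_ `&` _)); apply/seteqP; split => s; [move=> Is; apply/mem_set|move/set_mem].
Qed.

(* Under the Campbell measure of Phi_i the other processes keep their law. *)
Lemma campbell_other_le (X : set (R * T')) (delta : R) : measurable X -> (0 <= delta)%R ->
  (forall s, P (xsection X s) <= delta%:E) ->
  J [set z | X (z.2, z.1)] <= (delta * lam)%:E.
Proof.
move=> mX delta0 Xdelta.
pose ms := finite_measure_of fin_s; pose mP := finite_measure_of fin_P.
(* By agreement on rectangles, the image of [J] under [swap] is the product of its time marginal and
   [P] on the other histories; the bound then follows section by section. *)
have := @product_measure_unique _ _ _ _ R ms mP (image_measure J mswap).
move=> /(_ (fun I D mI mD => campbell_rectangle mI mD)) /(_ X mX) E.
rewrite -[leLHS]/(image_measure J mswap X) -E.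
apply: (@le_trans _ _ (\int[ms]_s delta%:E)).
  by apply: le_integral_nonmeas => s _; [exact: (measure_ge0 P (xsection X s))|exact: Xdelta].
rewrite integral_cst// EFinM; apply: lee_wpmul2l; rewrite ?lee_fin//.
by rewrite -JT.
Qed.

End independence.

(** * Chebyshev's inequality and the count of hot items *)

Section chebyshev_sum.
Context d (T : measurableType d) (R : realType) (P : probability T R).
Variables (n : nat) (B : 'I_n -> set T) (p : 'I_n -> R).
Hypothesis mB : forall j, measurable (B j).
Hypothesis PB : forall j, P (B j) = (p j)%:E.
Hypothesis indB : forall j k, j != k -> P (B j `&` B k) = P (B j) * P (B k).

Let S w : R := (\sum_j \1_(B j) w)%R.
Let m : R := (\sum_j p j)%R.

Let p0 j : (0 <= p j)%R. Proof. by rewrite -lee_fin -PB measure_ge0. Qed.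
Let p1 j : (p j <= 1)%R. Proof. by rewrite -lee_fin -PB probability_le1. Qed.

Let mS : measurable_fun setT S.
Proof. by apply: measurable_sum => j; exact: measurable_indic. Qed.

Let m0 : (0 <= m)%R. Proof. by apply: sumr_ge0. Qed.

Let S0 w : (0 <= S w)%R. Proof. by apply: sumr_ge0. Qed.

Let intS : \int[P]_w (S w)%:E = m%:E.
Proof.
under eq_integral do rewrite /S -sumEFin.
rewrite ge0_integral_sum//; last first.
  by move=> j; apply/measurable_EFinP; exact: measurable_indic.
rewrite /m -sumEFin; apply: eq_bigr => j _.
by rewrite integral_indic// setIT; exact: PB.
Qed.

Let intS2 : \int[P]_w (S w ^+ 2)%:E <= (m ^+ 2 + n%:R)%:E.
Proof.
have -> : \int[P]_w (S w ^+ 2)%:E = \sum_(j < n) \sum_(k < n) P (B j `&` B k).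
  transitivity (\int[P]_w \sum_(j < n) \sum_(k < n) (\1_(B j `&` B k) w)%:E).
    apply: eq_integral => w _; rewrite /S expr2 mulr_suml -sumEFin; apply: eq_bigr => j _.
    rewrite mulr_sumr -sumEFin; apply: eq_bigr => k _.
    by rewrite indicI.
  rewrite ge0_integral_sum//; last first.
  - by move=> j w _; apply: sume_ge0 => k _; rewrite lee_fin.
  - move=> j; apply: emeasurable_sum => k; apply/measurable_EFinP.
    by apply: measurable_indic; exact: measurableI.
  apply: eq_bigr => j _; rewrite ge0_integral_sum//; last first.
    by move=> k; apply/measurable_EFinP; apply: measurable_indic; exact: measurableI.
  by apply: eq_bigr => k _; rewrite integral_indic ?setIT//; exact: measurableI.
(* Each of the n diagonal terms exceeds [p j * p j] by at most 1. This crude bound gives a variance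
   at most n, uniformly in [p]. *)
have PBB j k : P (B j `&` B k) <= (p j * p k + (j == k)%:R)%:E.
  have [<-|jk] := eqVneq j k.
    by rewrite setIid PB lee_fin ler_wpDl// ?mulr_ge0.
  by rewrite addr0 indB// !PB.
apply: (@le_trans _ _ (\sum_(j < n) \sum_(k < n) (p j * p k + (j == k)%:R)%:E)).
  by apply: lee_sum => j _; apply: lee_sum => k _; exact: PBB.
under eq_bigr do rewrite sumEFin.
rewrite sumEFin lee_fin.
under eq_bigr do rewrite big_split/=.
rewrite big_split/= lerD//.
  by rewrite expr2 /m mulr_suml; under eq_bigr do rewrite -mulr_sumr.
under eq_bigr => j _.
  rewrite (bigD1 j)//= eqxx big1 ?addr0; last by move=> k kj; rewrite eq_sym (negbTE kj).
  over.
by rewrite sumr_const card_ord.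
Qed.

Let var : \int[P]_w ((S w - m) ^+ 2)%:E <= n%:R%:E.
Proof.
have md : measurable_fun setT (fun w => (S w - m) ^+ 2)%R.
  by apply: measurable_funX; apply: measurable_funB => //; exact: measurable_cst.
(* The expansion of the variance is written without subtraction, so that every integrand is
   nonnegative. *)
have E : \int[P]_w ((S w - m) ^+ 2)%:E + (2 * m * m)%:E =
     \int[P]_w (S w ^+ 2)%:E + (m ^+ 2)%:E.
  have i1 : \int[P]_w (2 * m * S w)%:E = (2 * m * m)%:E.
    under eq_integral do rewrite EFinM.
    rewrite ge0_integralZl_EFin ?mulr_ge0//; last 2 first.
    - by move=> w _; rewrite lee_fin.
    - exact/measurable_EFinP.
    by rewrite intS.
  have i2 : \int[P]_w (m ^+ 2)%:E = (m ^+ 2)%:E.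
    rewrite integral_cst//; transitivity ((m ^+ 2)%:E * P setT) => //; by rewrite probability_setT mule1.
  rewrite -i1 -i2 -!ge0_integralD//.
  all: try by apply/measurable_EFinP; do ?apply: measurable_funM => //; exact: measurable_cst.
  all: try by move=> w _; rewrite lee_fin ?sqr_ge0// !mulr_ge0.
  all: try exact/measurable_EFinP.
  by apply: eq_integral => w _; rewrite -!EFinD; congr EFin; ring.
have := intS2; rewrite -(leeD2rE _ _ (_ : (m ^+ 2)%:E \is a fin_num))// -E -EFinD.
rewrite (_ : (m ^+ 2 + n%:R + m ^+ 2 = n%:R + 2 * m * m)%R); last by ring.
by rewrite EFinD leeD2rE.
Qed.

Lemma chebyshev_sum e : (0 < e)%R ->
  P [set w | (e <= `|\sum_j \1_(B j) w - \sum_j p j|)%R] <= (n%:R / e ^+ 2)%:E.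
Proof.
move=> e0.
have e20 : (0 < e ^+ 2)%R by rewrite exprn_gt0.
set A := [set w | _].
have mA : measurable A.
  apply: measurable_le_set; first exact: measurable_cst.
  by apply: measurableT_comp => //; apply: measurable_funB => //; exact: measurable_cst.
suff : (e ^+ 2)%:E * P A <= n%:R%:E.
  by rewrite muleC -lee_pdivlMr// => /le_trans; apply; rewrite EFinM.
apply: le_trans var.
rewrite -(setIT A) -integral_indic// -ge0_integralZl_EFin//; last 2 first.
- by apply/measurable_EFinP; exact: measurable_indic.
- exact: ltW.
apply: le_integral_nonmeas => w _; first by rewrite mule_ge0 ?lee_fin// ltW.
rewrite -EFinM lee_fin indicE; case: (boolP (w \in A)) => [/set_mem Aw|_]; last first.
  by rewrite mulr0 sqr_ge0.
by rewrite mulr1 -[leRHS]real_normK ?num_real// lerXn2r// ?nnegrE// ltW.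
Qed.

End chebyshev_sum.

(** The source is left general because the rate is needed as a function on [T * R], on the history
    of one process, and on times paired with the other histories. *)
Lemma measurable_observed_rate (R : realType) d (T : measurableType d) (Phi : R.-ker T ~> R)
    (eta : R -> R) (l : R) dS (S : measurableType dS) (W : S -> T) (Y : S -> R) :
  (forall w, counting_conf (Phi w)) -> measurable_fun setT eta ->
  (forall B, measurable B -> measurable_fun setT (fun z => Phi (W z) B)) ->
  measurable_fun setT Y ->
  measurable_fun setT (fun z => observed_rate eta l Phi (Y z) (W z)).
Proof.
move=> cPhi meta mW mY; rewrite /observed_rate.
apply: measurable_funM; first exact: measurable_cst.
apply: (measurableT_comp meta).
apply: measurable_funM; first exact: measurable_cst.
apply: measurable_funB => //.
exact: (measurable_last_point (kappa := fun z => Phi (W z)) mW (fun z => cPhi (W z)) mY).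
Qed.

Section competitors.
Context (R : realType) d (T : measurableType d) (P : probability T R).
Variables (N : nat) (Phi : 'I_N -> R.-ker T ~> R).
Hypothesis indPhi : independent_pps P Phi.
Hypothesis cPhi : forall j w, counting_conf (Phi j w).
Variables (eta : R -> R) (lam : 'I_N -> R).
Hypothesis meta : measurable_fun setT eta.
Hypothesis intPhi : forall i, intensity P (fun w => Phi i w) = (lam i)%:E.
Variables (x : R) (p : 'I_N -> R).
Hypothesis rate_law : forall j s,
  P [set w | (x < observed_rate eta (lam j) (Phi j) s w)%R] = (p j)%:E.

Local Notation rate j s w := (observed_rate eta (lam j) (Phi j) s w).

(** Item i is excluded so that the count depends on the other processes only and keeps its law under
    the Campbell measure of [Phi i]. *)
Definition competitors (i : 'I_N) (s : R) (w : T) : nat :=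
  #|[pred j : 'I_N | (j != i) && (x < rate j s w)%R]|.

Variable i : 'I_N.

Local Notation T' := (g_sigma_algebraType (other_events Phi i)).

(** Index i receives the empty event with probability 0, so that [chebyshev_sum] applies over all of
    ['I_N] without reindexing. *)
Let B s j : set T := if j == i then set0 else [set w | (x < rate j s w)%R].

Let p' j : R := if j == i then 0%R else p j.

Let p0 j : (0 <= p j)%R.
Proof. by rewrite -lee_fin -(rate_law j 0%R) measure_ge0. Qed.

Let p1 j : (p j <= 1)%R.
Proof.
rewrite -lee_fin -(rate_law j 0%R); apply: probability_le1.
apply: measurable_lt_set; first exact: measurable_cst.
apply: (@measurable_observed_rate _ _ _ (Phi j) eta (lam j) _ T id (cst 0%R)) => //.
exact: measurable_kernel.
Qed.

Let competitorsE s w : (competitors i s w)%:R = (\sum_j \1_(B s j) w)%R :> R.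
Proof.
rewrite /competitors -sum1_card natr_sum big_mkcond/=; apply: eq_bigr => j _.
rewrite inE /B; have [->|ji] := eqVneq j i; first by rewrite indic0.
rewrite /= indicE; case: ifPn => [h|/negP h]; first by rewrite mem_set.
by rewrite memNset.
Qed.

Let pp_B s j : pp_sigma_algebra (Phi j) (B s j).
Proof.
rewrite /B; case: eqP => _; first exact: (@measurable0 _ (g_sigma_algebraType (counting_events (Phi j)))).
rewrite pp_sigma_algebraE.
apply: (@measurable_lt_set _ (g_sigma_algebraType (counting_events (Phi j))) R (cst x)).
  exact: measurable_cst.
apply: (@measurable_observed_rate _ _ _ (Phi j) eta (lam j) _
  (g_sigma_algebraType (counting_events (Phi j))) id (cst s)) => //.
move=> C mC _ U mU; rewrite setTI; apply: sub_sigma_algebra.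
by exists C, U.
Qed.

Let mB s j : measurable (B s j).
Proof. exact: pp_sigma_algebra_measurable (@pp_B s j). Qed.

Let PB s j : P (B s j) = (p' j)%:E.
Proof. by rewrite /B /p'; case: eqP => _; [rewrite measure0|exact: rate_law]. Qed.

Let indB s j k : j != k -> P (B s j `&` B s k) = P (B s j) * P (B s k).
Proof.
move=> jk; have := indPhi (s := [:: j; k]) (A := B s).
rewrite /= inE jk /= => /(_ erefl (fun l _ => @pp_B s l)).
rewrite big_cons big_seq1 => <-; congr (P _); apply/seteqP; split => w.
  by move=> [Bj Bk] l; rewrite /= !inE => /orP[/eqP->|/eqP->].
by move=> h; split; apply: h; rewrite /= !inE eqxx ?orbT.
Qed.

Let A' j : set (R * T') := if j == i then set0 else [set z | (x < rate j z.1 z.2)%R].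

Let mA' j : measurable (A' j).
Proof.
rewrite /A'; have [_|ji] := eqVneq j i; first exact: measurable0.
apply: measurable_lt_set; first exact: measurable_cst.
apply: (@measurable_observed_rate _ _ _ (Phi j) eta (lam j) _ (R * T')%type snd fst) => //.
  move=> C mC.
  have mPhi : measurable_fun setT (fun w : T' => Phi j w C).
    move=> _ U mU; rewrite setTI; apply: sub_sigma_algebra.
    apply: (pp_other_events ji); apply: sub_sigma_algebra.
    by exists C, U.
  exact: (measurableT_comp mPhi measurable_snd).
Qed.

Let S z : R := (\sum_j \1_(A' j) z)%R.

Let SE z : S z = (competitors i z.1 z.2)%:R.
Proof.
rewrite competitorsE; apply: eq_bigr => j _; rewrite /A' /B; case: eqP => _.
  by rewrite !indic0.
by [].
Qed.

Let mS : measurable_fun setT S.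
Proof. by apply: measurable_sum => j; exact: measurable_indic. Qed.

Let cheb s e : (0 < e)%R ->
  P [set w | (e <= `|(competitors i s w)%:R - \sum_j p' j|)%R] <= (N%:R / e ^+ 2)%:E.
Proof.
move=> e0; rewrite [X in P X](_ : _ =
    [set w | (e <= `|\sum_j \1_(B s j) w - \sum_j p' j|)%R]).
  exact: (chebyshev_sum (mB s) (PB s) (fun j k => @indB s j k) e0).
by apply/seteqP; split => w; rewrite /= competitorsE.
Qed.

Let mdev s e : measurable [set w | (e <= `|(competitors i s w)%:R - \sum_j p' j|)%R].
Proof.
rewrite (_ : [set w | _] = [set w | (e <= `|\sum_j \1_(B s j) w - \sum_j p' j|)%R]).
  apply: measurable_le_set; first exact: measurable_cst.
  apply: measurableT_comp => //; apply: measurable_funB => //.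
  by apply: measurable_sum => j; exact: measurable_indic.
by apply/seteqP; split => w; rewrite /= competitorsE.
Qed.

Let sump'_le : (\sum_j p' j <= \sum_j p j)%R.
Proof. by apply: ler_sum => j _; rewrite /p'; case: ifP. Qed.

(** Leaving out item i costs [p i], at most 1; hence the [- 1] in [few_competitors]. *)
Let sump'_ge : (\sum_j p j - 1 <= \sum_j p' j)%R.
Proof.
rewrite lerBlDr (bigD1 i)//= [X in (_ <= X + 1)%R](bigD1 i)//= {1}/p' eqxx add0r.
rewrite addrC lerD//; apply: ler_sum => j ji.
by rewrite /p' (negbTE ji).
Qed.

Local Notation J := (campbell_measure P (cPhi i)).

Let deviation_le (X : set (R * T')) (e : R) : (0 < e)%R -> measurable X ->
  (forall s w, X (s, w) -> (e <= `|(competitors i s w)%:R - \sum_j p' j|)%R) ->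
  J [set z | X (z.2, z.1)] <= (N%:R / e ^+ 2 * lam i)%:E.
Proof.
move=> e0 mX Xdev; apply: (campbell_other_le indPhi) => //.
  by rewrite divr_ge0// exprn_ge0// ltW.
move=> s; apply: le_trans (cheb s e0); apply: le_measure; rewrite ?inE//.
- apply: other_events_measurable; exact: measurable_xsection.
- by move=> w /set_mem; exact: Xdev.
Qed.

Lemma many_competitors (c : nat) (e : R) : (0 < e)%R -> (\sum_j p j + e <= c%:R)%R ->
  J [set z | (c <= competitors i z.2 z.1)%N] <= (N%:R / e ^+ 2 * lam i)%:E.
Proof.
move=> e0 pc; pose X : set (R * T') := [set z | (c <= competitors i z.1 z.2)%N].
apply: (@deviation_le X e e0) => [|s w /= h].
  rewrite (_ : X = [set z | (c%:R <= S z)%R]).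
    by apply: measurable_le_set => //; exact: measurable_cst.
  by apply/seteqP; split => z; rewrite /X /= SE ler_nat.
apply: le_trans (ler_norm _); rewrite lerBrDl.
apply: (@le_trans _ _ c%:R); last by rewrite ler_nat.
by apply: le_trans pc; rewrite lerD2r.
Qed.

Lemma few_competitors (c : nat) (e : R) : (0 < e)%R -> (c%:R + e <= \sum_j p j - 1)%R ->
  J [set z | (competitors i z.2 z.1 < c)%N] <= (N%:R / e ^+ 2 * lam i)%:E.
Proof.
move=> e0 pc; pose X : set (R * T') := [set z | (competitors i z.1 z.2 < c)%N].
apply: (@deviation_le X e e0) => [|s w /= h].
  rewrite (_ : X = [set z | (S z < c%:R)%R]).
    by apply: measurable_lt_set => //; exact: measurable_cst.
  by apply/seteqP; split => z; rewrite /X /= SE ltr_nat.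
rewrite distrC; apply: le_trans (ler_norm _); rewrite lerBrDl.
apply: le_trans sump'_ge; apply: le_trans pc; rewrite lerD2r ler_nat; exact: ltnW.
Qed.

Lemma measurable_many_competitors (c : nat) :
  measurable [set z : T * R | (c <= competitors i z.2 z.1)%N].
Proof.
rewrite (_ : [set z | _] = [set z : T * R | (c%:R <= \sum_j
    \1_(if j == i then set0 else [set z : T * R | (x < rate j z.2 z.1)%R]) z :> R)%R]).
  apply: measurable_le_set; first exact: measurable_cst.
  apply: measurable_sum => j; apply: measurable_indic; case: ifP => _ //.
  apply: measurable_lt_set; first exact: measurable_cst.
  apply: (@measurable_observed_rate _ _ _ (Phi j) eta (lam j) _ (T * R)%type fst snd) => //.
    by apply: mker_comp; exact: measurable_fst.
have E (z : T * R) : (\sum_j \1_(if j == i then set0 else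
    [set z : T * R | (x < rate j z.2 z.1)%R]) z = (competitors i z.2 z.1)%:R :> R)%R.
  by rewrite competitorsE; apply: eq_bigr => j _; rewrite /B; case: ifP => _; rewrite ?indic0.
by apply/seteqP; split => z /=; rewrite E ler_nat.
Qed.

End competitors.

(** * The miss rate of a finite system *)

Section miss_bounds.
Context (R : realType) d (T : measurableType d) (P : probability T R) (theta : R -> T -> T).
Hypothesis Hflow : measure_preserving_flow P theta.
Variable F0 : probability R R.
Hypothesis F0_supp : F0 `]-oo, 0%R[%classic = 0.
Hypothesis F0_set1 : forall x, F0 [set x] = 0.
Hypothesis F0_mean : \int[F0]_t t%:E = 1.
Variables (N : nat) (lam : 'I_N -> R) (Phi : 'I_N -> R.-ker T ~> R).
Hypothesis lam0 : forall i, (0 < lam i)%R.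
Hypothesis Hren : forall i, stationary_renewal P theta (Phi i).
Hypothesis intPhi : forall i, intensity P (fun w => Phi i w) = (lam i)%:E.
Hypothesis interPhi : forall i, has_interarrival_dist P theta (Phi i) F0 (lam i).
Hypothesis indPhi : independent_pps P Phi.
Variables (eta : R -> R) (C : nat) (sel : ('I_N -> R) -> {set 'I_N}).
Hypothesis meta : measurable_fun setT eta.
Hypothesis Hsel : largest_selection C sel.
Variable x : R.

Let cPhi i w : counting_conf (Phi i w).
Proof. by have [] := Hren i => /(_ w). Qed.

Local Notation J i := (campbell_measure P (cPhi i)).
Local Notation rate j s w := (observed_rate eta (lam j) (Phi j) s w).
Local Notation comp i s w := (competitors Phi eta lam x i s w).
Local Notation policy := (optimal_policy eta lam Phi sel).
Local Notation D := (`]0%R, 1%R]%classic : set R).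

(** If a selected item is not hot, every hot item must be selected as well, since an unselected one
    has no larger rate. The hot items then lie among the C - 1 other selected ones. *)
Lemma selected_few i s w : i \in policy s w -> ~~ (x < rate i s w)%R -> (comp i s w < C)%N.
Proof.
rewrite /optimal_policy; set r := (fun i : 'I_N => _) => isel; rewrite -leNgt => rx.
have [<- selP] := Hsel r; rewrite /competitors.
have : [pred j : 'I_N | (j != i) && (x < rate j s w)%R] \subset sel r :\ i.
  apply/fintype.subsetP => j; rewrite !inE => /andP[-> xj] /=.
  apply: contraT => nj; have := selP i j isel nj.
  by rewrite leNgt (le_lt_trans rx xj).
by move=> /subset_leq_card; rewrite (cardsD1 i (sel r)) isel add1n ltnS.
Qed.

(** If a hot item is left out, all C selected items have at least its rate, hence are hot
    competitors. *)
Lemma few_selected i s w : (x < rate i s w)%R -> (comp i s w < C)%N -> i \in policy s w.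
Proof.
rewrite /optimal_policy; set r := (fun i : 'I_N => _) => xi.
have [<- selP] := Hsel r; rewrite /competitors; apply: contraTT => ni.
rewrite -leqNgt; apply: subset_leq_card; apply/fintype.subsetP => j jsel.
rewrite inE; apply/andP; split; first by apply: contraNneq ni => <-.
by apply: lt_le_trans xi _; exact: selP j i jsel ni.
Qed.

Let mrate i : measurable [set z : T * R | (x < rate i z.2 z.1)%R].
Proof.
apply: measurable_lt_set; first exact: measurable_cst.
apply: (@measurable_observed_rate _ _ _ (Phi i) eta (lam i) _ (T * R)%type fst snd) => //.
by apply: mker_comp; exact: measurable_fst.
Qed.

Let mmany i : measurable [set z : T * R | (C <= comp i z.2 z.1)%N].
Proof. exact: measurable_many_competitors. Qed.

Let mfew i : measurable [set z : T * R | (comp i z.2 z.1 < C)%N].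
Proof.
rewrite (_ : [set z | _] = ~` [set z : T * R | (C <= comp i z.2 z.1)%N]); first exact: measurableC.
by apply/seteqP; split => z /=; rewrite ltnNge => /negP.
Qed.

Let hit := intensity P (hit_process Phi policy).

Let sumJ (U : 'I_N -> set (T * R)) : (forall i, measurable (U i)) ->
  \int[P]_w \sum_(i < N) Phi i w (xsection (U i) w `&` D) = \sum_(i < N) J i (U i).
Proof.
move=> mU; rewrite ge0_integral_sum//.
by move=> i; exact: measurable_campbell_section.
Qed.

(** With [hit_ge], the only access to the hit rate: the stored set need not be measurable, so it is
    enclosed between measurable sets of pairs. *)
Let hit_le (U : 'I_N -> set (T * R)) : (forall i, measurable (U i)) ->
  (forall i s w, i \in policy s w -> U i (w, s)) -> hit <= \sum_(i < N) J i (U i).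
Proof.
move=> mU hU; rewrite -sumJ//; apply: le_integral_nonmeas => w _.
  by apply: sume_ge0 => i _; apply: integral_ge0 => s _; rewrite lee_fin.
apply: lee_sum => i _; rewrite -integral_indic//; last exact: measurable_xsection.
apply: le_integral_nonmeas => s _; rewrite lee_fin// !indicE.
case: (boolP (s \in [set s | _])) => [/set_mem/= h|_]; last by rewrite ler0n.
by rewrite mem_set//; apply/mem_set; exact: hU.
Qed.

Let hit_ge (U : 'I_N -> set (T * R)) : (forall i, measurable (U i)) ->
  (forall i s w, U i (w, s) -> i \in policy s w) -> \sum_(i < N) J i (U i) <= hit.
Proof.
move=> mU hU; rewrite -sumJ//; apply: le_integral_nonmeas => w _.
  by apply: sume_ge0 => i _; exact: measure_ge0.
apply: lee_sum => i _; rewrite -integral_indic//; last exact: measurable_xsection.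
apply: le_integral_nonmeas => s _; rewrite lee_fin// !indicE.
case: (boolP (s \in xsection _ _)) => [/set_mem/set_mem/= h|_]; last by rewrite ler0n.
by rewrite mem_set//; exact: hU.
Qed.

Let p j : R := fine (age_measure F0 [set v | (x < lam j * eta v)%R]).

Let age_fin A : measurable A -> age_measure F0 A \is a fin_num.
Proof.
move=> mA; rewrite ge0_fin_numE//; apply: (@le_lt_trans _ _ (age_measure F0 setT)).
  by apply: le_measure; rewrite ?inE.
by rewrite age_measureT// ltry.
Qed.

Let mhaz l : measurable [set v | (x < l * eta v)%R].
Proof.
apply: measurable_lt_set; first exact: measurable_cst.
by apply: measurable_funM => //; exact: measurable_cst.
Qed.

Let rate_law j s : P [set w | (x < rate j s w)%R] = (p j)%:E.
Proof.
have [_ st si _ _] := Hren j; rewrite /p fineK; last exact: age_fin.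
exact: (stationary_rate_law Hflow (cPhi j) si st F0_supp F0_set1 F0_mean (lam0 j) (intPhi j)
  (interPhi j)).
Qed.

Let b j : R := fine (F0 [set v | (lam j * eta v <= x)%R]).

Let mhaz' l : measurable [set v | (l * eta v <= x)%R].
Proof.
apply: measurable_le_set; last exact: measurable_cst.
by apply: measurable_funM => //; exact: measurable_cst.
Qed.

Let campbell_law j : J j [set z | (x < rate j z.2 z.1)%R] = (lam j * (1 - b j))%:E.
Proof.
have [_ st si _ _] := Hren j; rewrite EFinM.
have -> : (1 - b j)%:E = F0 [set v | (x < lam j * eta v)%R].
  rewrite (_ : [set v | _] = ~` [set v | (lam j * eta v <= x)%R]).
    by rewrite probability_setC// EFinB /b fineK// fin_num_measure.
  by apply/seteqP; split => v /=; rewrite ltNge => /negP.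
exact: (campbell_rate_law (cPhi j) si st F0_supp F0_set1 (lam0 j) (intPhi j) (interPhi j) meta).
Qed.

Let Lam : R := (\sum_j lam j)%R.

(** A hot request with fewer than C competitors is a hit by [few_selected]; the other hot requests
    have at least C competitors and are rare by Chebyshev's inequality with deviation [e]. *)
Lemma miss_rate_le (e : R) : (0 < e)%R -> (\sum_j p j + e <= C%:R)%R ->
  miss_rate P lam Phi policy <= (\sum_j lam j * b j + N%:R / e ^+ 2 * Lam)%:E.
Proof.
move=> e0 pe.
have h1 : (\sum_j lam j * (1 - b j))%:E <= hit + (N%:R / e ^+ 2 * Lam)%:E.
  rewrite -sumEFin; apply: (@le_trans _ _ (\sum_(i < N)
     (J i ([set z | (x < rate i z.2 z.1)%R] `&` [set z | (comp i z.2 z.1 < C)%N]) +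
      J i [set z | (C <= comp i z.2 z.1)%N]))).
    apply: lee_sum => i _; rewrite -campbell_law.
    set A1 := [set z | (x < _)%R]; set A2 := [set z | (_ < C)%N]; set A3 := [set z | (C <= _)%N].
    apply: (@le_trans _ _ (J i ((A1 `&` A2) `|` A3))); last first.
      exact: measureU2 (measurableI _ _ (mrate i) (mfew i)) (mmany i).
    apply: le_measure; rewrite ?inE//; first exact: mrate.
      by apply: measurableU; [exact: measurableI (mrate i) (mfew i)|exact: mmany].
    by move=> z /= h; case: (leqP C (comp i z.2 z.1)) => h'; [right|left].
  rewrite big_split/=; apply: leeD.
    apply: hit_ge => [i|i s w []/= h1 h2]; first exact: measurableI.
    exact: few_selected.
  rewrite /Lam mulr_sumr -sumEFin; apply: lee_sum => i _.
  exact: (many_competitors indPhi cPhi meta intPhi rate_law i e0 pe).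
(* Moving [hit] across the inequality requires it to be finite; it is bounded by the sum of the
   intensities. *)
rewrite /miss_rate -/hit leeBlDr//; last first.
  rewrite ge0_fin_numE; last first.
    by apply: integral_ge0 => w _; apply: sume_ge0 => i _; apply: integral_ge0 => s _; rewrite lee_fin.
  apply: (@le_lt_trans _ _ (\sum_(i < N) J i setT)); first by apply: hit_le => //.
  apply: (@le_lt_trans _ _ (\sum_(i < N) (lam i)%:E)); last by rewrite sumEFin ltry.
  by apply: lee_sum => i _; rewrite -intPhi; rewrite -(campbell_setT P (cPhi i)).
apply: (@le_trans _ _ ((\sum_j lam j * (1 - b j))%:E + (\sum_j lam j * b j)%:E)).
  rewrite -EFinD -big_split/= lee_fin; apply: ler_sum => j _.
  by rewrite -mulrDr subrK mulr1.
rewrite EFinD -addeA [leRHS]addeC; apply: leeD => //.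
by rewrite addeC.
Qed.

(** A hit that is not hot has fewer than C competitors by [selected_few], which is rare when the
    expected number of hot items exceeds C by the margin [e] and the one item left out. *)
Lemma miss_rate_ge (e : R) : (0 < e)%R -> (C%:R + e <= \sum_j p j - 1)%R ->
  (\sum_j lam j * b j - N%:R / e ^+ 2 * Lam)%:E <= miss_rate P lam Phi policy.
Proof.
move=> e0 pe.
have h1 : hit <= (\sum_j lam j * (1 - b j))%:E + (N%:R / e ^+ 2 * Lam)%:E.
  rewrite -sumEFin; apply: (@le_trans _ _ (\sum_(i < N)
     J i ([set z | (x < rate i z.2 z.1)%R] `|` [set z | (comp i z.2 z.1 < C)%N]))).
    apply: hit_le => [i|i s w h]; first exact: measurableU.
    have [xr|nxr] := boolP (x < rate i s w)%R; [by left|right].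
    exact: selected_few h nxr.
  apply: (@le_trans _ _ (\sum_(i < N) (J i [set z | (x < rate i z.2 z.1)%R] +
      J i [set z | (comp i z.2 z.1 < C)%N]))).
    by apply: lee_sum => i _; exact: measureU2.
  rewrite big_split/=; apply: leeD.
    by apply: lee_sum => i _; have /eqP := campbell_law i; rewrite eq_le => /andP[].
  rewrite /Lam mulr_sumr -sumEFin; apply: lee_sum => i _.
  exact: (few_competitors indPhi cPhi meta intPhi rate_law i e0 pe).
rewrite /miss_rate -/hit.
apply: (@le_trans _ _ (Lam%:E - ((\sum_j lam j * (1 - b j))%:E + (N%:R / e ^+ 2 * Lam)%:E))); last first.
  exact: leeB.
rewrite -[leRHS]/((Lam - (\sum_j lam j * (1 - b j) + N%:R / e ^+ 2 * Lam))%:E) lee_fin opprD addrA lerD2r.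
rewrite /Lam -sumrB; apply: ler_sum => j _.
by rewrite mulrBr mulr1 opprB addrC subrK.
Qed.

(** Serves as the lower bound when the limiting threshold is 0 and cannot be lowered. *)
Lemma miss_rate_ge0 : 0 <= miss_rate P lam Phi policy.
Proof.
rewrite /miss_rate -/hit sube_ge0; last by rewrite orbT.
apply: (@le_trans _ _ (\sum_(i < N) J i setT)); first by apply: hit_le => //.
by rewrite -sumEFin; apply: lee_sum => i _; rewrite -intPhi -(campbell_setT P (cPhi i)).
Qed.

End miss_bounds.

(** * Convergence of weighted averages *)

Section cdf_atoms.
Context {R : realType} (m : {measure set R -> \bar R}).
Hypothesis fm : fin_num_fun m.

Let g (y : R) : R := fine (m `]-oo, y]%classic).

Let gE y : (g y)%:E = m `]-oo, y]%classic.
Proof. by rewrite /g fineK// fm. Qed.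

Lemma cdf_nd : {homo g : x y / (x <= y)%R}.
Proof.
move=> x y xy; rewrite -lee_fin !gE; apply: le_measure; rewrite ?inE//.
by move=> z /=; rewrite !in_itv/= => /le_trans; exact.
Qed.

Let left_cvg y : m `]-oo, (y - n.+1%:R^-1)%R]%classic @[n --> \oo] --> m `]-oo, y[%classic.
Proof.
have -> : m `]-oo, y[%classic = m (\bigcup_n `]-oo, (y - n.+1%:R^-1)%R]%classic).
  congr (m _); apply/seteqP; split => z /=.
    rewrite in_itv/= => /ltr_add_invr[n yn]; exists n => //=.
    by rewrite in_itv/= lerBrDr ltW.
  move=> [n _]; rewrite /= !in_itv/= => /le_lt_trans; apply.
  by rewrite ltrBlDr ltrDl invr_gt0.
apply: nondecreasing_cvg_mu => //; first exact: bigcup_measurable.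
move=> i j ij; apply/subsetPset => z /=; rewrite !in_itv/= => /le_trans; apply.
by rewrite lerD2l lerN2 lef_pV2 ?posrE// ler_nat.
Qed.

Let right_cvg y : m `]-oo, (y + n.+1%:R^-1)%R]%classic @[n --> \oo] --> m `]-oo, y]%classic.
Proof.
have -> : m `]-oo, y]%classic = m (\bigcap_n `]-oo, (y + n.+1%:R^-1)%R]%classic).
  congr (m _); apply/seteqP; split => z /=.
    by rewrite in_itv/= => zy n _ /=; rewrite in_itv/= (le_trans zy)// lerDl invr_ge0.
  move=> h; rewrite in_itv/=; apply/ler_addgt0Pr => e e0.
  have [n] := ltr_add_invr e0; rewrite add0r => ne.
  have := h n I; rewrite /= in_itv/= => /le_trans; apply.
  by rewrite lerD2l ltW.
apply: nonincreasing_cvg_mu => //.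
- by rewrite -ge0_fin_numE// fm.
- exact: bigcap_measurable.
move=> i j ij; apply/subsetPset => z /=; rewrite !in_itv/= => /le_trans; apply.
by rewrite lerD2l lef_pV2 ?posrE// ler_nat.
Qed.

(** Together with [continuous_set1_0], this translates continuity points of distribution functions,
    in which the hypotheses are phrased, into non-atoms. *)
Lemma set1_0_continuous y : m [set y] = 0 -> {for y, continuous g}.
Proof.
move=> my.
have yy : m `]-oo, y[%classic = m `]-oo, y]%classic.
  rewrite [in RHS](_ : `]-oo, y]%classic = `]-oo, y[%classic `|` [set y]) ?measureU0//.
  apply/seteqP; split => z /=; rewrite !in_itv/= le_eqVlt.
    by move=> /predU1P[->|]; [right|left].
  by move=> [->|->]; rewrite ?eqxx ?orbT.
have gl : g (y - n.+1%:R^-1)%R @[n --> \oo] --> g y.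
  by apply: fine_cvg; rewrite gE -yy; exact: (@left_cvg y).
have gr : g (y + n.+1%:R^-1)%R @[n --> \oo] --> g y.
  by apply: fine_cvg; rewrite gE; exact: (@right_cvg y).
apply/cvgrPdist_le => e e0.
have /cvgrPdist_le/(_ e e0)[n1 _ hn1] := gl.
have /cvgrPdist_le/(_ e e0)[n2 _ hn2] := gr.
pose n := maxn n1 n2.
have h1 := hn1 n (leq_maxl _ _); have h2 := hn2 n (leq_maxr _ _).
near=> t.
have : (`|y - t| < n.+1%:R^-1)%R by near: t; exact: cvgr_dist_lt.
rewrite ltr_distlC => /andP[yt ty].
move: h1 h2; rewrite /= !ler_distlC => /andP[h1 _] /andP[_ h2].
apply/andP; split.
  apply: le_trans h1 _; apply: cdf_nd; exact: ltW.
by apply: le_trans h2; apply: cdf_nd; exact: ltW.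
Unshelve. all: by end_near. Qed.

Lemma continuous_set1_0 y : {for y, continuous g} -> m [set y] = 0.
Proof.
move=> gy.
have gl : g (y - n.+1%:R^-1)%R @[n --> \oo] --> g y.
  have c : (y - n.+1%:R^-1)%R @[n --> \oo] --> (y - 0)%R.
    by apply: cvgB; [exact: cvg_cst|exact: cvg_harmonic].
  by rewrite subr0 in c; exact: (cvg_comp _ _ c gy).
have h : m `]-oo, (y - n.+1%:R^-1)%R]%classic @[n --> \oo] --> m `]-oo, y]%classic.
  rewrite -gE; under eq_fun do rewrite -gE; apply: cvg_comp gl _.
  exact: cvg_id.
have yy : m `]-oo, y[%classic = m `]-oo, y]%classic := cvg_unique (@ereal_hausdorff R) (@left_cvg y) h.
have : m `]-oo, y]%classic = m `]-oo, y[%classic + m [set y].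
  rewrite -measureU//.
    congr (m _); apply/seteqP; split => z /=; rewrite !in_itv/= le_eqVlt.
      by move=> /predU1P[->|]; [right|left].
    by move=> [->|->]; rewrite ?eqxx ?orbT.
  by rewrite -subset0 => z [/= + zy]; rewrite zy in_itv/= ltxx.
rewrite -yy -[LHS]adde0 => /eqP.
have fy : m `]-oo, y[%classic \is a fin_num by exact: fm.
by rewrite -(fineK fy) -(fineK (fm (measurable_set1 y))) -!EFinD eqe => /eqP/addrI <-.
Qed.

End cdf_atoms.

(** * Measurability and zeros of the hazard rate *)

Section hazard_null.
Context {R : realType} (F0 : probability R R) (f0 : R -> R).
Hypothesis F0_supp : F0 `]-oo, 0%R[%classic = 0.
Hypothesis F0_density : has_density F0 f0.

Lemma density_set1 y : F0 [set y] = 0.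
Proof.
have [mf f0_ge0 F0E] := F0_density; rewrite F0E// integral_set1//.
Qed.

Lemma measurable_hazard : measurable_fun setT (hazard F0 f0).
Proof.
have [mf _ _] := F0_density; apply: measurable_funM => //.
(* On nonnegative reals the inverse is the power -1, whose measurability is available. *)
rewrite (_ : (fun t => _) = (@powR R ^~ (-1))%R \o (fun t => 1 - dist_fun F0 t)%R).
  apply: measurableT_comp; first exact: measurable_powR.
  by apply: measurable_funB => //; exact: measurable_dist_fun.
by apply/funext => t /=; rewrite powR_inv1// subr_ge0 dist_fun_le1.
Qed.

Lemma hazard_ge0 t : (0 <= hazard F0 f0 t)%R.
Proof.
have [_ f0_ge0 _] := F0_density.
by rewrite /hazard divr_ge0// subr_ge0 dist_fun_le1.
Qed.

Let U := [set t | dist_fun F0 t = 1%R].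

(** [U] lies in the closed ray from its infimum s. [F0] gives no mass to ]a, +oo[ for a > s, and
    none to s itself. *)
Let U_null : exists2 V, measurable V /\ F0 V = 0 & U `<=` V.
Proof.
have [U0|nU] := pselect (U !=set0); last first.
  exists set0; first by rewrite measure0.
  by move=> t Ut; apply: nU; exists t.
have lU : has_lbound U.
  exists 0%R => t Ut; rewrite leNgt; apply/negP => t0.
  have : (dist_fun F0 t)%:E <= F0 `]-oo, 0%R[%classic.
    rewrite dist_funE; apply: le_measure; rewrite ?inE//.
    by move=> z /=; rewrite !in_itv/= => /le_lt_trans; exact.
  by rewrite Ut F0_supp lee_fin ler10.
pose s := inf U.
exists (`]s, +oo[%classic `|` [set s]); last first.
  move=> t Ut; have : (s <= t)%R by exact: ge_inf.
  by rewrite le_eqVlt => /predU1P[->|st]; [right|left; rewrite /= in_itv/= st].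
split; first exact: measurableU.
rewrite measureU0//; last exact: density_set1.
have gt0 (a : R) : (s < a)%R -> F0 `]a, +oo[%classic = 0.
  move=> sa; have [|t Ut tsa] := @inf_adherent R U (a - s)%R _ (conj U0 lU); first by rewrite subr_gt0.
  rewrite addrC subrK in tsa.
  rewrite ccdfE; congr EFin; apply/eqP; rewrite subr_eq0 eq_sym eq_le dist_fun_le1/= -Ut.
  by apply: dist_fun_nd; exact: ltW.
rewrite (_ : `]s, +oo[%classic = \bigcup_n `](s + n.+1%:R^-1)%R, +oo[%classic).
  apply/eqP; rewrite eq_le measure_ge0 andbT.
  apply: (@le_trans _ _ (\sum_(0 <= n <oo) F0 `](s + n.+1%:R^-1)%R, +oo[%classic)).
    by apply: measure_sigma_subadditive => //; exact: bigcup_measurable.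
  by rewrite eseries0// => n _ _; apply: gt0; rewrite ltrDl invr_gt0.
apply/seteqP; split => x /=; rewrite in_itv/= andbT.
  by move=> /ltr_add_invr[n ?]; exists n => //=; rewrite in_itv/= andbT.
move=> [n _]; rewrite /= in_itv/= andbT; apply: lt_trans.
by rewrite ltrDl invr_gt0.
Qed.

(** The hazard vanishes only where [f0] does or, by the default value of division, on [U]. This
    discards the level eta = 0, at which averages with weight l would be full means. *)
Lemma hazard_eq0_null : F0 [set t | hazard F0 f0 t = 0%R] = 0.
Proof.
have [mf f0_ge0 F0E] := F0_density.
have [V [mV V0] UV] := U_null.
have mz : measurable [set t | f0 t = 0%R].
  by rewrite -[X in measurable X]setTI; exact: (mf measurableT [set 0%R]).
have z0 : F0 [set t | f0 t = 0%R] = 0.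
  by rewrite F0E//; apply: integral0_eq => t /= ->.
have mh : measurable [set t | hazard F0 f0 t = 0%R].
  by rewrite -[X in measurable X]setTI; exact: (measurable_hazard measurableT (measurable_set1 0%R)).
apply: (@subset_measure0 _ _ _ F0 _ ([set t | f0 t = 0%R] `|` V)) => //.
- exact: measurableU.
- move=> t /= /eqP; rewrite /hazard mulf_eq0 => /orP[/eqP|]; first by left.
  by rewrite invr_eq0 subr_eq0 => /eqP h; right; apply: UV.
- by transitivity (F0 [set t | f0 t = 0%R]) => //; exact: measureU0.
Qed.

End hazard_null.

Section atoms.
Context {R : realType} (L : probability R R).

Lemma countable_atoms (X : R -> R) : measurable_fun setT X ->
  countable [set r | 0 < L [set t | X t = r]].
Proof.
move=> mX; pose X' : {RV L >-> R} := HB.pack X (isMeasurableFun.Build _ _ _ _ X mX).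
have fX r : L [set t | X t = r] \is a fin_num.
  by apply: fin_num_measure; have := mX measurableT _ (measurable_set1 r); rewrite setTI; exact.
have := pmf_gt0_countable X'; congr countable; apply/seteqP; split => r /=.
  by rewrite /pmf -lte_fin fineK//; exact: fX.
by rewrite /pmf -lte_fin fineK//; exact: fX.
Qed.

Lemma countable_atoms_id : countable [set r | 0 < L [set r]].
Proof. exact: (countable_atoms (@measurable_id _ R setT)). Qed.

Lemma exists_nonatom (a b : R) : (a < b)%R -> exists c, [/\ (a < c)%R, (c < b)%R & L [set c] = 0].
Proof.
move=> ab; apply: contrapT => h.
have sub : `]a, b[%classic `<=` [set r | 0 < L [set r]].
  move=> c /=; rewrite in_itv/= => /andP[ac cb]; rewrite lt0e measure_ge0 andbT.
  by apply/eqP => Lc; apply: h; exists c.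
have := countable_lebesgue_measure0 (sub_countable (subset_card_le sub) countable_atoms_id).
by rewrite lebesgue_measure_itv/= lte_fin ab -EFinB => -[] /eqP; rewrite subr_eq0 gt_eqF.
Qed.

End atoms.

Section cvg_minmax.
Context {R : realType}.

Lemma cvg_max_cst (u : R^nat) (a : R) (w : \bar R) : w \is a fin_num ->
  u n @[n --> \oo] --> a -> a%:E <= w -> maxe (u n)%:E w @[n --> \oo] --> w.
Proof.
case: w => [w| |]// _ ua; rewrite lee_fin => aw; under eq_fun do rewrite -EFin_max;
  apply: cvg_EFin; first exact: nearW.
apply/cvgrPdist_le => e e0; near=> n.
have : (`|a - u n| <= e)%R by near: n; move/cvgrPdist_le : ua; exact.
rewrite /= !ler_distlC => /andP[h1 h2]; rewrite le_max ge_max; apply/andP; split; lra.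
Unshelve. all: by end_near. Qed.

Lemma cvg_min_cst (u : R^nat) (a : R) (w : \bar R) : w \is a fin_num ->
  u n @[n --> \oo] --> a -> w <= a%:E -> mine (u n)%:E w @[n --> \oo] --> w.
Proof.
case: w => [w| |]// _ ua; rewrite lee_fin => aw; under eq_fun do rewrite -EFin_min;
  apply: cvg_EFin; first exact: nearW.
apply/cvgrPdist_le => e e0; near=> n.
have : (`|a - u n| <= e)%R by near: n; move/cvgrPdist_le : ua; exact.
rewrite /= !ler_distlC => /andP[h1 h2]; rewrite le_min ge_min; apply/andP; split; lra.
Unshelve. all: by end_near. Qed.

End cvg_minmax.

(** * Averages over the items against integrals over the limit law *)

Section weighted_averages.
Context {R : realType} (L : probability R R).
Variable lam : forall N : nat, 'I_N -> R.
Hypothesis lam0 : forall N (i : 'I_N), (0 < lam i)%R.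
Variable omega : R -> R.
Hypothesis momega : measurable_fun setT omega.
Hypothesis omega0 : forall l, (0 < l)%R -> (0 <= omega l)%R.

(** The inner integral over the rates when the hazard has the fixed value h; [wavg] is its empirical
    counterpart. The factor on 0 < l confines the integral to the rates where [omega] is known to be
    nonnegative. *)
Definition wcdf (x h : R) : \bar R :=
  \int[L]_l (omega l * ((0 < l)%R && (l * h <= x)%R)%:R)%:E.

Definition wtot : \bar R := \int[L]_l (omega l * (0 < l)%R%:R)%:E.

Definition wavg (N : nat) (x h : R) : R :=
  (N%:R^-1 * \sum_(i < N) omega (lam i) * (lam i * h <= x)%R%:R)%R.

Variable bnd : R.
Hypothesis avg_bnd : forall N, (0 < N)%N -> (N%:R^-1 * \sum_(i < N) omega (lam i) <= bnd)%R.
Hypothesis tot_bnd : wtot <= bnd%:E.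
Hypothesis avg_cvg : forall c, L [set c] = 0 ->
  (wavg N c 1)%:E @[N --> \oo] --> wcdf c 1.

Let term0 l b : (0 <= omega l * ((0 < l)%R && b)%:R)%R.
Proof. by case: ltP => l0/=; rewrite ?mulr0// mulr_ge0// omega0. Qed.

Let mterm x h : measurable_fun setT (fun l => (omega l * ((0 < l)%R && (l * h <= x)%R)%:R)%:E).
Proof.
apply/measurable_EFinP; apply: measurable_funM => //.
rewrite (_ : (fun l => _) = \1_([set l | (0 < l)%R] `&` [set l | (l * h <= x)%R])).
  apply: measurable_indic; apply: measurableI.
    by apply: measurable_lt_set => //; exact: measurable_cst.
  apply: measurable_le_set; last exact: measurable_cst.
  by apply: measurable_funM => //; exact: measurable_cst.
apply/funext => l; rewrite indicE; case: (boolP (_ && _)) => h'.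
  by rewrite mem_set//; move/andP: h'.
by rewrite memNset// => -[/= h1 h2]; move: h'; rewrite h1 h2.
Qed.

Let mtot : measurable_fun setT (fun l => (omega l * (0 < l)%R%:R)%:E).
Proof.
have := mterm 0%R 0%R; congr measurable_fun; apply/funext => l.
by rewrite mulr0 lexx andbT.
Qed.

Lemma wcdf_ge0 x h : 0 <= wcdf x h.
Proof. by apply: integral_ge0 => l _; rewrite lee_fin. Qed.

Lemma wcdf_le_tot x h : wcdf x h <= wtot.
Proof.
apply: le_integral_nonmeas => l _; rewrite lee_fin//.
by case: ltP => l0/=; rewrite ?mulr0// ler_wpM2l ?omega0// ler_nat leq_b1.
Qed.

Lemma wcdf_fin x h : wcdf x h \is a fin_num.
Proof.
rewrite ge0_fin_numE ?wcdf_ge0//; apply: le_lt_trans (wcdf_le_tot _ _) _.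
by apply: le_lt_trans tot_bnd _; rewrite ltry.
Qed.

Lemma le_wcdf x h x' h' :
  (forall l, (0 < l)%R -> (l * h <= x)%R -> (l * h' <= x')%R) -> wcdf x h <= wcdf x' h'.
Proof.
move=> hh; apply: le_integral_nonmeas => l _; rewrite lee_fin//.
case: (ltP 0%R l) => l0/=; rewrite ?mulr0//.
apply: ler_wpM2l; first exact: omega0.
by case: (boolP (l * h <= x)%R) => [/(hh _ l0) ->//|_]; rewrite ler0n.
Qed.

Let avg0 N x h : (0 <= wavg N x h)%R.
Proof.
by rewrite mulr_ge0 ?invr_ge0// sumr_ge0// => i _; rewrite mulr_ge0 ?omega0.
Qed.

Let avg_le_bnd N x h : (0 <= bnd)%R -> (wavg N x h <= bnd)%R.
Proof.
move=> b0; case: N => [|N]; first by rewrite /wavg big_ord0 mulr0.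
apply: le_trans (avg_bnd (ltn0Sn N)); apply: ler_wpM2l; first by rewrite invr_ge0.
apply: ler_sum => i _; rewrite ler_piMr ?omega0// lern1 leq_b1//.
Qed.

Let bnd0 : (0 <= bnd)%R.
Proof. by rewrite -lee_fin; apply: le_trans tot_bnd; apply: integral_ge0 => l _;
  have := term0 l true; rewrite andbT lee_fin. Qed.

Let le_avg N x h x' h' :
  (forall l, (0 < l)%R -> (l * h <= x)%R -> (l * h' <= x')%R) -> (wavg N x h <= wavg N x' h')%R.
Proof.
move=> hh; apply: ler_wpM2l; first by rewrite invr_ge0.
apply: ler_sum => i _; apply: ler_wpM2l; first exact: omega0.
by case: (boolP (_ <= x)%R) => [/(hh _ (lam0 i)) ->//|_]; rewrite ler0n.
Qed.

(** For h > 0 the condition l h <= x truncates l at x / h, and [avg_cvg] suffices. At h = 0 nothing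
    is truncated, so convergence of the full averages must be known. *)
Definition good (h : R) := (0 < h)%R \/ h = 0%R /\
  (N%:R^-1 * \sum_(i < N) omega (lam i))%:E%R @[N --> \oo] --> wtot.

(* A nonatomic point between x / h and x' / h separates the two levels. *)
Let separate x x' h : (x < x')%R -> good h ->
  exists a : R^nat, exists a' : R, [/\ a n @[n --> \oo] --> a',
   forall N, (wavg N x h <= a N)%R, forall N, (a N <= wavg N x' h)%R,
   wcdf x h <= a'%:E & a'%:E <= wcdf x' h].
Proof.
move=> xx' [h0|[-> totcvg]].
  have [c [xc cx' Lc]] : exists c, [/\ (x / h < c)%R, (c < x' / h)%R & L [set c] = 0].
    by apply: exists_nonatom; rewrite ltr_pM2r ?invr_gt0.
  exists (fun N => wavg N c 1), (fine (wcdf c 1)); split.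
  - by have := avg_cvg Lc; rewrite -(fineK (wcdf_fin c 1)) => /fine_cvg.
  - move=> N; apply: le_avg => l l0; rewrite mulr1 -ler_pdivlMr// => /le_trans; apply; exact: ltW.
  - move=> N; apply: le_avg => l l0; rewrite mulr1 -ler_pdivlMr// => /le_trans; apply; exact: ltW.
  - rewrite fineK ?wcdf_fin//; apply: le_wcdf => l l0; rewrite mulr1 -ler_pdivlMr// => /le_trans;
    apply; exact: ltW.
  - rewrite fineK ?wcdf_fin//; apply: le_wcdf => l l0; rewrite mulr1 -ler_pdivlMr// => /le_trans;
    apply; exact: ltW.
have [x0|x0] := ltP x 0%R.
  exists (fun=> 0%R), 0%R; split => //; first exact: cvg_cst.
  - move=> N; rewrite /wavg big1 ?mulr0// => i _; by rewrite mulr0 leNgt x0 mulr0.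
  - rewrite /wcdf integral0_eq// => l _; by rewrite mulr0 leNgt x0 andbF mulr0.
  - exact: wcdf_ge0.
have x'0 : (0 <= x')%R by rewrite (le_trans x0)// ltW.
have avgE y N : (0 <= y)%R -> (wavg N y 0 = N%:R^-1 * \sum_(i < N) omega (lam i))%R.
  by move=> y0; rewrite /wavg; congr *%R; apply: eq_bigr => i _; rewrite mulr0 y0 mulr1.
have cdfE y : (0 <= y)%R -> wcdf y 0 = wtot.
  by move=> y0; apply: eq_integral => l _; rewrite mulr0 y0 andbT.
have tf : wtot \is a fin_num by rewrite -(cdfE _ x0) wcdf_fin.
exists (fun N => N%:R^-1 * \sum_(i < N) omega (lam i))%R, (fine wtot); split.
- by move: totcvg; rewrite -(fineK tf) => /fine_cvg.
- by move=> N; rewrite avgE.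
- by move=> N; rewrite avgE.
- by rewrite fineK// cdfE.
- by rewrite fineK// cdfE.
Qed.

Variable nu : {finite_measure set R -> \bar R}.
Variable eta : R -> R.
Hypothesis meta : measurable_fun setT eta.
Hypothesis eta_good : {ae nu, forall v, good (eta v)}.

Definition limit_level (x : R) : \bar R :=
  \int[L]_(l in `]0%R, +oo[) ((omega l)%:E * nu [set v | (l * eta v <= x)%R]).

Definition avg_level (N : nat) (x : R) : R :=
  (N%:R^-1 * \sum_(i < N) omega (lam i) * fine (nu [set v | (lam i * eta v <= x)%R]))%R.

Let mlevel l x : measurable [set v | (l * eta v <= x)%R].
Proof.
apply: measurable_le_set; last exact: measurable_cst.
by apply: measurable_funM => //; exact: measurable_cst.
Qed.

Let F x (z : R * R) : \bar R := (omega z.2 * ((0 < z.2)%R && (z.2 * eta z.1 <= x)%R)%:R)%:E.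

Let mF x : measurable_fun setT (F x).
Proof.
apply/measurable_EFinP; apply: measurable_funM.
  by apply: measurableT_comp => //; exact: measurable_snd.
have me : measurable_fun setT (fun z : R * R => eta z.1).
  by apply: measurableT_comp => //; exact: measurable_fst.
rewrite (_ : (fun z => _) = \1_([set z : R * R | (0 < z.2)%R] `&` [set z | (z.2 * eta z.1 <= x)%R])).
  apply: measurable_indic; apply: measurableI.
    by apply: measurable_lt_set => //; exact: measurable_cst.
  apply: measurable_le_set; last exact: measurable_cst.
  exact: measurable_funM.
apply/funext => z; rewrite indicE; case: (boolP (_ && _)) => h'.
  by rewrite mem_set//; move/andP: h'.
by rewrite memNset// => -[/= h1 h2]; move: h'; rewrite h1 h2.
Qed.

Let F0 x z : 0 <= F x z. Proof. by rewrite lee_fin. Qed.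

Let mwcdf x : measurable_fun setT (fun v => wcdf x (eta v)).
Proof. have h := @measurable_fun_fubini_tonelli_F _ _ _ _ R L (F x) (mF x) (F0 x); exact: h. Qed.

Let tonelli x : \int[nu]_v wcdf x (eta v) = limit_level x.
Proof.
transitivity (\int[L]_l \int[nu]_v F x (v, l)).
  exact: (@fubini_tonelli _ _ _ _ R nu L (F x) (mF x) (F0 x)).
rewrite /limit_level [RHS]integral_mkcond.
apply: eq_integral => l _; rewrite patchE; case: ifPn => [/set_mem|/negP nl].
  rewrite /= in_itv/= andbT => l0.
  rewrite -[X in nu X]setIT -integral_indic// -ge0_integralZl_EFin ?omega0//; last first.
    by apply/measurable_EFinP; exact: measurable_indic.
  apply: eq_integral => v _; rewrite /F /= l0 EFinM /=; congr (_ * (_)%:E).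
  rewrite indicE; case: (boolP (l * eta v <= x)%R) => h; first by rewrite mem_set.
  by rewrite memNset//; exact/negP.
rewrite integral0_eq// => v _; rewrite /F/=.
case: ltP => l0/=; last by rewrite mulr0.
by exfalso; apply: nl; apply/mem_set; rewrite /= in_itv/= l0.
Qed.

Let integral_avg N x : \int[nu]_v (wavg N x (eta v))%:E = (avg_level N x)%:E.
Proof.
rewrite /avg_level.
under eq_integral do rewrite /wavg EFinM.
have mI (i : 'I_N) : measurable_fun setT (fun v => (omega (lam i) * (lam i * eta v <= x)%R%:R)%:E).
  apply/measurable_EFinP; apply: measurable_funM; first exact: measurable_cst.
  rewrite (_ : (fun v => _) = \1_[set v | (lam i * eta v <= x)%R]); first exact: measurable_indic.
  apply/funext => v; rewrite indicE; case: (boolP (_ <= x)%R) => h; first by rewrite mem_set.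
  by rewrite memNset//; exact/negP.
have I0 (i : 'I_N) v : 0 <= (omega (lam i) * (lam i * eta v <= x)%R%:R)%:E.
  by rewrite lee_fin mulr_ge0 ?omega0.
rewrite ge0_integralZl_EFin ?invr_ge0//; last 2 first.
- by move=> v _; rewrite lee_fin sumr_ge0// => i _; rewrite -lee_fin I0.
- by under eq_fun do rewrite -sumEFin; apply: emeasurable_sum.
rewrite EFinM; congr (_ * _).
under eq_integral do rewrite -sumEFin.
rewrite ge0_integral_sum// -sumEFin; apply: eq_bigr => i _.
rewrite EFinM fineK; last by apply: fin_num_measure; exact: mlevel.
rewrite -[X in nu X]setIT -integral_indic// -ge0_integralZl_EFin ?omega0//; last first.
  by apply/measurable_EFinP; exact: measurable_indic.
apply: eq_integral => v _; rewrite EFinM; congr (_ * (_)%:E).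
rewrite indicE; case: (boolP (_ <= x)%R) => h; first by rewrite mem_set.
by rewrite memNset//; exact/negP.
Qed.

Let mavg N x : measurable_fun setT (fun v => (wavg N x (eta v))%:E).
Proof.
rewrite /wavg; apply/measurable_EFinP; apply: measurable_funM; first exact: measurable_cst.
apply: measurable_sum => i; apply: measurable_funM; first exact: measurable_cst.
rewrite (_ : (fun v => _) = \1_[set v | (lam i * eta v <= x)%R]); first exact: measurable_indic.
apply/funext => v; rewrite indicE; case: (boolP (_ <= x)%R) => h; first by rewrite mem_set.
by rewrite memNset//; exact/negP.
Qed.

Lemma limit_level_ge0 x : 0 <= limit_level x.
Proof. by rewrite -tonelli; apply: integral_ge0 => v _; exact: wcdf_ge0. Qed.

Lemma limit_level_fin x : limit_level x \is a fin_num.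
Proof.
rewrite ge0_fin_numE ?limit_level_ge0// -tonelli.
apply: (@le_lt_trans _ _ (\int[nu]_v bnd%:E)).
  apply: le_integral_nonmeas => v _; first exact: wcdf_ge0.
  exact: le_trans (wcdf_le_tot _ _) tot_bnd.
by rewrite integral_cst// lte_mul_pinfty// ?lee_fin// -ge0_fin_numE// fin_num_measure.
Qed.

Let wcdf_bnd x h : wcdf x h <= bnd%:E.
Proof. exact: le_trans (wcdf_le_tot _ _) tot_bnd. Qed.

Let int_bnd : nu.-integrable setT (cst bnd%:E).
Proof. by apply: finite_measure_integrable_cst. Qed.

Lemma measurable_level (h : R) :
  measurable_fun setT (fun l => (omega l)%:E * nu [set v | (l * eta v <= h)%R]).
Proof.
apply: emeasurable_funM; first exact/measurable_EFinP.
have me : measurable_fun setT (fun z : R * R => (z.1 * eta z.2)%R).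
  by apply: measurable_funM => //; apply: measurableT_comp.
have mA : measurable [set z : R * R | (z.1 * eta z.2 <= h)%R].
  by apply: measurable_le_set => //; exact: measurable_cst.
have := measurable_fun_xsection nu mA; congr measurable_fun; apply/funext => l /=.
by congr (nu _); apply/seteqP; split => v /=; rewrite /xsection/= inE.
Qed.

Lemma limit_level_cvg (x_ : R^nat) (h : R -> \bar R) :
  measurable_fun setT h ->
  {ae L, forall l, (0 < l)%R -> nu [set v | (l * eta v <= x_ n)%R] @[n --> \oo] --> h l} ->
  limit_level (x_ n) @[n --> \oo] --> \int[L]_(l in `]0%R, +oo[) ((omega l)%:E * h l).
Proof.
move=> mh hcvg; rewrite /limit_level.
have mD : measurable (`]0%R, +oo[%classic : set R) by [].
have [_ _] : [/\ L.-integrable `]0%R, +oo[ (fun l => (omega l)%:E * h l),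
    [sequence \int[L]_(l in `]0%R, +oo[)
      `|(omega l)%:E * nu [set v | (l * eta v <= x_ n)%R] - (omega l)%:E * h l|]_n @ \oo --> 0 &
    [sequence \int[L]_(l in `]0%R, +oo[)
      ((omega l)%:E * nu [set v | (l * eta v <= x_ n)%R])]_n @ \oo -->
    \int[L]_(l in `]0%R, +oo[) ((omega l)%:E * h l)].
  apply: (@dominated_convergence _ _ _ L _ mD _ _ (fun l => (omega l)%:E * nu setT)).
  - by move=> n; apply: measurable_funTS; exact: measurable_level.
  - by apply: measurable_funTS; apply: emeasurable_funM => //; exact/measurable_EFinP.
  - apply: filterS hcvg => l hl; rewrite /= in_itv/= andbT => /hl h1.
    by apply: cvgeZl.
  - apply/integrableP; split.
      apply: measurable_funTS; apply: emeasurable_funM; first exact/measurable_EFinP.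
      exact: measurable_cst.
    have nf : nu setT \is a fin_num by exact: fin_num_measure.
    apply: (@le_lt_trans _ _ (\int[L]_l (nu setT * (omega l * (0 < l)%R%:R)%:E))).
      rewrite integral_mkcond; apply: le_integral_nonmeas => l _.
        by rewrite patchE; case: ifP => // _; exact: abse_ge0.
      rewrite patchE; case: ifPn => [/set_mem|/negP nl].
        rewrite /= in_itv/= andbT => l0; rewrite l0 mulr1 muleC gee0_abs//.
        by rewrite mule_ge0 ?measure_ge0// lee_fin omega0.
      by rewrite mule_ge0 ?measure_ge0//; have := term0 l true; rewrite andbT lee_fin.
    rewrite -(fineK nf) ge0_integralZl_EFin//; last 2 first.
    - by move=> l _; have := term0 l true; rewrite andbT lee_fin.
    - by rewrite fine_ge0// measure_ge0.
    rewrite lte_mul_pinfty ?lee_fin ?fine_ge0 ?measure_ge0//.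
    by apply: le_lt_trans tot_bnd _; rewrite ltry.
  - apply: aeW => l n; rewrite /= in_itv/= andbT => l0.
    rewrite gee0_abs ?mule_ge0 ?measure_ge0 ?lee_fin ?omega0//.
    apply: lee_wpmul2l; first by rewrite lee_fin omega0.
    by apply: le_measure; rewrite ?inE.
by [].
Qed.

Lemma le_limit_level x x' : (x <= x')%R -> limit_level x <= limit_level x'.
Proof.
move=> xx'; apply: le_integral_nonmeas => l; rewrite /= in_itv/= andbT => l0.
  by rewrite mule_ge0 ?measure_ge0// lee_fin omega0.
apply: lee_wpmul2l; first by rewrite lee_fin omega0.
by apply: le_measure; rewrite ?inE// => v /= /le_trans; exact.
Qed.

Lemma avg_level_le x x' kappa : (x < x')%R -> (0 < kappa)%R ->
  \forall N \near \oo, ((avg_level N x)%:E <= limit_level x' + kappa%:E).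
Proof.
move=> xx' k0.
(* The average at x need not converge. By [separate] its maximum with the limit at x' does converge,
   to that limit, so dominated convergence applies to a mere asymptotic upper bound. *)
pose g N v := maxe (wavg N x (eta v))%:E (wcdf x' (eta v)).
have mg N : measurable_fun setT (g N) by exact: measurable_maxe.
have [_ _ cvg] : [/\ nu.-integrable setT (fun v => wcdf x' (eta v)),
    [sequence \int[nu]_v `|g n v - wcdf x' (eta v)|]_n @ \oo --> 0 &
    [sequence \int[nu]_v g n v]_n @ \oo --> \int[nu]_v wcdf x' (eta v)].
  apply: (dominated_convergence measurableT mg (mwcdf x') _ int_bnd).
    apply: filterS eta_good => v gv _.
    have [a [a' [acvg ha _ _ ha']]] := separate xx' gv.
    have m' : maxe (a n)%:E (wcdf x' (eta v)) @[n --> \oo] --> wcdf x' (eta v).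
      exact: cvg_max_cst (wcdf_fin _ _) acvg ha'.
    apply: (squeeze_cvge _ (cvg_cst _) m'); apply: nearW => N.
    rewrite /g le_max lexx orbT/= ge_max le_max lee_fin ha/=.
    by rewrite le_max lexx orbT.
  apply: aeW => v N _; rewrite gee0_abs; last by rewrite /g le_max lee_fin avg0.
  by rewrite /g ge_max lee_fin avg_le_bnd//= wcdf_bnd.
have : \forall N \near \oo, \int[nu]_v g N v < limit_level x' + kappa%:E.
  rewrite tonelli in cvg.
  apply: (cvg [set y | y < limit_level x' + kappa%:E]).
  apply: open_nbhs_nbhs; split; first exact: open_ereal_lt_ereal.
  by rewrite /= -[X in X < _]adde0 lteD2lE ?limit_level_fin// lte_fin.
apply: filterS => N /ltW; apply: le_trans.
rewrite -integral_avg; apply: le_integral_nonmeas => v _; first by rewrite lee_fin avg0.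
by rewrite /g le_max lexx.
Qed.

Lemma avg_level_ge x x' kappa : (x < x')%R -> (0 < kappa)%R ->
  \forall N \near \oo, (limit_level x <= (avg_level N x')%:E + kappa%:E).
Proof.
move=> xx' k0.
(* The dual device: the minimum with the limit at the smaller level converges to that limit. *)
pose g N v := mine (wavg N x' (eta v))%:E (wcdf x (eta v)).
have mg N : measurable_fun setT (g N) by exact: measurable_mine.
have [_ _ cvg] : [/\ nu.-integrable setT (fun v => wcdf x (eta v)),
    [sequence \int[nu]_v `|g n v - wcdf x (eta v)|]_n @ \oo --> 0 &
    [sequence \int[nu]_v g n v]_n @ \oo --> \int[nu]_v wcdf x (eta v)].
  apply: (dominated_convergence measurableT mg (mwcdf x) _ int_bnd).
    apply: filterS eta_good => v gv _.
    have [a [a' [acvg _ ha ha' _]]] := separate xx' gv.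
    have m' : mine (a n)%:E (wcdf x (eta v)) @[n --> \oo] --> wcdf x (eta v).
      exact: cvg_min_cst (wcdf_fin _ _) acvg ha'.
    apply: (squeeze_cvge _ m' (cvg_cst _)); apply: nearW => N.
    by rewrite /g le_min !ge_min lee_fin ha !lexx !orbT.
  apply: aeW => v N _; rewrite gee0_abs; last by rewrite /g le_min lee_fin avg0 wcdf_ge0.
  by rewrite /g ge_min wcdf_bnd orbT.
have : \forall N \near \oo, limit_level x - kappa%:E < \int[nu]_v g N v.
  rewrite tonelli in cvg.
  apply: (cvg [set y | limit_level x - kappa%:E < y]).
  apply: open_nbhs_nbhs; split; first exact: open_ereal_gt_ereal.
  by rewrite /= -[X in _ < X]adde0 lteD2lE ?limit_level_fin// lte_fin oppr_lt0.
apply: filterS => N /ltW; rewrite leeBlDr// => /le_trans; apply; rewrite leeD2r//.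
rewrite -integral_avg; apply: le_integral_nonmeas => v _.
  by rewrite /g le_min lee_fin avg0 wcdf_ge0.
by rewrite /g ge_min lexx.
Qed.

End weighted_averages.

(** * Averages and truncated means of the intensities *)

Section rates.
Context {R : realType} (L : probability R R).
Hypothesis L_supp : L `]-oo, 0%R[%classic = 0.
Hypothesis L_atom : L [set 0%R] = 0.
Variable lam : forall N : nat, 'I_N -> R.
Hypothesis lam0 : forall N (i : 'I_N), (0 < lam i)%R.
Hypothesis L_weak : cvg_weakly (fun N => empirical_dist (@lam N)) (dist_fun L).

Lemma measure_npos : L `]-oo, 0%R]%classic = 0.
Proof.
rewrite (_ : `]-oo, 0%R]%classic = `]-oo, 0%R[%classic `|` [set 0%R]).
  by transitivity (L `]-oo, 0%R[%classic) => //; exact: measureU0.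
apply/seteqP; split => z /=; rewrite !in_itv/= [(z <= 0)%R]le_eqVlt.
  by move=> /predU1P[->|]; [right|left].
by move=> [->|->]; rewrite ?eqxx ?orbT.
Qed.

Lemma measure_pos : L `]0%R, +oo[%classic = 1.
Proof. by rewrite ccdfE /dist_fun measure_npos subr0. Qed.

Lemma empirical_cvg c : L [set c] = 0 ->
  empirical_dist (@lam N) c @[N --> \oo] --> dist_fun L c.
Proof.
move=> Lc; apply: L_weak; apply: (@set1_0_continuous _ L) => //.
Qed.

Let indE l c : ((0 < l)%R && (l <= c)%R)%:R = \1_(`]0%R, c]%classic : set R) l :> R.
Proof.
rewrite indicE; case: (boolP (_ && _)) => h; first by rewrite mem_set//= in_itv.
by rewrite memNset//= in_itv/=; exact/negP.
Qed.

Let mind c : measurable_fun setT (fun l : R => ((0 < l)%R && (l <= c)%R)%:R : R).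
Proof. by under eq_fun do rewrite indE; exact: measurable_indic. Qed.

Lemma integral_pos_le c : \int[L]_l (((0 < l)%R && (l <= c)%R)%:R)%:E = (dist_fun L c)%:E.
Proof.
under eq_integral do rewrite indE.
rewrite integral_indic// setIT dist_funE.
have [c0|c0] := leP c 0%R.
  rewrite set_itv_ge ?measure0; last by rewrite bnd_simp -leNgt.
  apply/esym/eqP; rewrite eq_le measure_ge0 andbT -measure_npos.
  apply: le_measure; rewrite ?inE//.
  by move=> z /=; rewrite !in_itv/= => /le_trans; exact.
rewrite (_ : `]-oo, c]%classic = `]0%R, c]%classic `|` `]-oo, 0%R]%classic).
  by apply/esym; apply: measureU0 => //; exact: measure_npos.
apply/seteqP; split => z /=; rewrite !in_itv/=.
  by case: (ltP 0%R z) => z0 zc; [left|right].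
by move=> [/andP[]//|z0]; rewrite (le_trans z0)// ltW.
Qed.

Lemma sum_empirical N c :
  (N%:R^-1 * \sum_(i < N) ((0 < lam i)%R && (lam i <= c)%R)%:R)%R = empirical_dist (@lam N) c.
Proof.
rewrite /empirical_dist; congr *%R; rewrite [RHS]big_mkcond/=; apply: eq_bigr => i _.
by rewrite lam0/=; case: ifP.
Qed.

Lemma unit_avg_cvg c : L [set c] = 0 ->
  (wavg (@lam) (fun=> 1%R) N c 1)%:E @[N --> \oo] --> wcdf L (fun=> 1%R) c 1.
Proof.
move=> Lc; rewrite /wcdf /wavg.
under eq_integral do rewrite mul1r mulr1.
rewrite integral_pos_le; apply: cvg_EFin; first exact: nearW.
rewrite (_ : _ \o _ = fun N => empirical_dist (@lam N) c); first exact: empirical_cvg.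
apply/funext => N /=; rewrite -sum_empirical; congr *%R; apply: eq_bigr => i _.
by rewrite lam0 mul1r mulr1.
Qed.

Local Notation leb := (@lebesgue_measure R).

(** The length of [l, c] for 0 < l <= c, as an integral in s. Integrated in l it gives the integral
    of the distribution function over [0, c]. *)
Let k (c l : R) : \bar R := \int[leb]_(s in `[0%R, c]%classic) (((0 < l)%R && (l <= s)%R)%:R)%:E.

(** The identity (c - l) + l = c on 0 < l <= c: integration by parts for a single rate. Integrating
    or averaging it yields [integral_dist_fun] and [integral_empirical]. *)
Let kE (c l : R) : (0 <= c)%R ->
  k c l + (l * ((0 < l)%R && (l <= c)%R)%:R)%:E = (c * ((0 < l)%R && (l <= c)%R)%:R)%:E.
Proof.
move=> c0; rewrite /k; case: (ltP 0%R l) => l0/=; last first.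
  by rewrite integral0_eq ?mulr0 ?adde0.
have -> : \int[leb]_(s in `[0%R, c]%classic) ((l <= s)%R%:R)%:E = leb `[l, c]%classic.
  transitivity (\int[leb]_(s in `[0%R, c]%classic) (\1_(`[l, c]%classic : set R) s)%:E).
    apply: eq_integral => s /set_mem/=; rewrite in_itv/= => /andP[s0 sc].
    by rewrite indicE/= mem_setE/= in_itv/= sc andbT.
  rewrite integral_indic//; congr (leb _); apply/seteqP; split => s /=; first by case.
  rewrite !in_itv/= => /andP[ls sc]; split; rewrite ?ls//.
  by rewrite sc (le_trans (ltW l0)).
rewrite lebesgue_measure_itv/= lte_fin.
case: (ltgtP l c) => lc; rewrite ?mulr1 ?mulr0 ?adde0// ?add0e//.
- by rewrite -EFinD subrK.
- by rewrite lc.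
Qed.

Let k0 c l : 0 <= k c l. Proof. by apply: integral_ge0 => s _; rewrite lee_fin. Qed.

Let mk2 : measurable_fun setT
  (fun z : R * R => ((0 < z.2)%R && (z.2 <= z.1)%R)%:R : R).
Proof.
have -> : (fun z : R * R => ((0 < z.2)%R && (z.2 <= z.1)%R)%:R : R) =
    \1_([set z : R * R | (0 < z.2)%R] `&` [set z : R * R | (z.2 <= z.1)%R]).
  apply/funext => z; rewrite indicE; case: (boolP (_ && _)) => h'.
    by rewrite mem_set//; move/andP: h'.
  by rewrite memNset// => -[/= h1 h2]; move: h'; rewrite h1 h2.
apply: measurable_indic; apply: measurableI.
  by apply: measurable_lt_set => //; exact: measurable_cst.
exact: measurable_le_set.
Qed.

Lemma integral_dist_fun (c : R) : (0 <= c)%R ->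
  \int[leb]_(s in `[0%R, c]%classic) (dist_fun L s)%:E + wcdf L id c 1 =
  (c * dist_fun L c)%:E.
Proof.
move=> c0.
pose f (z : R * R) : \bar R := ((z.1 \in `[0%R, c])%:R * ((0 < z.2)%R && (z.2 <= z.1)%R)%:R)%:E.
have f0 z : 0 <= f z by rewrite lee_fin mulr_ge0.
have mf : measurable_fun setT f.
  apply/measurable_EFinP; apply: measurable_funM => //.
  have -> : (fun z : R * R => (z.1 \in `[0%R, c])%:R : R) = \1_(`[0%R, c]%classic : set R) \o fst.
    by apply/funext => z /=; rewrite indicE mem_setE.
  by apply: measurableT_comp => //; exact: measurable_indic.
have kf l : \int[leb]_s f (s, l) = k c l.
  rewrite /k [RHS]integral_mkcond; apply: eq_integral => s _.
  by rewrite /f patchE mem_setE/=; case: ifP => _; rewrite ?mul1r ?mul0r.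
have mk : measurable_fun setT (k c).
  have := @measurable_fun_fubini_tonelli_G _ _ _ _ R leb f mf f0.
  by congr measurable_fun; apply/funext => l; exact: kf.
have E1 : \int[leb]_(s in `[0%R, c]%classic) (dist_fun L s)%:E = \int[L]_l k c l.
  transitivity (\int[leb]_s \int[L]_l f (s, l)).
    rewrite integral_mkcond; apply: eq_integral => s _; rewrite patchE mem_setE /f/=.
    case: ifPn => _; last by rewrite integral0_eq// => l _; rewrite mul0r.
    by rewrite -integral_pos_le; apply: eq_integral => l _; rewrite mul1r.
  transitivity (\int[L]_l \int[leb]_s f (s, l)).
    by apply: (@fubini_tonelli _ _ _ _ R leb L f mf).
  by apply: eq_integral => l _; exact: kf.
transitivity (\int[L]_l (k c l + (l * ((0 < l)%R && (l <= c)%R)%:R)%:E)).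
  rewrite ge0_integralD//.
  - by rewrite E1 /wcdf; congr (_ + _); apply: eq_integral => l _; rewrite mulr1.
  - by move=> l _; rewrite lee_fin; case: ltP => l0; rewrite ?mulr0// mulr_ge0// ltW.
  - by apply/measurable_EFinP; apply: measurable_funM.
under eq_integral do rewrite kE// EFinM.
rewrite ge0_integralZl_EFin//.
- by rewrite integral_pos_le EFinM.
- exact/measurable_EFinP.
Qed.

Lemma integral_empirical N (c : R) : (0 <= c)%R ->
  \int[leb]_(s in `[0%R, c]%classic) (empirical_dist (@lam N) s)%:E +
    (wavg (@lam) id N c 1)%:E = (c * empirical_dist (@lam N) c)%:E.
Proof.
move=> c0; have mD : measurable (`[0%R, c]%classic : set R) by [].
have ik (i : 'I_N) : measurable_fun `[0%R, c]%classic
    (fun s : R => (((0 < lam i)%R && (lam i <= s)%R)%:R : R)%:E).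
  apply: measurable_funTS; apply/measurable_EFinP.
  rewrite (_ : (fun s => _) = \1_([set s | (lam i <= s)%R])).
    by apply: measurable_indic; apply: measurable_le_set => //; exact: measurable_cst.
  apply/funext => s; rewrite indicE lam0/=; case: (boolP (_ <= _)%R) => h; first by rewrite mem_set.
  by rewrite memNset//; exact/negP.
have -> : \int[leb]_(s in `[0%R, c]%classic) (empirical_dist (@lam N) s)%:E =
    (N%:R^-1)%:E * \sum_(i < N) k c (lam i).
  have i0 (i : 'I_N) s : `[0%R, c]%classic s -> 0 <= (((0 < lam i)%R && (lam i <= s)%R)%:R : R)%:E.
    by rewrite lee_fin.
  have := ge0_integral_sum leb mD ik i0 (index_enum 'I_N); rewrite -/k => <-.
  rewrite -ge0_integralZl_EFin//.
  - by apply: eq_integral => s _; rewrite -sum_empirical EFinM sumEFin.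
  - by move=> s _; rewrite sumEFin lee_fin sumr_ge0.
  - exact: emeasurable_sum.
pose b (i : 'I_N) : R := ((0 < lam i)%R && (lam i <= c)%R)%:R.
have kfin (i : 'I_N) : k c (lam i) = (c * b i - lam i * b i)%R%:E.
  by rewrite EFinB -kE// addeK.
rewrite (eq_bigr _ (fun i _ => kfin i)) sumEFin -EFinM -EFinD; congr EFin.
rewrite sumrB -mulr_sumr -sum_empirical /wavg mulrBr.
rewrite [X in (_ - X + _)%R](_ : _ = N%:R^-1 * \sum_(i < N) lam i * (lam i * 1 <= c)%R%:R)%R.
  by rewrite subrK mulrCA.
by congr *%R; apply: eq_bigr => i _; rewrite /b lam0 mulr1.
Qed.

(** Bounded convergence: the empirical distribution functions lie in [0, 1] and converge off the
    countably many atoms of [L], a Lebesgue-null set. *)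
Let nonatom_cvg c :
  \int[leb]_(s in `[0%R, c]%classic) (empirical_dist (@lam N) s)%:E @[N --> \oo] -->
  \int[leb]_(s in `[0%R, c]%classic) (dist_fun L s)%:E.
Proof.
have mD : measurable (`[0%R, c]%classic : set R) by [].
have e01 N s : (0 <= empirical_dist (@lam N) s <= 1)%R.
  rewrite -sum_empirical mulr_ge0 ?invr_ge0 ?sumr_ge0//=.
  case: N => [|N]; first by rewrite big_ord0 mulr0.
  rewrite mulrC ler_pdivrMr// mul1r; apply: (@le_trans _ _ (\sum_(i < N.+1) 1)%R).
    by apply: ler_sum => i _; rewrite lern1 leq_b1.
  by rewrite sumr_const card_ord.
have me N : measurable_fun `[0%R, c]%classic (fun s => (empirical_dist (@lam N) s)%:E).
  apply: measurable_funTS; apply/measurable_EFinP.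
  apply: nondecreasing_measurable => // s t st; rewrite -!sum_empirical.
  apply: ler_wpM2l; first by rewrite invr_ge0.
  apply: ler_sum => i _; rewrite lam0 /= ler_nat.
  by case: (boolP (_ <= s)%R) => // /le_trans ->.
have [_ _] : [/\ leb.-integrable `[0%R, c]%classic (fun s => (dist_fun L s)%:E),
    [sequence \int[leb]_(s in `[0%R, c]%classic)
      `|(empirical_dist (@lam N) s)%:E - (dist_fun L s)%:E|]_N @ \oo --> 0 &
    [sequence \int[leb]_(s in `[0%R, c]%classic) (empirical_dist (@lam N) s)%:E]_N @ \oo -->
    \int[leb]_(s in `[0%R, c]%classic) (dist_fun L s)%:E].
  apply: (@dominated_convergence _ _ _ leb _ mD _ _ (cst 1)) => //.
  - by apply: measurable_funTS; apply/measurable_EFinP; exact: measurable_dist_fun.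
  - exists [set r | 0 < L [set r]]; split.
    + by apply: countable_measurable => //; exact: countable_atoms_id.
    + exact: (countable_lebesgue_measure0 (countable_atoms_id L)).
    move=> s /= h; rewrite lt0e measure_ge0 andbT; apply/eqP => Ls; apply: h => _.
    by apply: cvg_EFin; [exact: nearW|exact: empirical_cvg].
  - apply/integrableP; split; first exact: measurable_cst.
    rewrite (eq_integral (cst 1)); last by move=> s _; rewrite /= normr1.
    rewrite integral_cst// mul1e; apply: (@le_lt_trans _ _ (leb `[0%R, c]%classic)) => //.
    by rewrite lebesgue_measure_itv/=; case: ifP => _; rewrite ?ltry// -EFinB ltry.
  - apply: aeW => s N _; have /andP[h1 h2] := e01 N s.
    by rewrite gee0_abs lee_fin.
by [].
Qed.

(** The truncated mean equals c times the distribution function at c minus the integral of that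
    function over [0, c], both for the empirical law and for [L]; each term converges. *)
Lemma id_avg_cvg c : L [set c] = 0 ->
  (wavg (@lam) id N c 1)%:E @[N --> \oo] --> wcdf L id c 1.
Proof.
move=> Lc.
have [c0|/ltW c0] := leP c 0%R.
  have -> : wcdf L id c 1 = 0.
    apply: integral0_eq => l _; rewrite mulr1; case: ltP => l0; last by rewrite mulr0.
    by rewrite leNgt (le_lt_trans c0 l0) mulr0.
  rewrite (_ : (fun N => _) = cst 0); first exact: cvg_cst.
  apply/funext => N; rewrite /wavg big1 ?mulr0// => i _.
  by rewrite mulr1 leNgt (le_lt_trans c0)// mulr0.
have Xfin N : \int[leb]_(s in `[0%R, c]%classic) (empirical_dist (@lam N) s)%:E =
    (c * empirical_dist (@lam N) c - wavg (@lam) id N c 1)%:E.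
  by rewrite EFinB -integral_empirical// addeK.
have Ifin : \int[leb]_(s in `[0%R, c]%classic) (dist_fun L s)%:E \is a fin_num.
  have I0 : 0 <= \int[leb]_(s in `[0%R, c]%classic) (dist_fun L s)%:E.
    by apply: integral_ge0 => s _; rewrite lee_fin dist_fun_ge0.
  rewrite ge0_fin_numE//; apply: (@le_lt_trans _ _ (c * dist_fun L c)%:E); last by rewrite ltry.
  rewrite -integral_dist_fun// leeDl//; apply: integral_ge0 => l _; rewrite lee_fin.
  by case: ltP => l0; rewrite ?mulr0// mulr_ge0// ltW.
have wE : wcdf L id c 1 = (c * dist_fun L c)%:E -
    \int[leb]_(s in `[0%R, c]%classic) (dist_fun L s)%:E.
  by rewrite -integral_dist_fun// addeC addeK.
have -> : (fun N => (wavg (@lam) id N c 1)%:E) = (fun N => (c * empirical_dist (@lam N) c)%:E -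
    \int[leb]_(s in `[0%R, c]%classic) (empirical_dist (@lam N) s)%:E).
  by apply/funext => N; rewrite -integral_empirical// addeC addeK// Xfin.
rewrite wE; apply: cvgeB => //.
apply: cvg_EFin; first exact: nearW.
by apply: cvgM; [exact: cvg_cst|exact: empirical_cvg].
Qed.

Hypothesis UI : rates_uniformly_integrable (@lam).

(** Uniform integrability at level 1: rates above K contribute at most 1 to the mean, the others at
    most K. *)
Lemma mean_rate_bounded : exists bnd, forall N, (0 < N)%N ->
  (N%:R^-1 * \sum_(i < N) lam i <= bnd)%R.
Proof.
have [K [K0 hK]] := UI ltr01; exists (1 + K)%R => N N0.
apply: (@le_trans _ _ (N%:R^-1 * (\sum_(i < N | (K <= lam i)%R) lam i + \sum_(i < N) K))%R).
  apply: ler_wpM2l; first by rewrite invr_ge0.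
  rewrite [X in (_ <= X + _)%R]big_mkcond -big_split/=; apply: ler_sum => i _.
  by case: (leP K (lam i)) => h; [rewrite lerDl|rewrite add0r ltW].
rewrite mulrDr; apply: lerD; first exact: hK.
rewrite sumr_const card_ord -[(K *+ N)%R]mulr_natl mulrA mulVf ?mul1r//.
by rewrite pnatr_eq0 -lt0n.
Qed.

Variable bnd : R.
Hypothesis avg_bnd : forall N, (0 < N)%N -> (N%:R^-1 * \sum_(i < N) lam i <= bnd)%R.

(** The means truncated at non-atoms converge and stay below [bnd]; monotone convergence removes the
    truncation. Choosing [c n] in ]n, n + 1[ makes the truncations increase to infinity. *)
Lemma mean_rate_limit : wtot L id <= bnd%:E.
Proof.
have nonat n : exists c, [/\ (n%:R < c)%R, (c < n.+1%:R)%R & L [set c] = 0].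
  by apply: exists_nonatom; rewrite ltr_nat.
pose c n := sval (cid (nonat n)).
have cP n : [/\ (n%:R < c n)%R, (c n < n.+1%:R)%R & L [set c n] = 0] := svalP (cid (nonat n)).
have cle n : wcdf L id (c n) 1 <= bnd%:E.
  have [_ _ Lc] := cP n; have h := id_avg_cvg Lc.
  rewrite -(cvg_lim _ h)//; apply: lime_le; first by apply/cvg_ex; eexists; exact: h.
  near=> N; rewrite lee_fin.
  have N0 : (0 < N)%N by near: N; exists 1%N.
  apply: le_trans (avg_bnd N0); apply: ler_wpM2l; first by rewrite invr_ge0.
  by apply: ler_sum => i _; rewrite ler_piMr ?lern1 ?leq_b1// ltW.
pose g n (l : R) : \bar R := (l * ((0 < l)%R && (l <= c n)%R)%:R)%:E.
have mg n : measurable_fun setT (g n) by apply/measurable_EFinP; apply: measurable_funM.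
have g0 n l : 0 <= g n l.
  by rewrite lee_fin; case: ltP => l0; rewrite ?mulr0// mulr_ge0// ltW.
have c_nd : {homo c : m n / (m <= n)%N >-> (m <= n)%R}.
  move=> m n; rewrite leq_eqVlt => /predU1P[->//|mn].
  have [_ + _] := cP m; have [+ _ _] := cP n => h1 h2.
  by apply: ltW; apply: lt_trans h2 (le_lt_trans _ h1); rewrite ler_nat.
have gnd l : {homo g ^~ l : m n / (m <= n)%N >-> m <= n}.
  move=> m n mn; rewrite lee_fin; case: (ltP 0%R l) => l0; rewrite ?mulr0//.
  rewrite ler_wpM2l ?(ltW l0)// ler_nat/=.
  by case: (boolP (_ <= c m)%R) => // /le_trans ->//; exact: c_nd.
have h := @cvg_monotone_convergence _ _ R L _ measurableT g mg (fun n l _ => g0 n l) (fun l _ => gnd l).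
have -> : wtot L id = \int[L]_l limn (g ^~ l).
  apply: eq_integral => l _; apply/esym/cvg_lim => //.
  apply: cvg_near_cst; near=> n; rewrite /g; congr EFin; congr (_ * (_ : bool)%:R)%R.
  rewrite andb_idr// => _; apply: ltW; have [+ _ _] := cP n; apply: lt_trans.
  near: n; exact: nbhs_infty_gtr.
rewrite -(cvg_lim _ h)//; apply: lime_le; first by apply/cvg_ex; eexists; exact: h.
apply: nearW => n; apply: le_trans (cle n); rewrite /wcdf le_eqVlt; apply/orP; left.
by apply/eqP; apply: eq_integral => l _; rewrite mulr1.
Unshelve. all: by end_near. Qed.

End rates.

Lemma countable_null (R : realType) (m : {measure set R -> \bar R}) (B : set R) :
  countable B -> (forall b, B b -> m [set b] = 0) -> m B = 0.
Proof.
move=> cB B0; have /countable_injP[f fi] := cB.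
have mB : measurable B by exact: countable_measurable.
apply/(negligibleP m mB); rewrite (_ : B = \bigcup_n [set b | B b /\ f b = n]).
  apply: negligible_bigcup => n.
  have [[b [Bb fb]]|nex] := pselect (exists b, B b /\ f b = n).
    rewrite (_ : [set _ | _] = [set b]); first by apply/negligibleP => //; exact: B0.
    apply/seteqP; split => [y [By fy]|y ->//]; apply: fi; rewrite ?inE//.
    by rewrite fb.
  rewrite (_ : [set _ | _] = set0); first exact: negligible_set0.
  by rewrite -subset0 => b h; apply: nex; exists b.
by apply/seteqP; split => [b Bb|b [n _ []//]]; exists (f b).
Qed.

(** * Continuity of the limiting miss rate at the threshold *)

Section hazard_levels.
Context {R : realType} (F0 : probability R R) (eta : R -> R).
Hypothesis F0_supp : F0 `]-oo, 0%R[%classic = 0.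
Hypothesis meta : measurable_fun setT eta.
Hypothesis eta0 : forall t, (0 <= eta t)%R.

Let mlevel (l x : R) : measurable [set v | (l * eta v <= x)%R].
Proof.
apply: measurable_le_set; last exact: measurable_cst.
by apply: measurable_funM => //; exact: measurable_cst.
Qed.

Let preimageE (x : R) : hazard_preimage eta x = [set v | (1 * eta v <= x)%R] `&` `[0%R, +oo[%classic.
Proof.
apply/seteqP; split => v; rewrite /hazard_preimage /= in_itv/= andbT mul1r eta0/=.
  by move=> [].
by move=> [].
Qed.

Lemma observed_hazard_distE (x : R) :
  observed_hazard_dist F0 eta x = fine (F0 [set v | (eta v <= x)%R]).
Proof.
have -> : [set v | (eta v <= x)%R] = [set v | (1 * eta v <= x)%R].
  by apply/seteqP; split => v /=; rewrite mul1r.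
rewrite /observed_hazard_dist preimageE; congr fine.
rewrite -[in RHS](setIT [set v | _]) -(setvU `[0%R, +oo[%classic) setCitvr setIUr measureU//=;
  last 3 first.
- by apply: measurableI => //; exact: mlevel.
- by apply: measurableI => //; exact: mlevel.
- by rewrite -subset0 => v [[_ +] [_]]; rewrite /= !in_itv/= andbT => /lt_le_trans h /h; rewrite ltxx.
rewrite (_ : F0 ([set v | _] `&` `]-oo, 0%R[%classic) = 0) ?add0e//.
apply: (@subset_measure0 _ _ _ F0 _ `]-oo, 0%R[%classic) => //.
by apply: measurableI => //; exact: mlevel.
Qed.

Lemma observed_age_hazard_distE (x : R) :
  observed_hazard_dist (age_dist F0) eta x = fine (age_measure F0 [set v | (eta v <= x)%R]).
Proof.
rewrite /observed_hazard_dist age_measureE /age_dist preimageE -setIA setIid.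
by congr (fine (integral _ (_ `&` _) _)); apply/seteqP; split => v /=; rewrite mul1r.
Qed.

Hypothesis eta_null : F0 [set t | eta t = 0%R] = 0.
Variable L : probability R R.

Let mc : fin_num_fun (image_measure F0 meta).
Proof.
move=> A mA; rewrite image_measureE; apply: fin_num_measure.
by rewrite -[X in measurable X]setTI; exact: meta.
Qed.

Lemma observed_hazard_cdf :
  observed_hazard_dist F0 eta = fun y => fine (image_measure F0 meta `]-oo, y]%classic).
Proof.
by apply/funext => y; rewrite observed_hazard_distE.
Qed.

(* For th != 0 the exceptional l are among the countably many th / r with r an
   atom of eta under F0; such an l is not an atom of L, because of the
   hypothesis on th. *)
Lemma level_null (th : R) :
  ~ [set l * x | l in discontinuities (dist_fun L) &
       x in discontinuities (observed_hazard_dist F0 eta)]%R th ->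
  {ae L, forall l, (0 < l)%R -> F0 [set v | eta v = (th / l)%R] = 0}.
Proof.
(* For th = 0 the level th / l is 0 for every l, and [eta_null] settles it. *)
move=> hth; have [->|th0] := eqVneq th 0%R.
  by apply: aeW => l _; rewrite mul0r.
pose B := [set l | (0 < l)%R /\ 0 < F0 [set v | eta v = (th / l)%R]].
have cB : countable B.
  apply: sub_countable (countable_atoms F0 meta).
  apply: card_le_trans (card_image_le (fun r => th / r)%R _).
  apply: subset_card_le => l [l0 Fl]; exists (th / l)%R => //=.
  by rewrite invf_div mulrCA divff// mulr1.
exists B; split.
- exact: countable_measurable.
- apply: countable_null => // l [l0 Fl]; apply/eqP; rewrite -[_ == _]negbK; apply/negP => Ll.
  apply: hth; exists l.
    move=> cl; move: Ll; apply/negP; rewrite negbK; apply/eqP.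
    by apply: (@continuous_set1_0 _ L) cl => A mA; exact: fin_num_measure.
  exists (th / l)%R; last by rewrite mulrC divfK// gt_eqF.
  rewrite observed_hazard_cdf => /= h.
  by have := continuous_set1_0 mc h; rewrite image_measureE; move: Fl => /[swap] /= ->; rewrite ltxx.
- move=> l /= h; split.
    by apply: contrapT => l0; apply: h => /l0.
  by rewrite lt0e measure_ge0 andbT; apply/eqP => h'; apply: h.
Qed.

Variable bnd : R.
Hypothesis tot_bnd : wtot L id <= bnd%:E.

(** By [level_null], for [L]-almost every l the law of eta under [F0] has no atom at th / l, so the
    integrand is continuous there and dominated convergence applies. *)
Lemma limit_level_continuous (th : R) (u : R^nat) :
  ~ [set l * x | l in discontinuities (dist_fun L) &
       x in discontinuities (observed_hazard_dist F0 eta)]%R th ->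
  u n @[n --> \oo] --> 0%R ->
  limit_level L id F0 eta (th + u n)%R @[n --> \oo] --> limit_level L id F0 eta th.
Proof.
move=> hth u0.
have id0 l : (0 < l)%R -> (0 <= id l :> R)%R by move/ltW.
have levE l x : (0 < l)%R -> (F0 : {finite_measure set R -> \bar R}) [set v | (l * eta v <= x)%R] =
    (fine (image_measure F0 meta `]-oo, (x / l)%R]%classic))%:E.
  move=> l0; rewrite fineK ?mc// image_measureE; congr (F0 _).
  by apply/seteqP; split => v; rewrite /= in_itv/= ler_pdivlMr// mulrC.
apply: (limit_level_cvg _ id0 tot_bnd meta) => //.
  by have := measurable_level (omega := fun=> 1%R) (measurable_cst (1%R : R)) F0 meta th;
    under eq_fun do rewrite mul1e; exact.
apply: filterS (level_null hth) => l hl l0.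
rewrite levE//; under eq_fun do rewrite levE//.
apply: cvg_EFin; first exact: nearW.
have c0 : image_measure F0 meta [set (th / l)%R] = 0 by rewrite image_measureE; exact: hl.
have c1 : ((th + u n) / l)%R @[n --> \oo] --> (th / l)%R.
  apply: cvgM; last exact: cvg_cst.
  by rewrite -[X in _ --> X]addr0; apply: cvgD => //; exact: cvg_cst.
exact: cvg_comp c1 (set1_0_continuous mc c0).
Qed.

End hazard_levels.

(** * The limit of the miss rate *)

Section quantiles.
Context {R : realType} (H : R -> R).
Hypothesis H_nd : {homo H : x y / (x <= y)%R}.
Hypothesis H_top : forall p, (p < 1)%R -> exists x : R, (0 <= x)%R /\ (p <= H x)%R.
Local Notation Q := (quantile H).

Let lbQ p : has_lbound [set x : R | (0 <= x)%R /\ (p <= H x)%R].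
Proof. by exists 0%R => x []. Qed.

Lemma quantile_ge0 p : (0 <= Q p)%R.
Proof.
have [h|/set0P/negP/negPn/eqP h] := pselect ([set x : R | (0 <= x)%R /\ (p <= H x)%R] !=set0).
  by apply: lb_le_inf => // x [].
by rewrite /quantile h inf0.
Qed.

Lemma lt_quantile (p x : R) : (0 <= x)%R -> (x < Q p)%R -> (H x < p)%R.
Proof.
move=> x0 xQ; rewrite ltNge; apply/negP => pH; move: xQ; apply/negP; rewrite -leNgt.
exact: ge_inf.
Qed.

(** Continuity at 1 - c provides p > 1 - c whose quantile is still below the quantile at 1 - c plus
    [e]. This excludes that [H] is flat at the level 1 - c to the right of the quantile. *)
Lemma gt_quantile (c e : R) : (0 < c <= 1)%R ->
  Q p @[p --> within `[0%R, 1%R]%classic (nbhs (1 - c)%R)] --> Q (1 - c)%R ->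
  (0 < e)%R -> (1 - c < H (Q (1 - c)%R + e))%R.
Proof.
move=> /andP[c0 c1] Qc e0.
have /cvgrPdist_lt/(_ e e0) := Qc.
rewrite near_withinE => /nbhs_ballP[r /= r0 hr].
(* The increment is the smaller of r / 2 and c / 2: within the continuity radius, and keeping p
   below 1 so that the set defining its quantile is nonempty. *)
have [p [p1 p2 p3 p4]] : exists p, [/\ (1 - c < p)%R, (p < 1)%R, (0 <= p)%R & (p - (1 - c) < r)%R].
  by have [h|h] := leP (r / 2)%R (c / 2)%R;
    [exists (1 - c + r / 2)%R|exists (1 - c + c / 2)%R]; split; lra.
have : (`|Q (1 - c)%R - Q p| < e)%R.
  apply: hr; last by rewrite /= in_itv/= p3 ltW.
  by rewrite /ball/= ltr_distlC; apply/andP; split; lra.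
rewrite ltr_distlC => /andP[_ Qp].
have [y [y0 py] yQ] := inf_lt (H_top p2) Qp.
by apply: lt_le_trans p1 (le_trans py (H_nd (ltW yQ))).
Qed.

End quantiles.

Lemma squeeze_level (R : realType) (u : nat -> \bar R) (l : R) :
  (forall k, (0 < k)%R -> \forall N \near \oo, (l - k)%:E <= u N <= (l + k)%:E) ->
  u N @[N --> \oo] --> l%:E.
Proof.
move=> h; apply/fine_cvgP; split.
  apply: filterS (h 1%R ltr01) => N /andP[h1 h2]; rewrite fin_numElt.
  by rewrite (lt_le_trans (ltNyr _) h1) (le_lt_trans h2 (ltry _)).
apply/cvgrPdist_le => e e0; apply: filterS (h e e0) => N /= /andP[].
case: (u N) => [r| |]//=; rewrite !lee_fin => h1 h2.
by rewrite ler_distlC h1.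
Qed.

Section limits.
Context (R : realType) d (T : measurableType d) (P : probability T R) (theta : R -> T -> T).
Hypothesis Hflow : measure_preserving_flow P theta.
Variables (F0 : probability R R) (f0 : R -> R).
Hypothesis F0_supp : F0 `]-oo, 0%R[%classic = 0.
Hypothesis F0_density : has_density F0 f0.
Hypothesis F0_mean : \int[F0]_t t%:E = 1.
Variable lam : forall N : nat, 'I_N -> R.
Hypothesis lam0 : forall N (i : 'I_N), (0 < lam i)%R.
Variable Phi : forall N : nat, 'I_N -> R.-ker T ~> R.
Variables (C : nat -> nat) (sel : forall N : nat, ('I_N -> R) -> {set 'I_N}).
Hypothesis Hren : forall N (i : 'I_N), stationary_renewal P theta (Phi i).
Hypothesis intPhi : forall N (i : 'I_N), intensity P (fun w => Phi i w) = (lam i)%:E.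
Hypothesis interPhi : forall N (i : 'I_N), has_interarrival_dist P theta (Phi i) F0 (lam i).
Hypothesis indPhi : forall N, independent_pps P (@Phi N).
Hypothesis Hsel : forall N, (1 < N)%N -> largest_selection (C N) (@sel N).
Variable L : probability R R.
Hypothesis L_supp : L `]-oo, 0%R[%classic = 0.
Hypothesis L_atom : L [set 0%R] = 0.
Hypothesis L_weak : cvg_weakly (fun N => empirical_dist (@lam N)) (dist_fun L).
Hypothesis UI : rates_uniformly_integrable (@lam).

Local Notation eta := (hazard F0 f0).
Let meta : measurable_fun setT eta := measurable_hazard F0_density.

Let age_fm : fin_num_fun (age_measure F0).
Proof.
move=> A mA; rewrite ge0_fin_numE//; apply: (@le_lt_trans _ _ (age_measure F0 setT)).
  by apply: le_measure; rewrite ?inE.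
by rewrite age_measureT// ltry.
Qed.

Let age : {finite_measure set R -> \bar R} := finite_measure_of age_fm.

Let ageT : age setT = 1. Proof. exact: age_measureT. Qed.

Let one : R -> R := fun=> 1%R.
Let mone : measurable_fun setT one. Proof. exact: measurable_cst. Qed.
Let one0 l : (0 < l)%R -> (0 <= one l)%R. Proof. by []. Qed.

Let one_tot : wtot L one = 1.
Proof.
rewrite /wtot -(measure_pos L_supp L_atom) -[X in _ = L X]setIT -integral_indic//.
apply: eq_integral => l _; by rewrite mul1r indicE mem_setE in_itv/= andbT.
Qed.

Let one_tot_bnd : wtot L one <= 1%:E. Proof. by rewrite one_tot. Qed.

Let one_cvg c : L [set c] = 0 ->
  (wavg (@lam) one N c 1)%:E @[N --> \oo] --> wcdf L one c 1.
Proof. exact: unit_avg_cvg. Qed.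

Let one_avg N : (0 < N)%N -> (N%:R^-1 * \sum_(i < N) one (lam i) = 1)%R.
Proof. by move=> N0; rewrite sumr_const card_ord mulVf// pnatr_eq0 -lt0n. Qed.

Let one_avg' N : (0 < N)%N -> (N%:R^-1 * \sum_(i < N) one (lam i) <= 1)%R.
Proof. by move=> /one_avg ->. Qed.

Let one_good : {ae age, forall v, good L (@lam) one (eta v)}.
Proof.
apply: aeW => v; have := hazard_ge0 F0_density v; rewrite [(0 <= _)%R]le_eqVlt => /predU1P[<-|h];
  last by left.
right; split => //; rewrite one_tot; apply: cvg_near_cst.
by exists 1%N => // N /= N0; rewrite one_avg.
Qed.

Let id0 (l : R) : (0 < l)%R -> (0 <= id l)%R. Proof. exact: ltW. Qed.

Let id_good : {ae F0, forall v, good L (@lam) id (eta v)}.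
Proof.
exists [set t | eta t = 0%R]; split.
- by rewrite -[X in measurable X]setTI; exact: (meta measurableT (measurable_set1 0%R)).
- exact: hazard_eq0_null.
- move=> v /= h; apply/eqP; rewrite eq_le hazard_ge0// andbT leNgt; apply/negP => h0.
  by apply: h; left.
Qed.

Local Notation H := (limit_hazard_dist (observed_hazard_dist (age_dist F0) eta) L).

Let lamE (nu : {finite_measure set R -> \bar R}) (l x : R) : (0 < l)%R ->
  nu [set v | (eta v <= x / l)%R] = nu [set v | (l * eta v <= x)%R].
Proof.
by move=> l0; congr (nu _); apply/seteqP; split => v /=; rewrite ler_pdivlMr// mulrC.
Qed.

Let mlev (l x : R) : measurable [set v | (l * eta v <= x)%R].
Proof.
apply: measurable_le_set; last exact: measurable_cst.
by apply: measurable_funM => //; exact: measurable_cst.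
Qed.

Lemma limit_hazard_distE x : (H x)%:E = limit_level L one age eta x.
Proof.
have -> : H x = fine (limit_level L one age eta x).
  congr fine; apply: eq_integral => l /set_mem; rewrite /= in_itv/= andbT => l0.
  rewrite observed_age_hazard_distE//; last exact: hazard_ge0.
  transitivity (age [set v | (eta v <= x / l)%R]); last by rewrite mul1e; exact: (lamE age).
  rewrite fineK//; apply: age_fm; rewrite (_ : [set v | _] = [set v | (1 * eta v <= x / l)%R]) ?mlev//.
  by apply/seteqP; split => v /=; rewrite mul1r.
by rewrite fineK//; exact: (limit_level_fin mone one0 one_tot_bnd).
Qed.

Let H_nd : {homo H : x y / (x <= y)%R}.
Proof.
by move=> x y xy; rewrite -lee_fin !limit_hazard_distE; exact: (le_limit_level L one0).
Qed.

Let H_top p : (p < 1)%R -> exists x : R, (0 <= x)%R /\ (p <= H x)%R.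
Proof.
move=> p1.
have : limit_level L one age eta n%:R @[n --> \oo] --> \int[L]_(l in `]0%R, +oo[) ((one l)%:E * age setT).
  apply: (limit_level_cvg mone one0 one_tot_bnd meta (h := fun=> age setT)) => //.
  apply: aeW => l l0.
  rewrite (_ : setT = \bigcup_n [set v | (l * eta v <= n%:R)%R]).
    apply: nondecreasing_cvg_mu => //; first exact: bigcup_measurable.
    move=> m n mn; apply/subsetPset => v /= /le_trans; apply; rewrite ler_nat//.
  by apply/seteqP; split => // v _; exists (Num.truncn `|l * eta v|%R).+1 => //=;
    rewrite (le_trans (ler_norm _))// ltW// truncnS_gt.
rewrite (eq_integral (cst 1)); last by move=> l _; rewrite ageT mule1.
rewrite integral_cst// mul1e => h.
have : (H n%:R)%:E @[n --> \oo] --> 1%:E.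
  rewrite -(measure_pos L_supp L_atom); apply: cvg_trans h; apply: near_eq_cvg.
  by apply: nearW => n; rewrite -limit_hazard_distE.
move=> /fine_cvg h1.
have [n _ hn] := cvgr_gt _ h1 _ p1.
by exists n%:R; split=> //; apply: ltW; exact: (hn n (leqnn n)).
Qed.

Local Notation a N x := (avg_level (@lam) one age eta N x).
Local Notation B N x := (avg_level (@lam) id F0 eta N x).
Local Notation M N := (miss_rate P (@lam N) (@Phi N)
  (optimal_policy eta (@lam N) (@Phi N) (@sel N)) * (N%:R^-1)%:E).

Let sum_p N (x : R) : (0 < N)%N ->
  (\sum_(j < N) fine (age_measure F0 [set v | (x < lam j * eta v)%R]) = N%:R * (1 - a N x))%R.
Proof.
move=> N0; have Nn : N%:R != 0%R :> R by rewrite pnatr_eq0 -lt0n.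
rewrite /avg_level mulrBr mulr1 mulrA mulfV// mul1r.
rewrite -[X in (X%:R - _)%R]card_ord -sumr_const -sumrB; apply: eq_bigr => j _.
rewrite mul1r (_ : [set v | (x < _)%R] = setT `\` [set v | (lam j * eta v <= x)%R]); last first.
  by apply/seteqP; split => v /=; rewrite ltNge; [move=> /negP|move=> [_ /negP]].
rewrite measureD//; last by rewrite -ge0_fin_numE//; exact: age_fm.
rewrite setTI fineB//; [|exact: age_fm|exact: age_fm].
by congr (_ - _)%R; exact: (congr1 fine ageT).
Qed.

Variable bnd : R.
Hypothesis avg_bnd : forall N, (0 < N)%N -> (N%:R^-1 * \sum_(i < N) lam i <= bnd)%R.

(** Chebyshev's error for a deviation e = N delta: divided by N, it is of order 1/N because the mean
    rate is bounded. *)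
Let error_le N (delta : R) : (0 < N)%N -> (0 < delta)%R ->
  ((N%:R / (N%:R * delta) ^+ 2 * \sum_(i < N) lam i) * N%:R^-1 <= bnd / (N%:R * delta ^+ 2))%R.
Proof.
move=> N0 d0; have Np : (0 < N%:R :> R)%R by rewrite ltr0n.
rewrite ler_pdivlMr; last by rewrite mulr_gt0// exprn_gt0.
apply: le_trans (avg_bnd N0); rewrite le_eqVlt; apply/orP; left; apply/eqP; field.
by rewrite !gt_eqF.
Qed.

Let miss_upper N (x delta : R) : (1 < N)%N -> (0 < delta)%R ->
  (1 - a N x + delta <= (C N)%:R / N%:R)%R ->
  M N <= (B N x + bnd / (N%:R * delta ^+ 2))%:E.
Proof.
move=> N1 d0; have N0 : (0 < N)%N by exact: ltnW.
have Np : (0 < N%:R :> R)%R by rewrite ltr0n.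
rewrite ler_pdivlMr// => h.
have h1 := miss_rate_le Hflow F0_supp (density_set1 F0_density) F0_mean (@lam0 N) (@Hren N)
  (@intPhi N) (@interPhi N) (@indPhi N) meta (Hsel N1) (x := x) (e := (N%:R * delta)%R).
apply: (@le_trans _ _ ((\sum_(j < N) lam j * fine (F0 [set v | (lam j * eta v <= x)%R])
    + N%:R / (N%:R * delta) ^+ 2 * \sum_(j < N) lam j)%:E * (N%:R^-1)%:E)).
  apply: lee_wpmul2r; first by rewrite lee_fin invr_ge0.
  apply: h1; first exact: mulr_gt0.
  by rewrite sum_p// -mulrDr mulrC.
rewrite -EFinM lee_fin mulrDl; apply: lerD; last exact: error_le.
by rewrite mulrC.
Qed.

Let miss_lower N (x delta : R) : (1 < N)%N -> (0 < delta)%R ->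
  ((C N)%:R / N%:R + delta <= 1 - a N x - N%:R^-1)%R ->
  (B N x - bnd / (N%:R * delta ^+ 2))%:E <= M N.
Proof.
move=> N1 d0; have N0 : (0 < N)%N by exact: ltnW.
have Np : (0 < N%:R :> R)%R by rewrite ltr0n.
move=> h.
have h1 := miss_rate_ge Hflow F0_supp (density_set1 F0_density) F0_mean (@lam0 N) (@Hren N)
  (@intPhi N) (@interPhi N) (@indPhi N) meta (Hsel N1) (x := x) (e := (N%:R * delta)%R).
apply: (@le_trans _ _ ((\sum_(j < N) lam j * fine (F0 [set v | (lam j * eta v <= x)%R])
    - N%:R / (N%:R * delta) ^+ 2 * \sum_(j < N) lam j)%:E * (N%:R^-1)%:E)); last first.
  apply: lee_wpmul2r; first by rewrite lee_fin invr_ge0.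
  apply: h1; first exact: mulr_gt0.
  have := ler_wpM2l (ltW Np) h.
  by rewrite sum_p// mulrDr mulrCA mulfV ?gt_eqF// mulr1 mulrBr mulfV ?gt_eqF.
rewrite -EFinM lee_fin mulrBl; apply: lerB; last exact: error_le.
by rewrite mulrC.
Qed.

Let error_small (delta k : R) : (0 < delta)%R -> (0 < k)%R ->
  \forall N \near \oo, (bnd / (N%:R * delta ^+ 2) <= k)%R.
Proof.
move=> d0 k0; have d2 : (0 < delta ^+ 2)%R by rewrite exprn_gt0.
near=> N.
have N0 : (0 < N)%N by near: N; exists 1%N.
have Np : (0 < N%:R :> R)%R by rewrite ltr0n.
rewrite ler_pdivrMr; last by rewrite mulr_gt0.
rewrite mulrCA -ler_pdivrMr; last by rewrite mulr_gt0.
by near: N; exact: nbhs_infty_ger.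
Unshelve. all: by end_near. Qed.

Let id_tot_bnd : wtot L id <= bnd%:E.
Proof. exact: (mean_rate_limit L_supp L_atom lam0 L_weak avg_bnd). Qed.

Let id_cvg c : L [set c] = 0 -> (wavg (@lam) id N c 1)%:E @[N --> \oo] --> wcdf L id c 1.
Proof. exact: id_avg_cvg. Qed.

Local Notation S x := (fine (limit_level L id F0 eta x)).

Let SE x : (S x)%:E = limit_level L id F0 eta x.
Proof. by rewrite fineK//; exact: (limit_level_fin _ id0 id_tot_bnd). Qed.

Variable c : R.
Hypothesis Hc : (0 < c <= 1)%R.
Local Notation th := (quantile H (1 - c)%R).
Hypothesis Qcont :
  quantile H p @[p --> within `[0%R, 1%R]%classic (nbhs (1 - c)%R)] --> th.
Hypothesis th_regular :
  ~ [set l * x | l in discontinuities (dist_fun L) &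
       x in discontinuities (observed_hazard_dist F0 eta)]%R th.
Hypothesis Ccvg : ((C N)%:R / N%:R)%R @[N --> \oo] --> c.

Let S_cvg (u : R^nat) : u n @[n --> \oo] --> 0%R -> S (th + u n)%R @[n --> \oo] --> S th.
Proof.
move=> u0; apply: fine_cvg; rewrite SE.
apply: (limit_level_continuous F0_supp meta _ _ id_tot_bnd) => //; first exact: hazard_ge0.
exact: hazard_eq0_null.
Qed.

Let limit_upper (k : R) : (0 < k)%R -> \forall N \near \oo, M N <= (S th + k)%:E.
Proof.
move=> k0.
(* The tolerance k is split in three: continuity of the limit, comparison of averages with limits,
   and Chebyshev's error. *)
have [e [e0 Se]] : exists e : R, (0 < e)%R /\ (S (th + e) <= S th + k / 3)%R.
  have h : (S th < S th + k / 3)%R by lra.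
  have [n _ hn] := cvgr_lt _ (S_cvg (@cvg_harmonic R)) _ h.
  exists (n.+1%:R^-1)%R; split; first by rewrite invr_gt0.
  apply: ltW; exact: (hn n (leqnn n)).
have e4 : (0 < e / 4)%R by lra.
(* Averages are evaluated at th + e / 2, strictly between th + e / 4, where [H] exceeds 1 - c, and
   th + e, where the limit is controlled: both comparisons need distinct levels. *)
have HQ := gt_quantile H_nd H_top Hc Qcont e4.
(* A third of the margin each for the average of the age probabilities, for C_N / N against c, and
   for the Chebyshev deviation. *)
pose delta := ((H (th + e / 4) - (1 - c)) / 3)%R.
have d0 : (0 < delta)%R by rewrite /delta; lra.
have k3 : (0 < k / 3)%R by lra.
near=> N.
have N1 : (1 < N)%N by near: N; exists 2%N.
have aN : (H (th + e / 4) <= a N (th + e / 2) + delta)%R.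
  rewrite -lee_fin limit_hazard_distE EFinD; near: N.
  apply: (avg_level_ge lam0 mone one0 one_tot_bnd one_cvg meta one_good) => //; lra.
have BN : (B N (th + e / 2) <= S (th + e) + k / 3)%R.
  rewrite -lee_fin EFinD SE; near: N.
  apply: (avg_level_le lam0 _ id0 avg_bnd id_tot_bnd id_cvg meta id_good) => //; lra.
have CN : (`|c - (C N)%:R / N%:R| <= delta)%R.
  by near: N; move/cvgrPdist_le : Ccvg; exact.
have EN : (bnd / (N%:R * delta ^+ 2) <= k / 3)%R by near: N; exact: error_small.
apply: le_trans (miss_upper N1 d0 (x := (th + e / 2)%R) _) _.
  move: CN; rewrite ler_distlC => /andP[CN _].
  by move: (aN) (CN) (d0); rewrite /delta; lra.
by rewrite lee_fin; lra.
Unshelve. all: by end_near. Qed.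

Let limit_lower (k : R) : (0 < k)%R -> \forall N \near \oo, (S th - k)%:E <= M N.
Proof.
move=> k0; have := quantile_ge0 H (1 - c)%R.
(* At threshold 0 only the null event eta = 0 contributes, so the limit is 0 and positivity of the
   miss rate is enough. *)
rewrite [(0 <= _)%R]le_eqVlt => /predU1P[th0|thp].
  have -> : S th = 0%R.
    rewrite -th0 (_ : limit_level _ _ _ _ _ = 0)//; apply: integral0_eq => l;
      rewrite /= in_itv/= andbT => l0.
    rewrite (_ : [set v | _] = [set v | eta v = 0%R]) ?hazard_eq0_null ?mule0//.
    apply/seteqP; split => v /=; last by move=> ->; rewrite mulr0.
    rewrite pmulr_rle0// => h; apply/eqP; rewrite eq_le h; exact: hazard_ge0.
  near=> N.
  have N1 : (1 < N)%N by near: N; exists 2%N.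
  apply: (@le_trans _ _ 0); first by rewrite lee_fin sub0r oppr_le0 ltW.
  apply: mule_ge0; last by rewrite lee_fin invr_ge0.
  exact: (miss_rate_ge0 (@Hren N) (@intPhi N)).
(* Taking e < th keeps th - e / 4 nonnegative, as [quantile] only inspects nonnegative arguments. *)
have [e [e0 eth Se]] : exists e : R, [/\ (0 < e)%R, (e < th)%R & (S th - k / 3 <= S (th - e))%R].
  have h : (S th - k / 3 < S th)%R by lra.
  have hN : (- n.+1%:R^-1 : R)%R @[n --> \oo] --> 0%R.
    by rewrite -oppr0; apply: cvgN; exact: cvg_harmonic.
  have [n _ hn] := cvgr_gt _ (S_cvg hN) _ h.
  have [m _ hm] := cvgr_lt _ (@cvg_harmonic R) _ thp.
  exists ((maxn m n).+1%:R^-1)%R; split; first by rewrite invr_gt0.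
    exact: (hm _ (leq_maxl _ _)).
  by apply: ltW; exact: (hn _ (leq_maxr _ _)).
have HQ : (H (th - e / 4) < 1 - c)%R.
  apply: lt_quantile; first by move: eth e0; lra.
  by move: eth e0; lra.
(* A quarter of the margin each: the three uses of the upper bound, and 1/N for the item excluded
   from its own competitors. *)
pose delta := ((1 - c - H (th - e / 4)) / 4)%R.
have d0 : (0 < delta)%R by rewrite /delta; lra.
have k3 : (0 < k / 3)%R by lra.
near=> N.
have N1 : (1 < N)%N by near: N; exists 2%N.
have aN : (a N (th - e / 2) <= H (th - e / 4) + delta)%R.
  rewrite -lee_fin EFinD limit_hazard_distE; near: N.
  apply: (avg_level_le lam0 mone one0 one_avg' one_tot_bnd one_cvg meta one_good) => //; lra.
have BN : (S (th - e) <= B N (th - e / 2) + k / 3)%R.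
  rewrite -lee_fin EFinD SE; near: N.
  apply: (avg_level_ge lam0 _ id0 id_tot_bnd id_cvg meta id_good) => //; lra.
have CN : (`|c - (C N)%:R / N%:R| <= delta)%R.
  by near: N; move/cvgrPdist_le : Ccvg; exact.
have IN : (N%:R^-1 <= delta)%R.
  rewrite invf_ple ?posrE ?ltr0n ?(ltnW N1)//.
  by near: N; exact: nbhs_infty_ger.
have EN : (bnd / (N%:R * delta ^+ 2) <= k / 3)%R by near: N; exact: error_small.
apply: le_trans _ (miss_lower N1 d0 (x := (th - e / 2)%R) _).
  by rewrite lee_fin; lra.
move: CN; rewrite ler_distlC => /andP[_ CN].
by move: (aN) (CN) (IN) (d0); rewrite /delta; lra.
Unshelve. all: by end_near. Qed.

Lemma miss_rate_limit : M N @[N --> \oo] --> limit_level L id F0 eta th.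
Proof.
rewrite -SE; apply: squeeze_level => k k0; near=> N; apply/andP; split.
  by near: N; exact: limit_lower.
by near: N; exact: limit_upper.
Unshelve. all: by end_near. Qed.

End limits.

Local Close Scope ereal_scope.

Theorem theorem3 (R : realType) (d : measure_display) (T : measurableType d)
  (P : probability T R) (theta : R -> T -> T)
  (Hflow : measure_preserving_flow P theta)
  (F0 : probability R R) (f0 : R -> R)
  (HF0_supp : F0 `]-oo, 0[%classic = 0%E)
  (HF0_density : has_density F0 f0)
  (HF0_mean : (\int[F0]_t t%:E = 1)%E)
  (lam : forall N : nat, 'I_N -> R)
  (Phi : forall N : nat, 'I_N -> R.-ker T ~> R)
  (C : nat -> nat)
  (sel : forall N : nat, ('I_N -> R) -> {set 'I_N})
  (HC : forall N : nat, (1 < N)%N -> (1 <= C N < N)%N)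
  (Hlam_pos : forall (N : nat) (i : 'I_N), 0 < lam N i)
  (Hlam_dec : forall (N : nat) (i j : 'I_N),
    (i <= j)%N -> lam N j <= lam N i)
  (Hrenewal : forall (N : nat) (i : 'I_N),
    stationary_renewal P theta (Phi N i))
  (Hintensity : forall (N : nat) (i : 'I_N),
    intensity P (fun w => Phi N i w) = (lam N i)%:E)
  (Hinterarrival : forall (N : nat) (i : 'I_N),
    has_interarrival_dist P theta (Phi N i) F0 (lam N i))
  (Hindep : forall N : nat, independent_pps P (Phi N))
  (Hsel : forall N : nat, (1 < N)%N -> largest_selection (C N) (sel N))
  (L : probability R R)
  (HL_supp : L `]-oo, 0[%classic = 0%E)
  (HL_weak : cvg_weakly (fun N => empirical_dist (lam N)) (dist_fun L))
  (HL_atom : L [set 0] = 0%E)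
  (Hties : forall (N : nat) (i j : 'I_N), i != j ->
    palm P theta (superposition (Phi N))
      [set w | observed_rate (hazard F0 f0) (lam N i) (Phi N i) 0 w =
               observed_rate (hazard F0 f0) (lam N j) (Phi N j) 0 w] = 0%E)
  (HUI : rates_uniformly_integrable lam)
  (c : R) (Hc : 0 < c <= 1) :
  let eta := hazard F0 f0 in
  let G := observed_hazard_dist (age_dist F0) eta in
  let G0 := observed_hazard_dist F0 eta in
  let Q := quantile (limit_hazard_dist G L) in
  let thetastar := Q (1 - c) in
  Q p @[p --> within `[0, 1]%classic (nbhs (1 - c))] --> Q (1 - c) ->
  ~ [set l * x | l in discontinuities (dist_fun L) & x in discontinuities G0]
      thetastar ->
  (C N)%:R / N%:R @[N --> \oo] --> c ->
  (miss_rate P (lam N) (Phi N)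
     (optimal_policy eta (lam N) (Phi N) (sel N)) * (N%:R^-1)%:E)%E
    @[N --> \oo] -->
  (\int[L]_(l in `]0%R, +oo[%classic) (l * G0 (thetastar / l))%:E)%E.
Proof.
move=> eta G G0 Q thetastar Qcont hreg Ccvg.
(* The bound on the mean rate controls the Chebyshev error and provides the dominating constant for
   the averages with weight l. *)
have [bnd hbnd] := mean_rate_bounded HUI.
have := miss_rate_limit Hflow HF0_supp HF0_density HF0_mean Hlam_pos Hrenewal Hintensity
  Hinterarrival Hindep Hsel HL_supp HL_atom HL_weak hbnd Hc Qcont hreg Ccvg.
rewrite (_ : limit_level _ _ _ _ _ = (\int[L]_(l in `]0%R, +oo[%classic) (l * G0 (thetastar / l))%:E)%E) //.
apply: eq_integral => l /set_mem; rewrite /= in_itv/= andbT => l0.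
rewrite EFinM; congr (_ * _)%E.
rewrite /G0 observed_hazard_distE//; last 2 first.
- exact: measurable_hazard HF0_density.
- exact: hazard_ge0 HF0_density.
rewrite fineK; last first.
  apply: fin_num_measure.
  by apply: measurable_le_set; [exact: measurable_hazard HF0_density|exact: measurable_cst].
congr (F0 _); apply/seteqP; split => v /=; by rewrite ler_pdivlMr// mulrC.
Qed.
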